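(* Let $\Gamma$ be a finite group, $\lambda\in\mathcal P(\Gamma_* )$ and $r\ge0$. Then the product $K_\lambda K_{(r)_{c^0}}$ in the Farahat–Higman ring $\mathcal G_\Gamma$ is \begin{align*} K_\lambda K_{(r)_{c^0}} &=\sum_{I_1}\frac{\bigl(m_{\|\mu\|+r}(\lambda(c^0))+1\bigr)(\|\mu\|+r+1)\, r!}{(r+1-\ell(\mu))!\prod_{i\ge1}m_i(\mu)!}\,K_{\lambda\cup(\|\mu\|+r)_{c^0}-\mu}\\ &+\sum_{I_2}\frac{\bigl(m_{\|\mu\|+r+k}(\lambda(c))+1\bigr)(\|\mu\|+r+k)\, r!}{(r-\ell(\mu))!\prod_{i\ge1}m_i(\mu)!}\,K_{\lambda\cup(\|\mu\|+r+k)_c-(\mu\cup(k)_c)}\\ &+\sum_{I_3}s_1s_2\,\zeta_c\,p(\mu,r,s_1)\,(m_{s_1}(\lambda(c))+1)(m_{s_2}(\lambda(\bar c))+1)\,K_{\lambda\cup(s_1)_c\cup(s_2)_{\bar c}-\mu}\\ &+\sum_{I_4}s^2\,\zeta_c\,p(\mu,r,s)\,(m_s(\lambda(c))+1)(m_s(\lambda(\bar c))+1)\,K_{\lambda\cup(s)_c\cup(s)_{\bar c}-\mu}\\ &+\sum_{I_5}s^2\,\zeta_c\,p(\mu,r,s)\binom{m_s(\lambda(c))+2}{2}\,K_{\lambda\cup(s)_c\cup(s)_c-\mu}, \end{align*} where $\mu=(1^{m_1(\mu)}2^{m_2(\mu)}\cdots)$ and $I_1=\{\mu\mid \mu=\mu(c^0)\subset\lambda(c^0),\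 \ell(\mu)\le r+1\}$; $I_2=\{(c,\mu,k)\mid c\ne c^0,\ \mu=\mu(c^0)\subset\lambda(c^0),\ \ell(\mu)\le r,\ (k)_c\subset\lambda(c),\ k\ge1\}$; $I_3=\{(c,\mu,s_1,s_2)\mid c\ne c^0,\ \mu=\mu(c^0)\subset\lambda(c^0),\ \ell(\mu)\le r,\ 0<s_1<s_2,\ s_1+s_2=\|\mu\|+r\}$; $I_4=\{(\{c,\bar c\},\mu,s)\mid c\ne\bar c,\ \mu=\mu(c^0)\subset\lambda(c^0),\ \ell(\mu)\le r,\ 2s=\|\mu\|+r\}$; $I_5=\{(c,\mu,s)\mid c=\bar c,\ c\ne c^0,\ \mu=\mu(c^0)\subset\lambda(c^0),\ \ell(\mu)\le r,\ 2s=\|\mu\|+r\}$. Here $\{c,\bar c\}$ denotes an unordered pair of conjugacy classes in $\Gamma_*$.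
   Context: $\Gamma_*$ is the set of conjugacy classes of $\Gamma$, $c^0=\{1\}$, $\zeta_c$ is the order of the centralizer of an element of $c$, and $\bar c=\{x\mid x^{-1}\in c\}$. $S_n$ acts on $\Gamma^n$ by $\sigma(g_1,\dots,g_n)=(g_{\sigma^{-1}(1)},\dots,g_{\sigma^{-1}(n)})$, and $\Gamma_n=\Gamma^n\rtimes S_n$ with $(g,\sigma)(h,\tau)=(g\,\sigma(h),\sigma\tau)$. For $x=(g,\sigma)$ and a cycle $(i_1\cdots i_k)$ of $\sigma$ (fixed points are 1-cycles), the cycle-product is $g_{i_k}\cdots g_{i_1}$, well defined up to conjugacy. For a partition $\mu$: $|\mu|$ is the sum of its parts, $\ell(\mu)$ the number of parts, $m_i(\mu)$ the number of parts equal to $i$. For partitions, $\mu\subset\lambda$ means that $\mu$ consists of some of the parts of $\lambda$ (the empty partition is allowed); $\lambda\cup\mu$ is the multiset union of parts, and $\lambda-\mu$ is obtained by removing the parts of $\mu$. $\mathcal P(\Gamma_* )$ is the set of partition-valued functions on $\Gamma_*$, with $\subset$, $\cup$, $-$ pointwise and $\|\lambda\|=\sum_c|\lambda(c)|$. Writing $\mu=\mu(c^0)$ means that $\mu\in\mathcal P(\Gamma_* )$ is supported at $c^0$; it is then identified with the partition $\mu(c^0)$, so $\|\mu\|=|\mu|$. For $k\ge1$, $(k)_c\in\mathcal P(\Gamma_* )$ has the one-part partition $(k)$ at $c$ and empty partitions elsewhere, so $(k)_c\subset\lambda(c)$ means that $k$ is a part of $\lambda(c)$; $(0)_{c^0}$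 is the empty family, and $K_{(0)_{c^0}}=K_\emptyset$ is the identity of the ring below. Given a partition $\mu=(\mu_1,\dots,\mu_k)$ with $k=\ell(\mu)\le r$, let $\tilde\mu=(\mu_1+1,\dots,\mu_k+1,1,\dots,1)$, a partition of $|\mu|+r$ with exactly $r$ parts. For $s>0$, $p(\mu,r,s)$ is the number of compositions $(b_1,\dots,b_r)$ obtained by rearranging the $r$ parts of $\tilde\mu$ (counted without multiplicities) such that $s$ is not one of the $r$ partial sums $b_1+\cdots+b_a$, $a=1,\dots,r$; it is zero unless $0<s<|\mu|+r$. The type $\rho$ of $x\in\Gamma_n$: $m_i(\rho(c))$ is the number of $i$-cycles of $\sigma$ with cycle-product in $c$. The modified type $\lambda$: $\lambda(c)=\rho(c)$ for $c\ne c^0$, and $\lambda(c^0)$ is obtained from $\rho(c^0)$ by subtracting 1 from every part (zeros discarded). $K_\lambda(n)\in\mathbb Z[\Gamma_n]$ is the sum of all elements of $\Gamma_n$ of modified type $\lambda$; it is nonzero iff $\|\lambda\|+\ell(\lambda(c^0))\le n$, and the nonzero ones form a $\mathbb Z$-basis of the center of $\mathbb Z[\Gamma_n]$. Write $K_\lambda(n)K_\mu(n)=\sum_\nu a_{\lambda\mu}^\nu(n)K_\nu(n)$. When $\|\nu\|=\|\lambda\|+\|\mu\|$, the number $a_{\lambda\mu}^\nu(n)$ is the same for all $n\ge\|\nu\|+\ell(\nu(c^0))$ and is denoted $a_{\lambda\mu}^\nu$. The Farahat–Higman ring $\mathcal G_\Gamma$ is the commutative ring with $\mathbb Z$-basis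 $(K_\lambda)_{\lambda\in\mathcal P(\Gamma_* )}$ and multiplication $K_\lambda K_\mu=\sum_{\|\nu\|=\|\lambda\|+\|\mu\|}a_{\lambda\mu}^\nu K_\nu$.
   Formalization: The displayed formula is proved for r ≥ 1; for r = 0 it is false for nonempty λ (for λ = (1)_{c^0} the right side is at least 5K_λ), so there the correct value K_λ K_{(0)_{c^0}} = K_λ is stated and proved instead. *)

(* Defs.v *)
From HB Require Import structures.
From mathcomp Require Import all_boot all_order all_algebra all_fingroup.
From mathcomp Require Import finmap monalg.

Set Implicit Arguments.
Unset Strict Implicit.
Unset Printing Implicit Defensive.

Import GRing.Theory.

(* A partition is the weakly decreasing sequence of its (positive) parts, so
   Leibniz equality of partitions is equality of multisets of parts. *)
Definition is_partn (s : seq nat) : bool := sorted geq s && (0 \notin s).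

Record partn := Partn {parts :> seq nat; partsP : is_partn parts}.

HB.instance Definition _ := [isSub for parts].
HB.instance Definition _ := [Countable of partn by <:].

Lemma mkpartn_subproof (s : seq nat) :
  is_partn (sort geq [seq k <- s | k != 0]).
Proof.
rewrite /is_partn sort_sorted /=; last by move=> i j; apply: leq_total.
by rewrite mem_sort mem_filter eqxx.
Qed.

(* Zero entries are discarded; in particular [mkpartn [:: 0]] is empty. *)
Definition mkpartn (s : seq nat) : partn := Partn (mkpartn_subproof s).

Definition mult (k : nat) (m : partn) : nat := count_mem k m.
Definition psize (m : partn) : nat := sumn m.

Definition psub (m l : partn) : bool := all (fun k => mult k m <= mult k l) m.
Definition punion (l m : partn) : partn := mkpartn (l ++ m).
Definition pdiff (l m : partn) : partn :=
  mkpartn (foldr (fun k s => rem k s) l m).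

Lemma mult0 (m : partn) : mult 0 m = 0.
Proof. by have /andP[_ ?] := partsP m; apply/count_memPn. Qed.

Lemma mult_mkpartn (k : nat) (s : seq nat) :
  mult k (mkpartn s) = (k != 0) * count_mem k s.
Proof.
rewrite /mult /= count_sort count_filter.
case: (eqVneq k 0) => [->|k0] /=.
  by rewrite mul0n -[RHS](count_pred0 s); apply: eq_count => -[].
by rewrite mul1n; apply: eq_count => i /=; case: eqVneq => // ->.
Qed.

Lemma partn_eq (l m : partn) : (forall k, mult k l = mult k m) -> l = m.
Proof.
move=> e; apply/val_inj/(@sorted_eq _ geq).
- by move=> j i k /= ? /leq_trans; apply.
- by move=> i j /= /andP[? ?]; apply/eqP; rewrite eqn_leq; apply/andP.
- by have /andP[] := partsP l.
- by have /andP[] := partsP m.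
- by apply/allP => k _; apply/eqP/e.
Qed.

Lemma psubP (m l : partn) :
  reflect (forall k, mult k m <= mult k l) (psub m l).
Proof.
apply: (iffP allP) => [h k|h k _]; last exact: h.
case: (boolP (k \in parts m)) => [/h //|/count_memPn].
by rewrite /mult => ->.
Qed.

Lemma mult_punion k l m : mult k (punion l m) = mult k l + mult k m.
Proof.
rewrite mult_mkpartn count_cat; case: (eqVneq k 0) => [->|_].
  by rewrite !mult0.
by rewrite mul1n.
Qed.

Lemma mult_pdiff k l m : mult k (pdiff l m) = mult k l - mult k m.
Proof.
have E (t : seq nat) :
    count_mem k (foldr (fun k s => rem k s) (parts l) t)
    = count_mem k (parts l) - count_mem k t.
  elim: t => [|x t IH] /=; first by rewrite subn0.
  rewrite count_rem /= IH; case: (eqVneq x k) => [e|_]; last first.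
    by rewrite andbF subn0 add0n.
  rewrite e andbT add1n -addn1 subnDA.
  by case: (boolP (k \in _)) => // /count_memPn; rewrite IH => ->.
rewrite mult_mkpartn E; case: (eqVneq k 0) => [->|_]; first by rewrite !mult0.
by rewrite mul1n.
Qed.

Definition subpartns (l : partn) : seq partn :=
  undup [seq mkpartn (mask b l) | b : (size l).-tuple bool].

Lemma mem_subpartns (m l : partn) : (m \in subpartns l) = psub m l.
Proof.
rewrite mem_undup; apply/imageP/psubP => [[b _ ->] k|h].
  rewrite mult_mkpartn; apply: leq_trans (leq_count_mask _ b l).
  by case: (k != 0); rewrite ?mul1n ?mul0n.
have gtr : transitive geq by move=> j i n /= ? /leq_trans; apply.
have : subseq m l.
  have /count_subseqP[s ss] : forall k, count_mem k m <= count_mem k l by [].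
  rewrite perm_sym => es; rewrite -(@sorted_eq _ geq gtr _ s m _ _ es) //.
  - by move=> i j /= /andP[? ?]; apply/eqP; rewrite eqn_leq; apply/andP.
  - by apply: subseq_sorted ss _ => //; case: l {h} => t /= /andP[].
  - by have /andP[] := partsP m.
case/subseqP=> b sb eb; exists (tcast sb (in_tuple b)) => //.
apply: partn_eq => k; rewrite mult_mkpartn val_tcast /= -eb -/(mult k m).
by case: (eqVneq k 0) => [->|_]; rewrite ?mult0 ?mul1n.
Qed.

(* The range suffices: every part of [m] is at most [psize m]. *)
Definition mfact (m : partn) : nat :=
  \prod_(1 <= i < (psize m).+1) (mult i m)`!.

Lemma big_parts (m : partn) (F : nat -> nat) :
  \sum_(k <- m) F k = \sum_(1 <= i < (psize m).+1) F i * mult i m.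
Proof.
have H (s : seq nat) (j : nat) : {in s, forall x, 0 < x <= j} ->
    \sum_(k <- s) F k = \sum_(1 <= i < j.+1) F i * count_mem i s.
  elim: s => [|x s IH] h; first by rewrite big_nil big1 // => i _; rewrite muln0.
  rewrite big_cons IH => [|y ys]; last by apply: h; rewrite inE ys orbT.
  under [RHS]eq_bigr do rewrite /= mulnDr.
  rewrite big_split /=; congr addn; rewrite (bigD1_seq x) ?iota_uniq //=; last first.
    by rewrite mem_index_iota ltnS h // mem_head.
  rewrite eqxx muln1 big1 ?addn0 // => i /negPf.
  by rewrite eq_sym => ->; rewrite muln0.
apply: H => x hx; have /andP[_ p0] := partsP m.
rewrite lt0n (memPn p0 _ hx) /= /psize.
by rewrite (perm_sumn (perm_to_rem hx)) /= leq_addr.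
Qed.

Lemma fact_mul_dvdn (a b : nat) : a`! * b`! %| (a + b)`!.
Proof.
by have := bin_fact (leq_addr b a); rewrite addKn => <-; rewrite dvdn_mull.
Qed.

Lemma multinomial_dvdn (I : Type) (s : seq I) (P : pred I) (k : I -> nat) :
  \prod_(i <- s | P i) (k i)`! %| (\sum_(i <- s | P i) k i)`!.
Proof.
rewrite -!(big_filter _ P); elim: (filter P s) => [|a t IH].
  by rewrite !big_nil.
rewrite !big_cons; apply: dvdn_trans (fact_mul_dvdn _ _).
by rewrite dvdn_pmul2l ?fact_gt0.
Qed.

(* The quotients by factorials in the product formula are exact. *)
Lemma coef_dvdn (m : partn) (r : nat) : size m <= r ->
  (r - size m)`! * mfact m %| r`!.
Proof.
move=> le; rewrite -[X in _ %| X`!](subnK le).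
apply: dvdn_trans (fact_mul_dvdn _ _); rewrite dvdn_pmul2l ?fact_gt0 //.
have -> : size m = \sum_(1 <= i < (psize m).+1) mult i m.
  by rewrite -sum1_size big_parts; apply: eq_bigr => i _; rewrite mul1n.
exact: multinomial_dvdn.
Qed.

Lemma coefS_dvdn (m : partn) (r : nat) : size m <= r.+1 ->
  (r.+1 - size m)`! * mfact m %| (psize m + r).+1 * r`!.
Proof.
move=> le; pose k i := if i == 0 then r.+1 - size m else mult i m.
pose s := index_iota 0 (psize m).+1.
have kE (T : Type) (x0 : T) (op : T -> T -> T) (F : nat -> nat -> T) :
    \big[op/x0]_(i <- s) F i (k i)
    = op (F 0 (r.+1 - size m)) (\big[op/x0]_(1 <= i < (psize m).+1) F i (mult i m)).
  rewrite /s big_ltn //; apply: (congr1 (op _)).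
  by rewrite [LHS]big_nat [RHS]big_nat; apply: eq_bigr => -[].
have -> : (r.+1 - size m)`! * mfact m = \prod_(i <- s) (k i)`!.
  by rewrite (kE _ _ muln (fun _ n => n`!)).
have sumk : \sum_(i <- s) k i = r.+1.
  rewrite (kE _ _ addn (fun _ n => n)) -[RHS](subnK le); congr addn.
  by rewrite -sum1_size big_parts; apply: eq_bigr => i _; rewrite mul1n.
have -> : (psize m + r).+1 = \sum_(i <- s) i.+1 * k i.
  under eq_bigr do rewrite mulSn.
  rewrite big_split /= sumk -addnS addnC; congr addn.
  rewrite (kE _ _ addn (fun i n => i * n)) mul0n add0n.
  by rewrite -(big_parts m id) /psize sumnE.
clear kE; move: k sumk => k sumk.
rewrite big_distrl [X in _ %| X]big_seq /=; apply: dvdn_sum => i si.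
rewrite -mulnA dvdn_mull // (bigD1_seq i) ?iota_uniq //=.
case E: (k i) => [|j]; first by rewrite dvdn0.
rewrite factS -mulnA dvdn_pmul2l //.
have -> : r = j + \sum_(x <- s | x != i) k x.
  by apply: succn_inj; rewrite -sumk (bigD1_seq i) ?iota_uniq //= E.
apply: dvdn_trans (fact_mul_dvdn _ _); rewrite dvdn_pmul2l ?fact_gt0 //.
exact: multinomial_dvdn.
Qed.

(* Padding by 1 is legitimate only when [size m <= r]. *)
Definition ptilde (m : partn) (r : nat) : seq nat :=
  map succn m ++ nseq (r - size m) 1.

(* [permutations] lists each rearrangement once and [scanl addn 0 b] is the
   sequence of the partial sums [b_1, b_1 + b_2, ...]. *)
Definition pcount (m : partn) (r s : nat) : nat :=
  if 0 < s < psize m + r then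
    count (fun b => s \notin scanl addn 0 b) (permutations (ptilde m r))
  else 0.

Definition cclass (gT : finGroupType) : Type :=
  {c : {set gT} | c \in classes [set: gT]}.

HB.instance Definition _ (gT : finGroupType) := Finite.on (cclass gT).
HB.instance Definition _ (gT : finGroupType) := SubType.on (cclass gT).

Notation ptfun gT := {ffun cclass gT -> partn}.

Section Classes.
Context {gT : finGroupType}.

Definition c0 : cclass gT := Sub 1%g (classes1 [set: gT]%G).

Lemma cbar_subproof (c : cclass gT) :
  ((val c)^-1)%g \in classes [set: gT].
Proof. by case: c => c /= /imsetP[x _ ->]; rewrite -classVg mem_classes ?inE. Qed.

Definition cbar (c : cclass gT) : cclass gT :=
  Sub ((val c)^-1)%g (cbar_subproof c).

Definition zeta (c : cclass gT) : nat := #|('C[repr (val c)])%g|.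

(* Selects one class from each unordered pair {c, cbar c} with c <> cbar c. *)
Definition pair_rep (c : cclass gT) : bool :=
  (c != cbar c) && (enum_rank c < enum_rank (cbar c)).

Lemma cbarK : involutive cbar.
Proof. by move=> c; apply: val_inj; rewrite /= invgK. Qed.

Lemma pair_rep_cbar (c : cclass gT) :
  c != cbar c -> pair_rep (cbar c) = ~~ pair_rep c.
Proof.
move=> h; rewrite /pair_rep cbarK eq_sym h /= -leqNgt ltn_neqAle.
by rewrite (inj_eq val_inj) (inj_eq enum_rank_inj) eq_sym h.
Qed.

Definition norm (lam : ptfun gT) : nat := \sum_c psize (lam c).

Definition funion (lam mu : ptfun gT) : ptfun gT :=
  [ffun c => punion (lam c) (mu c)].

Definition fdiff (lam mu : ptfun gT) : ptfun gT :=
  [ffun c => pdiff (lam c) (mu c)].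

Definition at_class (c : cclass gT) (m : partn) : ptfun gT :=
  [ffun d => if d == c then m else mkpartn [::]].

(* The family (k)_c; it is empty for k = 0. *)
Definition single (k : nat) (c : cclass gT) : ptfun gT :=
  at_class c (mkpartn [:: k]).

End Classes.

Record wreath (gT : finGroupType) (n : nat) :=
  Wreath {wbase : {ffun 'I_n -> gT}; wperm : 'S_n}.

Section Wreath.
Context {gT : finGroupType} {n : nat}.
Implicit Types x y : wreath gT n.

Definition wreath_pair x := (wbase x, wperm x).
Definition pair_wreath (p : {ffun 'I_n -> gT} * 'S_n) := Wreath p.1 p.2.

Lemma wreath_pairK : cancel wreath_pair pair_wreath.
Proof. by case. Qed.

HB.instance Definition _ := Finite.copy (wreath gT n) (can_type wreath_pairK).

(* Products in ['S_n] compose from left to right: [(s * t) i = t (s i)], so the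
   composite "first tau, then sigma" is [tau * sigma]. *)
Definition wreath_mul x y : wreath gT n :=
  Wreath [ffun i => wbase x i * wbase y ((wperm x)^-1 i)]%g
         (wperm y * wperm x)%g.

Definition wreath_one : wreath gT n := Wreath [ffun=> 1%g] 1%g.

Definition wreath_inv x : wreath gT n :=
  Wreath [ffun i => (wbase x (wperm x i))^-1]%g (wperm x)^-1%g.

Lemma wreath_eq x y :
  (forall i, wbase x i = wbase y i) -> wperm x = wperm y -> x = y.
Proof. by case: x y => [g s] [h t] /= /ffunP-> ->. Qed.

Lemma wreath_mulA : associative wreath_mul.
Proof.
move=> x y z; apply: wreath_eq => [i|] /=; last by rewrite mulgA.
by rewrite !ffunE mulgA invMg permM.
Qed.

Lemma wreath_mul1 : left_id wreath_one wreath_mul.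
Proof.
move=> x; apply: wreath_eq => [i|] /=; last by rewrite mulg1.
by rewrite !ffunE mul1g invg1 perm1.
Qed.

Lemma wreath_mulV : left_inverse wreath_one wreath_inv wreath_mul.
Proof.
move=> x; apply: wreath_eq => [i|] /=; last by rewrite mulgV.
by rewrite !ffunE invgK mulVg.
Qed.

HB.instance Definition _ := Finite_isGroup.Build (wreath gT n)
  wreath_mulA wreath_mul1 wreath_mulV.

(* For the cycle i, sigma i, sigma (sigma i), ... through [i] the base
   components are multiplied from right to left. *)
Definition cycle_product x (i : 'I_n) : gT :=
  (\prod_(j <- rev (traject (wperm x) i #|porbit (wperm x) i|)) wbase x j)%g.

(* Starting points in the same cycle give conjugate products, so a cycle B
   contributes to exactly one class. *)
Definition wtype x (c : cclass gT) : partn :=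
  mkpartn [seq #|B| | B : {set 'I_n} <- enum (porbits (wperm x))
             & [exists i in B, cycle_product x i \in val c]].

Definition mtype x : ptfun gT :=
  [ffun c => if c == c0 then mkpartn [seq k.-1 | k <- wtype x c]
             else wtype x c].

End Wreath.

Local Open Scope ring_scope.

Section ClassSums.
Context {gT : finGroupType}.

(* Elements of the integral group ring are functions on the group, multiplied
   by convolution. *)
Definition convolution (n : nat) (f g : {ffun wreath gT n -> int}) :
  {ffun wreath gT n -> int} :=
  [ffun z => \sum_x \sum_(y | (x * y)%g == z) f x * g y].

Definition class_sum (n : nat) (lam : ptfun gT) : {ffun wreath gT n -> int} :=
  [ffun x => (mtype x == lam)%:R].

(* Every element of modified type [nu] occurs in [class_sum n nu] with
   coefficient 1 and in no other class sum, so the coefficient of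
   [class_sum n nu] in a central element is its value at any such element. *)
Definition structure_const (lam mu nu : ptfun gT) (n : nat) : int :=
  if [pick z : wreath gT n | mtype z == nu] is Some z
  then convolution (class_sum n lam) (class_sum n mu) z else 0.

(* When [norm nu = norm lam + norm mu], [structure_const lam mu nu n] is the
   same for all n at least [norm nu + size (nu c0)]; the least such n is used. *)
Definition stable_const (lam mu nu : ptfun gT) : int :=
  structure_const lam mu nu (norm nu + size (nu c0)).

Definition funs_of_norm (N : nat) : seq (ptfun gT) :=
  undup [seq nu <- [seq [ffun c => mkpartn (map val (t c))]
                   | t : {ffun cclass gT -> N.-tuple 'I_N.+1}]
        | norm nu == N].

Lemma mem_funs_of_norm (N : nat) (nu : ptfun gT) :
  (nu \in funs_of_norm N) = (norm nu == N).
Proof.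
rewrite mem_undup mem_filter; case: eqP => //= nuN.
have leN c : (psize (nu c) <= N)%N by rewrite -nuN /norm (bigD1 c) //= leq_addr.
have leS (s : seq nat) : 0%N \notin s ->
    (size s <= sumn s)%N /\ forall k, k \in s -> (k <= sumn s)%N.
  elim: s => [|a s IH] //=; rewrite inE negb_or eq_sym -lt0n => /andP[a0 /IH[h1 h2]].
  split=> [|k]; first by rewrite -add1n leq_add.
  by rewrite inE => /predU1P[->|/h2 h]; rewrite ?leq_addr // (leq_trans h) ?leq_addl.
have pos c : 0%N \notin parts (nu c) by have /andP[] := partsP (nu c).
have sz c :
    size ([seq inord k : 'I_N.+1 | k <- nu c] ++ nseq (N - size (nu c)) ord0) == N.
  rewrite size_cat size_map size_nseq subnKC //.
  by have [/leq_trans h _] := leS _ (pos c); apply/h/leN.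
apply/imageP; exists [ffun c => Tuple (sz c)] => //.
apply/ffunP => c; rewrite !ffunE; apply: partn_eq => k.
rewrite mult_mkpartn map_cat -map_comp map_nseq count_cat count_nseq.
rewrite [X in count_mem k X](_ : _ = parts (nu c)); last first.
  rewrite -[RHS]map_id; apply/eq_in_map => j hj /=; rewrite inordK // ltnS.
  by have [_ /(_ _ hj) /leq_trans h] := leS _ (pos c); apply/h/leN.
case: (eqVneq k 0%N) => [->|k0]; first by rewrite mult0.
by rewrite /= eq_sym (negPf k0) mul0n addn0 mul1n.
Qed.

End ClassSums.

(* The free Z-module on the K_lambda, with the bilinear extension of the
   product of basis elements. *)
Definition FH (gT : finGroupType) : Type := {malg int[ptfun gT]}.
HB.instance Definition _ gT := GRing.Zmodule.on (FH gT).

Section FarahatHigman.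
Context {gT : finGroupType}.

Definition K (lam : ptfun gT) : FH gT := << lam >>.

Definition mulK (lam mu : ptfun gT) : FH gT :=
  \sum_(nu <- funs_of_norm (norm lam + norm mu)) K nu *~ stable_const lam mu nu.

Definition FHmul (f g : FH gT) : FH gT :=
  \sum_(lam <- msupp f) \sum_(mu <- msupp g) mulK lam mu *~ (f@_lam * g@_mu).

Lemma FHmulK (lam mu : ptfun gT) : FHmul (K lam) (K mu) = mulK lam mu.
Proof.
by rewrite /FHmul !msuppU !oner_eq0 !big_seq_fset1 !mcoeffUU mulr1.
Qed.

End FarahatHigman.

(* Main.v *)
(* Fix z of type nu. The wreath product acts on the points 'I_n * gT, commuting
   with right translation by gT, and the class of a cycle is the class of its
   monodromy. An element of type (r) is a lifted cycle through r+1 points of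
   distinct fibres, so one counts the sequences s of such points for which
   x = z * cyc s has type lam. As norm nu = norm lam + r, passing from z to x
   creates r trivial cycles (those with monodromy 1), hence some r of the r+1
   points lie on distinct trivial cycles of x. There are three cases. If all
   points do, a trivial cycle of z is cut into r+1 trivial ones (I_1); if the
   remaining point lies on a non-trivial cycle of x, a non-trivial cycle of z
   is cut (I_2); if it shares its trivial cycle with another point, two cycles of z
   with inverse monodromies are joined and then cut (I_3, I_4, I_5). In each
   case s is recovered from a starting point and the composition formed by the
   lengths of the pieces; the last case is reduced to the first one by a lifted
   transposition joining the two cycles. *)

Require Import Defs.
From HB Require Import structures.
From mathcomp Require Import all_boot all_order all_algebra all_fingroup.
From mathcomp Require Import finmap monalg zify ring.

Set Implicit Arguments.
Unset Strict Implicit.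
Unset Printing Implicit Defensive.

(** * Wreath products acting on points *)

Section Action.
Local Open Scope group_scope.
Context {gT : finGroupType} {n : nat}.
Local Notation point := ('I_n * gT)%type.
Implicit Types (x y z v w : wreath gT n) (p q : point) (g h : gT) (i j : 'I_n).

(** The norm of a type is [n] minus the number of trivial cycles; this turns the condition on norms
    into a count of trivial cycles. Types are not compared cycle by cycle: an identity between sums
    of [F (len i) (cls i)] over all [i], for arbitrary [F], records the multiset of lengths and
    classes, since a cycle of length k contributes k equal terms. Constants: each element of type
    (r) comes from [r.+1 * #|gT|] sequences. The factor [#|gT|] is matched by the free choice of a
    starting point in its fibre. The factor [r.+1] is matched by the rotations that bring the
    exceptional point to the front or, when all points are alike, by (r+1)! in the number of
    rearrangements. When two points share a cycle, either may come first; this 2 is matched by the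
    two orders of the joined cycles. The factor [zeta c] counts the points of a fibre where the
    monodromy has a prescribed value in its class, and [pcount] the compositions for which the point
    used for joining is not over a cut point as well. *)

Definition wact x p : point :=
  (wperm x p.1, wbase x (wperm x p.1) * p.2).

Definition rt p g : point := (p.1, p.2 * g).

Lemma wpermM x y : wperm (x * y) = wperm y * wperm x.
Proof. by []. Qed.

Lemma wbaseM x y i :
  wbase (x * y) i = wbase x i * wbase y ((wperm x)^-1 i).
Proof. by rewrite /= ffunE. Qed.

Lemma wact1 p : wact 1 p = p.
Proof. by case: p => i g; rewrite /wact /= perm1 ffunE mul1g. Qed.

Lemma wactM x y p : wact (x * y) p = wact x (wact y p).
Proof.
by rewrite /wact wpermM wbaseM permM /= permK mulgA.
Qed.

Lemma wactKV x : cancel (wact x^-1) (wact x).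
Proof. by move=> p; rewrite -wactM mulgV wact1. Qed.

Lemma wactK x : cancel (wact x) (wact x^-1).
Proof. by move=> p; rewrite -wactM mulVg wact1. Qed.

Lemma rt1 p : rt p 1 = p.
Proof. by case: p => i g; rewrite /rt mulg1. Qed.

Lemma rtM p g h : rt (rt p g) h = rt p (g * h).
Proof. by rewrite /rt mulgA. Qed.

Lemma rt_inj p : injective (rt p).
Proof. by move=> g h [] /mulgI. Qed.

Lemma rtE p q : p.1 = q.1 -> p = rt q (q.2^-1 * p.2).
Proof. by case: p q => i g [j h] /= ->; rewrite /rt mulKVg. Qed.

Lemma wact_rt x p g : wact x (rt p g) = rt (wact x p) g.
Proof. by rewrite /wact /rt /= mulgA. Qed.

Lemma iter_wact_rt x k p g :
  iter k (wact x) (rt p g) = rt (iter k (wact x) p) g.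
Proof. by elim: k => //= k ->; rewrite wact_rt. Qed.

Lemma wact_ext x y : wact x =1 wact y -> x = y.
Proof.
move=> e; have ep : wperm x = wperm y.
  by apply/permP => i; have := e (i, 1) => -[].
apply: wreath_eq => // i; have [] := e ((wperm x)^-1 i, 1).
by rewrite /= !mulg1 -ep permKV.
Qed.

Lemma iter_wact1 x k p : (iter k (wact x) p).1 = iter k (wperm x) p.1.
Proof. by elim: k => //= k ->. Qed.

Definition len x i := #|porbit (wperm x) i|.

Lemma len_gt0 x i : 0 < len x i.
Proof. by rewrite /len lt0n -lt0n; apply/card_gt0P; exists i; apply: porbit_id. Qed.

Lemma iter_len x i : iter (len x i) (wperm x) i = i.
Proof. exact: iter_porbit. Qed.

Lemma len_iter_inj x i a b : a < len x i -> b < len x i ->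
  iter a (wperm x) i = iter b (wperm x) i -> a = b.
Proof.
move=> al bl e; have := uniq_traject_porbit (wperm x) i.
move/(nth_uniq i) => /(_ a b); rewrite !size_traject => /(_ al bl).
by rewrite !nth_traject // e eqxx => /esym/eqP.
Qed.

Lemma len_first x i k : 0 < k -> iter k (wperm x) i = i ->
  (forall a, 0 < a < k -> iter a (wperm x) i <> i) -> len x i = k.
Proof.
move=> k0 ek hk; case: (ltngtP (len x i) k) => // h.
  by case: (hk (len x i)); rewrite ?len_gt0 //= iter_len.
have := @len_iter_inj x i k 0 h (len_gt0 x i) ek; lia.
Qed.

Lemma mem_porbit_iter x i j :
  reflect (exists2 a, a < len x i & j = iter a (wperm x) i)
          (j \in porbit (wperm x) i).
Proof.
rewrite porbit_traject; apply: (iffP (@trajectP _ _ _ _ _)) => -[a al e].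
  by exists a.
by exists a.
Qed.

Lemma porbit_iter x i a : iter a (wperm x) i \in porbit (wperm x) i.
Proof. by rewrite -permX mem_porbit. Qed.

Lemma eq_porbit_mem x i j : (porbit (wperm x) i == porbit (wperm x) j)
  = (i \in porbit (wperm x) j).
Proof. exact: eq_porbit_mem. Qed.

Lemma porbit_of_mem x i j :
  j \in porbit (wperm x) i -> porbit (wperm x) j = porbit (wperm x) i.
Proof. by rewrite -eq_porbit_mem => /eqP. Qed.

Lemma len_mem x i j : j \in porbit (wperm x) i -> len x j = len x i.
Proof. by rewrite /len => /porbit_of_mem ->. Qed.

(* Monodromy, at the point [p], of the cycle of [x] through [p]. *)
Definition mono x p : gT := p.2^-1 * (iter (len x p.1) (wact x) p).2.

Lemma iter_mono x p : iter (len x p.1) (wact x) p = rt p (mono x p).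
Proof. by apply: rtE; rewrite iter_wact1 iter_len. Qed.

Lemma mono_rt x p g : mono x (rt p g) = mono x p ^ g.
Proof.
apply: (@rt_inj (rt p g)); rewrite -iter_mono iter_wact_rt /= iter_mono.
by rewrite !rtM conjgE !mulgA mulgV mul1g.
Qed.

Lemma mono_iter x k p : mono x (iter k (wact x) p) = mono x p.
Proof.
apply: (@rt_inj (iter k (wact x) p)); rewrite -iter_mono iter_wact1.
rewrite (len_mem (porbit_iter _ _ _)) -iterD addnC iterD iter_mono.
by rewrite iter_wact_rt.
Qed.

Lemma mem_porbit_point x p j : j \in porbit (wperm x) p.1 ->
  exists2 a, a < len x p.1 & j = (iter a (wact x) p).1.
Proof. by case/mem_porbit_iter => a al ->; exists a; rewrite ?iter_wact1. Qed.

Lemma mono_fiber x p q : p.1 = q.1 ->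
  mono x p = mono x q ^ (q.2^-1 * p.2).
Proof. by move=> e; rewrite {1}(rtE e) mono_rt. Qed.

Definition cls_of g : cclass gT :=
  Sub (g ^: [set: gT]) (mem_classes (in_setT g)).

Lemma cls_ofE g (c : cclass gT) : (cls_of g == c) = (g \in val c).
Proof.
rewrite -(inj_eq val_inj) /=; case: c => c /= /imsetP[h _ ->].
by apply/eqP/idP => [<-|/class_eqP //]; exact: class_refl.
Qed.

Lemma cls_ofJ g h : cls_of (g ^ h) = cls_of g.
Proof. by apply/val_inj; rewrite /= classGidl ?inE. Qed.

Lemma cls_of_c0 g : (cls_of g == c0) = (g == 1).
Proof. by rewrite cls_ofE /= inE. Qed.

(** The point 1 of the fibre is an arbitrary choice: another one conjugates the monodromy. *)
Definition cls x i := cls_of (mono x (i, 1)).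

Lemma clsE x p : cls x p.1 = cls_of (mono x p).
Proof.
by rewrite /cls (@mono_fiber x (p.1, 1) p) // cls_ofJ.
Qed.

Lemma cls_mem x i j : j \in porbit (wperm x) i -> cls x j = cls x i.
Proof.
by move/(@mem_porbit_point x (i, 1)) => [a _ ->]; rewrite clsE mono_iter -clsE.
Qed.

Lemma cls_c0 x p : (cls x p.1 == c0) = (mono x p == 1).
Proof. by rewrite clsE cls_of_c0. Qed.

Lemma iter_agree (f1 f2 : point -> point) k p :
  (forall a, a < k -> f2 (iter a f1 p) = f1 (iter a f1 p)) ->
  iter k f2 p = iter k f1 p.
Proof.
elim: k => //= k IH h; rewrite IH ?h // => a ak; apply: h; lia.
Qed.

(** Agreement along the orbit of [z] is enough, because the iterates of [x] from [p] then never
    leave that orbit. *)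
Lemma untouched x z p :
  (forall j g, j \in porbit (wperm z) p.1 -> wact x (j, g) = wact z (j, g)) ->
  [/\ porbit (wperm x) p.1 = porbit (wperm z) p.1, len x p.1 = len z p.1
    & mono x p = mono z p].
Proof.
move=> h; have e k : iter k (wact x) p = iter k (wact z) p.
  apply: iter_agree => a _; case E: (iter a _ p) => [j g]; apply: h.
  by have -> : j = (iter a (wact z) p).1 by [rewrite E]; rewrite iter_wact1 porbit_iter.
have eo : porbit (wperm x) p.1 = porbit (wperm z) p.1.
  apply/setP => j; apply/idP/idP => /mem_porbit_point[a _ ->].
    by rewrite e iter_wact1 porbit_iter.
  by rewrite -e iter_wact1 porbit_iter.
have el : len x p.1 = len z p.1 by rewrite /len eo.
by split; rewrite // /mono el e.
Qed.

End Action.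

(** * Lifted transpositions *)

Section Transposition.
Local Open Scope group_scope.
Context {gT : finGroupType} {n : nat}.
Local Notation point := ('I_n * gT)%type.
Implicit Types (x y z v w : wreath gT n) (p q u : point) (g h : gT) (i j : 'I_n).

(* The lifted transposition exchanging the points [p] and [q], which must lie
   in different fibres. *)
Definition ptperm p q : wreath gT n :=
  Wreath [ffun i => if i == p.1 then p.2 * q.2^-1
                    else if i == q.1 then q.2 * p.2^-1 else 1]
         (tperm p.1 q.1).

Lemma ptpermL p q : p.1 != q.1 -> wact (ptperm p q) p = q.
Proof.
case: p q => i g [j h] /= ij; rewrite /wact /= tpermL ffunE eqxx.
by rewrite eq_sym (negPf ij) mulgKV.
Qed.

Lemma ptpermR p q : wact (ptperm p q) q = p.
Proof.
by case: p q => i g [j h]; rewrite /wact /= tpermR ffunE eqxx mulgKV.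
Qed.

Lemma ptpermD p q u : u.1 != p.1 -> u.1 != q.1 -> wact (ptperm p q) u = u.
Proof.
case: u => k f /= kp kq; rewrite /wact /= tpermD 1?eq_sym // ffunE.
by rewrite (negPf kp) (negPf kq) mul1g.
Qed.

Lemma ptpermL_rt p q g : p.1 != q.1 -> wact (ptperm p q) (rt p g) = rt q g.
Proof. by move=> pq; rewrite wact_rt ptpermL. Qed.

Lemma ptpermR_rt p q g : wact (ptperm p q) (rt q g) = rt p g.
Proof. by rewrite wact_rt ptpermR. Qed.

Lemma ptpermK p q : p.1 != q.1 -> ptperm p q * ptperm p q = 1.
Proof.
move=> pq; apply: wact_ext => u; rewrite wactM wact1.
have [e|np] := eqVneq u.1 p.1; first by rewrite (rtE e) ptpermL_rt ?ptpermR_rt.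
have [e|nq] := eqVneq u.1 q.1; first by rewrite (rtE e) ptpermR_rt ptpermL_rt.
by rewrite !ptpermD.
Qed.

Lemma ptpermC p q : p.1 != q.1 -> ptperm p q = ptperm q p.
Proof.
move=> pq; apply: wact_ext => u.
have [e|np] := eqVneq u.1 p.1; first by rewrite (rtE e) ptpermL_rt ?ptpermR_rt.
have [e|nq] := eqVneq u.1 q.1.
  by rewrite (rtE e) ptpermR_rt ptpermL_rt // eq_sym.
by rewrite !ptpermD.
Qed.

Lemma mul_ptpermK w p q : p.1 != q.1 -> w * ptperm p q * ptperm p q = w.
Proof. by move=> pq; rewrite -mulgA ptpermK ?mulg1. Qed.

Lemma notin_porbit_neq w p q : q.1 \notin porbit (wperm w) p.1 -> p.1 != q.1.
Proof. by apply: contraNneq => ->; apply: porbit_id. Qed.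

(** The first step jumps from [p] to [q] before applying [w]; afterwards the transposition is
    invisible until the walk meets the fibre of [p] or [q]. *)
Lemma ptperm_walk w p q k : p.1 != q.1 ->
  (forall a, 0 < a < k -> iter a (wperm w) q.1 != p.1) ->
  (forall a, 0 < a < k -> iter a (wperm w) q.1 != q.1) ->
  0 < k -> iter k (wact (w * ptperm p q)) p = iter k (wact w) q.
Proof.
move=> pq hp hq; case: k hp hq => // k hp hq _.
rewrite !iterSr wactM ptpermL //.
apply: iter_agree => a ak; rewrite wactM ptpermD //.
  by rewrite -iterSr iter_wact1 hp.
by rewrite -iterSr iter_wact1 hq.
Qed.

Lemma join_walk w p q k : q.1 \notin porbit (wperm w) p.1 ->
  0 < k <= len w q.1 -> iter k (wact (w * ptperm p q)) p = iter k (wact w) q.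
Proof.
move=> npq /andP[k0 kl]; have npq' : p.1 \notin porbit (wperm w) q.1 by rewrite porbit_sym.
apply: ptperm_walk => //; first exact: notin_porbit_neq npq.
  by move=> a ak; apply: contraNneq npq' => <-; apply: porbit_iter.
move=> a /andP[a0 ak]; apply/eqP => e.
have := @len_iter_inj _ _ w q.1 a 0 (leq_trans ak kl) (len_gt0 _ _) e.
by move=> e0; rewrite e0 in a0.
Qed.

Lemma join_walk_len w p q : q.1 \notin porbit (wperm w) p.1 ->
  iter (len w q.1) (wact (w * ptperm p q)) p = rt q (mono w q).
Proof. by move=> h; rewrite join_walk ?len_gt0 ?leqnn // iter_mono. Qed.

(** After a full turn of the cycle of [q] the walk stands over [q], translated by the monodromy;
    with the roles of [p] and [q] exchanged it goes on through the cycle of [p]. *)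
Lemma join_walk2 w p q k : q.1 \notin porbit (wperm w) p.1 ->
  0 < k <= len w p.1 ->
  iter (k + len w q.1) (wact (w * ptperm p q)) p
  = rt (iter k (wact w) p) (mono w q).
Proof.
move=> h hk; rewrite iterD join_walk_len // iter_wact_rt; congr rt.
by rewrite (ptpermC (notin_porbit_neq h)) join_walk // porbit_sym.
Qed.

Lemma join_len w p q : q.1 \notin porbit (wperm w) p.1 ->
  len (w * ptperm p q) p.1 = len w p.1 + len w q.1.
Proof.
move=> h; have lp := len_gt0 w p.1; have lq := len_gt0 w q.1.
apply: len_first; first lia.
  by rewrite -iter_wact1 join_walk2 ?lp ?leqnn // iter_mono.
move=> a al; rewrite -iter_wact1.
case: (leqP a (len w q.1)) => ha.
  rewrite join_walk //; last lia.
  rewrite iter_wact1 => e; move: h; rewrite porbit_sym => /negP; apply.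
  by rewrite -e porbit_iter.
have {1}-> : a = (a - len w q.1) + len w q.1 by lia.
rewrite join_walk2 //; last lia.
rewrite /= iter_wact1 => e.
have := @len_iter_inj _ _ w p.1 (a - len w q.1) 0 _ lp e; lia.
Qed.

Lemma join_mono w p q : q.1 \notin porbit (wperm w) p.1 ->
  mono (w * ptperm p q) p = mono w p * mono w q.
Proof.
move=> h; apply: (@rt_inj _ _ p); rewrite -iter_mono join_len //.
by rewrite join_walk2 ?len_gt0 ?leqnn // iter_mono rtM.
Qed.

Lemma join_porbit w p q : q.1 \notin porbit (wperm w) p.1 ->
  porbit (wperm (w * ptperm p q)) p.1
  = porbit (wperm w) p.1 :|: porbit (wperm w) q.1.
Proof.
move=> h; apply/esym/eqP; rewrite eqEcard; apply/andP; split.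
  apply/subsetP => j; rewrite inE => /orP[]/mem_porbit_point[a al ->].
    case: a al => [|a] al; first exact: porbit_id.
    have -> : (iter a.+1 (wact w) p).1
      = (iter (a.+1 + len w q.1) (wact (w * ptperm p q)) p).1.
      by rewrite join_walk2 //; lia.
    by rewrite iter_wact1 porbit_iter.
  case: a al => [|a] al.
    have -> : (iter 0 (wact w) q).1 = (iter (len w q.1) (wact (w * ptperm p q)) p).1.
      by rewrite join_walk_len.
    by rewrite iter_wact1 porbit_iter.
  by rewrite -(join_walk h) ?iter_wact1 ?porbit_iter //; lia.
rewrite -/(len _ _) join_len // cardsU.
suff -> : porbit (wperm w) p.1 :&: porbit (wperm w) q.1 = set0.
  by rewrite cards0 subn0.
apply/setP => j; rewrite !inE; apply/andP => -[/porbit_of_mem e].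
by rewrite porbit_sym e => e'; rewrite e' in h.
Qed.

Lemma ptperm_untouched w p q u : p.1 \notin porbit (wperm w) u.1 ->
  q.1 \notin porbit (wperm w) u.1 ->
  [/\ porbit (wperm (w * ptperm p q)) u.1 = porbit (wperm w) u.1,
      len (w * ptperm p q) u.1 = len w u.1
    & mono (w * ptperm p q) u = mono w u].
Proof.
move=> hp hq; apply: untouched => j g hj; rewrite wactM ptpermD //=.
  by apply: contraNneq hp => <-.
by apply: contraNneq hq => <-.
Qed.

(** If [q] lies over the position [a] of a cycle of length [l] starting over [p], the new orbit of
    [p] runs through the positions a+1, ..., l and closes there, so it misses [a]. *)
Lemma cut_notin w p q : q.1 \in porbit (wperm w) p.1 -> p.1 != q.1 ->
  q.1 \notin porbit (wperm (w * ptperm p q)) p.1.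
Proof.
case/mem_porbit_iter => a al eq pq.
have a0 : 0 < a by case: a al eq => // _ e; rewrite e eqxx in pq.
set l := len w p.1 in al *.
have hq b : 0 < b <= l - a -> iter b (wperm w) q.1 != q.1.
  move=> hb; rewrite eq -iterD; apply/eqP => e.
  have [e'|lt] : b + a = l \/ b + a < l by lia.
    move: e; rewrite e' iter_len -eq => e; by rewrite e eqxx in pq.
  by have := @len_iter_inj _ _ w p.1 (b + a) a lt al e; lia.
have hp b : 0 < b < l - a -> iter b (wperm w) q.1 != p.1.
  move=> hb; rewrite eq -iterD; apply/eqP => e.
  have lt : b + a < l by lia.
  by have := @len_iter_inj _ _ w p.1 (b + a) 0 lt (len_gt0 _ _) e; lia.
have W b : 0 < b <= l - a -> iter b (wact (w * ptperm p q)) p = iter b (wact w) q.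
  move=> hb; apply: ptperm_walk => [//|c hc|c hc|]; last lia.
    by apply: hp; lia.
  by apply: hq; lia.
have el : len (w * ptperm p q) p.1 = l - a.
  apply: len_first; first lia.
    rewrite -iter_wact1 W; last lia.
    by rewrite iter_wact1 eq -iterD subnK ?iter_len // ltnW.
  move=> b hb; rewrite -iter_wact1 W; last lia.
  by rewrite iter_wact1; apply/eqP/hp; lia.
apply/negP => /mem_porbit_point[b]; rewrite el => bl.
case: b bl => [|b] bl; first by move=> e; rewrite /= e eqxx in pq.
rewrite W ?iter_wact1; last lia.
by move/esym/eqP; apply/negP/hq; lia.
Qed.

(** Cutting is joining read backwards: the transposition is an involution, so [w] is a join of two
    cycles of [v]. *)
Lemma cut_spec w p q v : v = w * ptperm p q ->
  q.1 \in porbit (wperm w) p.1 -> p.1 != q.1 ->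
  [/\ q.1 \notin porbit (wperm v) p.1, len w p.1 = len v p.1 + len v q.1,
      iter (len v q.1) (wact w) p = rt q (mono v q)
    & mono w p = mono v p * mono v q].
Proof.
move=> ev h pq; have nq := cut_notin h pq; rewrite -ev in nq.
have -> : w = v * ptperm p q by rewrite ev mul_ptpermK.
split; rewrite //; [exact: join_len|exact: join_walk_len|exact: join_mono].
Qed.

Lemma sum_porbit w i (F : nat -> cclass gT -> nat) :
  \sum_(j in porbit (wperm w) i) F (len w j) (cls w j)
    = (len w i * F (len w i) (cls w i))%N.
Proof.
rewrite (eq_bigr (fun=> F (len w i) (cls w i))) ?sum_nat_const // => j hj.
by rewrite (len_mem hj) (cls_mem hj).
Qed.

(** Only the orbits of [p] and [q] contribute differently. The lost terms stand on the opposite side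
    because subtraction of naturals is truncated. *)
Lemma join_sum w p q v (F : nat -> cclass gT -> nat) : v = w * ptperm p q ->
  q.1 \notin porbit (wperm w) p.1 ->
  \sum_i F (len v i) (cls v i)
   + (len w p.1 * F (len w p.1) (cls w p.1)
      + len w q.1 * F (len w q.1) (cls w q.1))%N
  = \sum_i F (len w i) (cls w i) + (len v p.1 * F (len v p.1) (cls v p.1))%N.
Proof.
move=> ev h; have eo := join_porbit h; rewrite -ev in eo.
rewrite -!sum_porbit eo.
set A := porbit _ p.1; set B := porbit _ q.1.
have dAB j : j \in A -> j \notin B.
  move=> /porbit_of_mem e; rewrite porbit_sym e; apply: contra h.
  by rewrite porbit_sym.
rewrite (bigID (mem (A :|: B))) /= [X in _ = X + _](bigID (mem (A :|: B))) /=.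
have -> : \sum_(i in A :|: B) F (len w i) (cls w i)
   = \sum_(i in A) F (len w i) (cls w i) + \sum_(i in B) F (len w i) (cls w i).
  rewrite (bigID (mem A)) /=; congr (_ + _); apply: eq_bigl => j; rewrite !inE.
    by case: (j \in A); rewrite ?andbT ?andbF.
  by case: (boolP (j \in A)) => [/dAB/negPf->|]; rewrite ?andbT.
have -> : \sum_(i | i \notin A :|: B) F (len v i) (cls v i)
   = \sum_(i | i \notin A :|: B) F (len w i) (cls w i).
  apply: eq_bigr => j; rewrite inE negb_or => /andP[jA jB].
  have pj : p.1 \notin porbit (wperm w) j by rewrite porbit_sym.
  have qj : q.1 \notin porbit (wperm w) j by rewrite porbit_sym.
  have [_ /= e1 e2] := @ptperm_untouched w p q (j, 1) pj qj.
  by rewrite /cls ev e1 e2.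
by rewrite addnC addnA addnAC.
Qed.

End Transposition.

(** * Cutting a cycle *)

#[local] Arguments wperm : simpl never.
#[local] Arguments wbase : simpl never.

Section Cycles.
Local Open Scope group_scope.
Context {gT : finGroupType} {n : nat}.
Local Notation point := ('I_n * gT)%type.
Implicit Types (x y z v w : wreath gT n) (p q u : point) (g h : gT) (i j : 'I_n).
Implicit Types (s : seq point) (b : seq nat).

(* The element sending each point of [s] to the next one, cyclically. It only
   has this meaning when the points of [s] lie in distinct fibres. *)
Fixpoint cyc s : wreath gT n :=
  if s is q :: s' then if s' is p :: _ then ptperm q p * cyc s' else 1 else 1.

Lemma cyc_cons_rcons q s p :
  cyc (q :: rcons s p) = ptperm q (head p (rcons s p)) * cyc (rcons s p).
Proof. by case: s. Qed.

Lemma cyc_out s u : u.1 \notin map fst s -> wact (cyc s) u = u.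
Proof.
elim: s => [|q [|p s] IH]; rewrite ?wact1 //.
rewrite [map _ _]/= inE negb_or => /andP[uq us].
have up : u.1 != p.1 by move: us; rewrite /= inE negb_or => /andP[].
by rewrite [cyc _]/= -/(cyc (p :: s)) wactM IH // ptpermD.
Qed.

Lemma fpath_sub (T : eqType) (f1 f2 : T -> T) (a : T) (l : seq T) :
  (forall c d, d \in l -> f1 c = d -> f2 c = d) ->
  fpath f1 a l -> fpath f2 a l.
Proof.
elim: l a => //= d l IH a h /andP[/eqP e pl]; rewrite (h a d) ?mem_head //=.
by rewrite eqxx IH // => c e' he'; apply: h; rewrite inE he' orbT.
Qed.

(** The shorter lifted cycle returns from its last point to [p]; the additional transposition
    diverts this one arrow to [q] and leaves the others alone. *)
Lemma cyc_fcycle s : uniq (map fst s) -> fcycle (wact (cyc s)) s.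
Proof.
elim: s => [|q [|p s] IH] //.
  by rewrite /= wact1 eqxx.
rewrite [map _ _]/= => /andP[qs us]; have {IH} := IH us.
have qp : q.1 != p.1 by move: qs; rewrite inE negb_or => /andP[].
set y := cyc (p :: s) => cy.
have -> : cyc (q :: p :: s) = ptperm q p * y by [].
have eq : wact (ptperm q p * y) q = p by rewrite wactM cyc_out // ptpermL.
move: cy; rewrite /= eq eqxx !rcons_path => /andP[ps /eqP /= lp] /=.
rewrite wactM lp ptpermR eqxx andbT.
apply: fpath_sub ps => c d ds e; rewrite wactM e ptpermD //.
  by apply: contraNneq qs => <-; rewrite inE map_f ?orbT.
by apply: contraTneq us => <- /=; rewrite map_f.
Qed.

(** Suffix sums fit the recursion of [cyc], which peels points off at the front: the tail is a
    sequence of the same kind with the same base point. *)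
Fixpoint ssums b := if b is a :: b' then a + sumn b' :: ssums b' else [::].

Lemma ssums_le b (d : nat) : d \in ssums b -> d <= sumn b.
Proof.
elim: b => //= a b IH; rewrite inE => /predU1P[->//|/IH h].
by rewrite (leq_trans h) ?leq_addl.
Qed.

(* The points reached from [p] by walking along [z] the suffix sums of [b]
   steps: consecutive points are separated by the parts of [b]. *)
Fixpoint ptsb z p b : seq point :=
  if b is a :: b' then iter (a + sumn b') (wact z) p :: ptsb z p b' else [::].

Lemma ptsbE z p b : ptsb z p b = [seq iter c (wact z) p | c <- ssums b].
Proof. by elim: b => //= a b ->. Qed.

Lemma head_ptsb z p b : head p (rcons (ptsb z p b) p) = iter (sumn b) (wact z) p.
Proof. by case: b. Qed.

Lemma ptsb_agree z z' p b :
  (forall c, c <= sumn b -> iter c (wact z') p = iter c (wact z) p) ->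
  ptsb z' p b = ptsb z p b.
Proof.
elim: b => //= a b IH h; rewrite h // IH // => c hc; apply: h.
by rewrite (leq_trans hc) ?leq_addl.
Qed.

Lemma mem_ptsb_porbit z p b u :
  u \in rcons (ptsb z p b) p -> u.1 \in porbit (wperm z) p.1.
Proof.
elim: b => [|a b IH] /=; first by rewrite inE => /eqP ->; apply: porbit_id.
by rewrite inE => /predU1P[->|//]; rewrite iter_wact1 porbit_iter.
Qed.

(** The arc of length [a] from [p'] to [q] becomes a cycle of its own. The walk from [p] is
    unchanged up to [p'], so the remaining cuts can be described in [z'] by the same numbers. *)
Lemma cut_step z p a c q p' z' : q = iter (a + c) (wact z) p ->
  p' = iter c (wact z) p -> z' = z * ptperm q p' ->
  0 < a -> a + c < len z p.1 ->
  [/\ z' = z * ptperm p' q, p'.1 != q.1, q.1 \notin porbit (wperm z') p'.1,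
     len z' q.1 = a & mono z' q = 1] /\ [/\ len z p.1 = len z' p.1 + a, mono z' p = mono z p,
     p'.1 \in porbit (wperm z') p.1
   & forall d, d <= c -> iter d (wact z') p = iter d (wact z) p].
Proof.
move=> eq ep ez a0 hL.
have pL : p'.1 \in porbit (wperm z) p.1 by rewrite ep iter_wact1 porbit_iter.
have lp' : len z p'.1 = len z p.1 by rewrite (len_mem pL).
have pq : p'.1 != q.1.
  rewrite eq ep !iter_wact1; apply/eqP => e.
  have := @len_iter_inj _ _ z p.1 c (a + c) _ hL e; lia.
have tC := ptpermC pq.
have qL : q.1 \in porbit (wperm z) p'.1.
  by rewrite eq iterD -ep iter_wact1 porbit_iter.
have ez' : z' = z * ptperm p' q by rewrite tC.
have [nq el ew em] := cut_spec ez' qL pq.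
have elq : len z' q.1 = a.
  have := @len_iter_inj _ _ z p'.1 (len z' q.1) a _ _.
  rewrite lp'; apply; try lia.
    by have := len_gt0 z' p'.1; lia.
  by rewrite -!iter_wact1 ew /= eq iterD ep.
have mq : mono z' q = 1.
  apply: (@rt_inj _ _ q); by rewrite -ew elq rt1 eq iterD ep.
have ag d : d <= c -> iter d (wact z') p = iter d (wact z) p.
  move=> dc; apply: iter_agree => e ed.
  rewrite ez wactM ptpermD //; rewrite ?eq ?ep !iter_wact1; apply/eqP => ee.
    by have := @len_iter_inj _ _ z p.1 e (a + c) _ hL ee; lia.
  by have := @len_iter_inj _ _ z p.1 e c _ _ ee; lia.
have p'L : p'.1 \in porbit (wperm z') p.1.
  by rewrite ep -ag // iter_wact1 porbit_iter.
split; split=> //.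
  by rewrite -(len_mem p'L) -lp' el elq.
by rewrite -(mono_iter z' c) ag // -(mono_iter z c) -ep em mq mulg1.
Qed.

(** Under [x] a cut point jumps back to the next entry of [s] and walks along [z] until it meets
    itself again: its cycle is the arc between the two and has monodromy 1. Only the piece of [p],
    which closes up as the old cycle did, inherits the old monodromy. The proof detaches the
    farthest arc first. *)
Lemma cut_main z p b s x : s = rcons (ptsb z p b) p -> x = z * cyc s ->
  all (leq 1) b -> sumn b < len z p.1 ->
  [/\ uniq [seq porbit (wperm x) u.1 | u <- s],
      [seq len x u.1 | u <- ptsb z p b] = b,
      all (fun u => mono x u == 1) (ptsb z p b),
      len z p.1 = len x p.1 + sumn b & mono x p = mono z p]
  /\ [/\ forall u, u.1 \notin porbit (wperm z) p.1 ->
          [/\ porbit (wperm x) u.1 = porbit (wperm z) u.1,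
              len x u.1 = len z u.1 & mono x u = mono z u],
      forall i, i \in porbit (wperm z) p.1 ->
          has (fun u => i \in porbit (wperm x) u.1) s
    & forall F : nat -> cclass gT -> nat,
       \sum_i F (len x i) (cls x i)
         + (len z p.1 * F (len z p.1) (cls z p.1))%N
       = \sum_i F (len z i) (cls z i) + (\sum_(a <- b) a * F a c0)%N
         + (len x p.1 * F (len x p.1) (cls z p.1))%N].
Proof.
elim: b z s x => [|a b IH] z s x es ex.
  move=> _ _; rewrite {}ex {}es /= mulg1; split; split=> //.
  - by rewrite addn0.
  - by move=> i ->.
  - by move=> F; rewrite big_nil addn0.
case/andP=> a0 ab hL.
have [q eq] : exists q, q = iter (a + sumn b) (wact z) p by eexists.
have [p' ep'] : exists p', p' = iter (sumn b) (wact z) p by eexists.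
have [z' ez0] : exists z', z' = z * ptperm q p' by eexists.
have [[ez pq nq lq mq] [lp mp p'L ag]] := cut_step eq ep' ez0 a0 hL.
have hL' : sumn b < len z' p.1 by move: hL => /=; lia.
have [s' es'] : exists s', s' = rcons (ptsb z p b) p by eexists.
have ess : s = q :: s' by rewrite es es' eq.
have es'' : s' = rcons (ptsb z' p b) p by rewrite (ptsb_agree ag).
have ex' : x = z' * cyc s'.
  by rewrite ex ess es' cyc_cons_rcons head_ptsb -ep' mulgA ez0.
have := IH z' s' x es'' ex' ab hL'.
rewrite (ptsb_agree ag) => -[[H1 H2 H3 H4 H5] [H6 H7 H8]].
have ep : porbit (wperm z') p.1 = porbit (wperm z') p'.1.
  by rewrite (porbit_of_mem p'L).
have ezp : z = z' * ptperm p' q by rewrite ez mul_ptpermK.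
have p'z : p'.1 \in porbit (wperm z) p.1 by rewrite ep' iter_wact1 porbit_iter.
have eU : porbit (wperm z) p.1 = porbit (wperm z') p.1 :|: porbit (wperm z') q.1.
  by rewrite -(porbit_of_mem p'z) {1}ezp join_porbit // ep.
have [oq lq' mq'] : [/\ porbit (wperm x) q.1 = porbit (wperm z') q.1,
   len x q.1 = a & mono x q = 1].
  by have [|-> -> ->] := H6 q; rewrite ?ep // lq mq.
have es0 : ptsb z p (a :: b) = q :: ptsb z p b by rewrite eq.
rewrite es0; split; split=> //.
(* The later points all stay on the orbit of [p] in [z'], from which [q] has been separated. *)
- rewrite ess /= H1 andbT oq; apply/mapP => -[u us e].
  have hu : u.1 \in porbit (wperm z') p.1.
    by apply: (@mem_ptsb_porbit z' p b); rewrite -es''.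
  have hu' : u.1 \in porbit (wperm z') q.1.
    have [|eu _ _] := H6 q; first by rewrite ep.
    by rewrite -eu oq e porbit_id.
  move: nq; rewrite -ep -(porbit_of_mem hu) (porbit_of_mem hu').
  by rewrite porbit_id.
- by rewrite /= H2 lq'.
- by rewrite /= mq' eqxx.
- by rewrite /= lp H4; lia.
- by rewrite H5.
- move=> u; rewrite eU inE negb_or => /andP[up uq].
  have [-> -> ->] := H6 u up; rewrite ez; apply: ptperm_untouched.
    by rewrite porbit_sym (porbit_of_mem p'z) eU inE negb_or up.
  have qz : q.1 \in porbit (wperm z) p.1 by rewrite eU inE porbit_id orbT.
  by rewrite porbit_sym (porbit_of_mem qz) eU inE negb_or up.
- move=> i; rewrite eU inE => /orP[/H7|iq]; rewrite ess /=.
    by move=> ->; rewrite orbT.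
  by rewrite oq iq.
- move=> F; have := H8 F; have := join_sum F ezp nq; rewrite big_cons.
  have c1 : cls z' q.1 = c0 by apply/eqP; rewrite cls_c0 mq.
  have c2 : cls z' p'.1 = cls z p.1.
    by rewrite (cls_mem p'L) !clsE mp.
  have c3 : cls z p'.1 = cls z p.1 by rewrite (cls_mem p'z).
  have c4 : cls z' p.1 = cls z p.1 by rewrite !clsE mp.
  have l2 : len z' p'.1 = len z' p.1 by rewrite (len_mem p'L).
  have l3 : len z p'.1 = len z p.1 by rewrite (len_mem p'z).
  rewrite c1 c2 c3 c4 l2 l3 lq; lia.
Qed.

End Cycles.

(** * Recovering the cut points *)

Section Classify.
Local Open Scope group_scope.
Context {gT : finGroupType} {n : nat}.
Local Notation point := ('I_n * gT)%type.
Implicit Types (x y z v w : wreath gT n) (p q u : point) (g h : gT) (i j : 'I_n).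
Implicit Types (s : seq point) (b : seq nat).

Lemma len_all_gt0 x s : all (leq 1) [seq len x u.1 | u <- s].
Proof. by apply/allP => _ /mapP[u _ ->]; apply: len_gt0. Qed.

(** Converse of [cut_main]. By induction the points after [q] cut the cycle of [p] in [z'], and
    their orbits under [x] cover it. As [q] has a different orbit, it lies outside, and passing from
    [z'] to [z] joins its cycle to that of [p]. This cycle being trivial, walking its length from
    [p'] ends exactly at [q]. *)
Lemma classify z p s s' x b : s = rcons s' p -> x = z * cyc s ->
  uniq (map fst s) -> uniq [seq porbit (wperm x) u.1 | u <- s] ->
  all (fun u => mono x u == 1) s' -> b = [seq len x u.1 | u <- s'] ->
  s' = ptsb z p b /\ sumn b < len z p.1.
Proof.
elim: s' z s b => [|q s' IH] z s b es ex us ux mx ->; first by rewrite len_gt0.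
have [r er] : exists r, r = rcons s' p by eexists.
have [p' ep'] : exists p', p' = head p r by eexists.
have [z' ez] : exists z', z' = z * ptperm q p' by eexists.
have es' : s = q :: r by rewrite es er.
have ex' : x = z' * cyc r.
  by rewrite ez ex es er cyc_cons_rcons -er -ep' mulgA.
move: us ux mx; rewrite es' /= => /andP[qr ur] /andP[qx ux] /andP[/eqP mq mx].
have [b' eb] : exists b', b' = [seq len x u.1 | u <- s'] by eexists.
have [H1 H2] := IH z' r b' er ex' ur ux mx eb.
have hb : all (leq 1) b' by rewrite eb len_all_gt0.
have er' : r = rcons (ptsb z' p b') p by rewrite er H1.
have [[_ _ _ _ _] [H6 H7 _]] := cut_main er' ex' hb H2.
have ep : p' = iter (sumn b') (wact z') p by rewrite ep' er' head_ptsb.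
have p'r : p' \in r.
  by rewrite ep' er; case: s' {IH H1 eb mx er es} => *; apply: mem_head.
have pq : p'.1 != q.1 by apply: contraNneq qr => <-; apply: map_f.
have nq : q.1 \notin porbit (wperm z') p.1.
  apply: contra qx => /H7/hasP[u ur' hu]; apply/mapP; exists u => //.
  by rewrite (porbit_of_mem hu).
have p'z : p'.1 \in porbit (wperm z') p.1.
  by rewrite ep iter_wact1 porbit_iter.
have nq' : q.1 \notin porbit (wperm z') p'.1 by rewrite (porbit_of_mem p'z).
have ezz : z = z' * ptperm p' q by rewrite (ptpermC pq) ez mul_ptpermK // eq_sym.
have [_ lq mq'] := H6 q nq.
have ag c : c <= sumn b' -> iter c (wact z) p = iter c (wact z') p.
  move=> hc; apply: iter_agree => d dc; rewrite {1}ezz wactM ptpermD //.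
    rewrite ep !iter_wact1; apply/eqP => e.
    have dl := leq_trans dc hc.
    by have := dl; rewrite (@len_iter_inj _ _ z' p.1 _ _ (ltn_trans dl H2) H2 e) ltnn.
  by apply: contraNneq nq => <-; rewrite iter_wact1 porbit_iter.
have lz : len z p.1 = len z' p.1 + len z' q.1.
  have p'z2 : p'.1 \in porbit (wperm z) p.1.
    by rewrite ep -ag // iter_wact1 porbit_iter.
  by rewrite -(len_mem p'z2) {1}ezz join_len // (len_mem p'z).
rewrite -eb lz; split; last by rewrite /= lq addnC ltn_add2r.
rewrite /= (ptsb_agree ag) -H1; congr (_ :: _).
rewrite iterD ag // -ep lq {1}ezz join_walk_len // -mq' mq rt1 //.
Qed.

Lemma sumn_rcons b a : sumn (rcons b a) = (sumn b + a)%N.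
Proof. by rewrite -cats1 sumn_cat /= addn0. Qed.

(** Moves the base point to the last cut point, since [cut_main] wants its base point to be an entry
    of the sequence. *)
Lemma ptsb_rcons z p b a (p1 := iter a (wact z) p) :
  ptsb z p (rcons b a) = rcons (ptsb z p1 b) p1.
Proof.
rewrite /p1; elim: b => /= [|c b ->]; first by rewrite addn0.
by rewrite sumn_rcons addnA iterD.
Qed.

Definition split_all x s :=
  all (fun u => mono x u == 1) s && uniq [seq porbit (wperm x) u.1 | u <- s].

(** The last part of [b] is the piece that [cut_main] leaves at its base point, so that lemma is
    applied at the last point of [s]. Trivial monodromy makes the walk of full length return to [p],
    which is thus the head of [s]. *)
Lemma split_allI z p b s x : all (leq 1) b -> sumn b = len z p.1 ->
  mono z p = 1 -> s = ptsb z p b -> x = z * cyc s ->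
  [/\ split_all x s, [seq len x u.1 | u <- s] = b & head p s = p]
  /\ [/\ forall u, u.1 \notin porbit (wperm z) p.1 ->
          [/\ porbit (wperm x) u.1 = porbit (wperm z) u.1,
              len x u.1 = len z u.1 & mono x u = mono z u],
      forall i, i \in porbit (wperm z) p.1 ->
          has (fun u => i \in porbit (wperm x) u.1) s
    & forall F : nat -> cclass gT -> nat,
       \sum_i F (len x i) (cls x i) + (len z p.1 * F (len z p.1) c0)%N
       = \sum_i F (len z i) (cls z i) + (\sum_(a <- b) a * F a c0)%N].
Proof.
case/lastP: b => [|b a]; first by move=> _ /= e; have := len_gt0 z p.1; rewrite -e.
rewrite all_rcons sumn_rcons ptsb_rcons => /andP[a0 hb] hs mz.
have [p1 ep] : exists p1, p1 = iter a (wact z) p by eexists.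
rewrite -ep => es ex.
have p1z : p1.1 \in porbit (wperm z) p.1 by rewrite ep iter_wact1 porbit_iter.
have l1 := len_mem p1z; have m1 : mono z p1 = 1 by rewrite ep mono_iter.
have c1 : cls z p1.1 = c0 by apply/eqP; rewrite cls_c0 m1.
have hL : sumn b < len z p1.1 by rewrite l1 -hs; lia.
have [[H1 H2 H3 H4 H5] [H6 H7 H8]] := cut_main es ex hb hL.
have la : len x p1.1 = a by lia.
split; split.
- by rewrite /split_all H1 andbT es all_rcons H3 andbT H5 m1.
- by rewrite es map_rcons H2 la.
- rewrite es; case: (b) hs => [|d b'] /= hs.
    by rewrite ep -[a]add0n hs iter_mono mz rt1.
  by rewrite ep -iterD hs iter_mono mz rt1.
- by move=> u hu; apply: H6; rewrite (porbit_of_mem p1z).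
- by move=> i hi; apply: H7; rewrite (porbit_of_mem p1z).
- move=> F; have := H8 F; rewrite c1 l1 la -cats1 big_cat /= big_seq1; lia.
Qed.

Lemma split_all_elim z p s x b : x = z * cyc s -> p = head p s -> s != [::] ->
  split_all x s -> b = [seq len x u.1 | u <- s] ->
  [/\ s = ptsb z p b, sumn b = len z p.1 & mono z p = 1].
Proof.
case/lastP: s => // s' p1 ex ep _ /andP[ms us] eb.
move: ms; rewrite all_rcons => /andP[/eqP m1 ms].
have uf : uniq (map fst (rcons s' p1)).
  by move: us; rewrite (map_comp (porbit (wperm x)) fst) => /map_uniq.
have [b' eb'] : exists b', b' = [seq len x u.1 | u <- s'] by eexists.
have [H1 H2] := classify erefl ex uf us ms eb'.
have hb : all (leq 1) b' by rewrite eb' len_all_gt0.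
have ers : rcons s' p1 = rcons (ptsb z p1 b') p1 by rewrite {1}H1.
have [[_ _ _ H4 H5] _] := cut_main ers ex hb H2.
have ep' : p = iter (sumn b') (wact z) p1.
  by rewrite ep ers; case: (b').
have pz : p.1 \in porbit (wperm z) p1.1 by rewrite ep' iter_wact1 porbit_iter.
have mz : mono z p = 1 by rewrite ep' mono_iter -H5.
have ea : iter (len x p1.1) (wact z) p = p1.
  by rewrite ep' -iterD -H4 iter_mono -H5 m1 rt1.
split=> //; first by rewrite eb map_rcons -eb' ptsb_rcons ea.
by rewrite eb map_rcons sumn_rcons -eb' (len_mem pz) H4 addnC.
Qed.

(** Both sides commute with right translation, so on each fibre it is enough to compare them at the
    one point belonging to [s]. *)
Lemma cyc_unique y s : uniq (map fst s) -> fcycle (wact y) s ->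
  (forall u, u.1 \notin map fst s -> wact y u = u) -> y = cyc s.
Proof.
move=> us cy oy; apply: wact_ext => u.
case: (boolP (u.1 \in map fst s)) => [/mapP[v vs e]|h]; last first.
  by rewrite oy // cyc_out.
rewrite (rtE e) !wact_rt; congr rt.
by rewrite (eqP (next_cycle cy vs)) (eqP (next_cycle (cyc_fcycle us) vs)).
Qed.

Lemma cyc_rot k s : uniq (map fst s) -> cyc (rot k s) = cyc s.
Proof.
move=> us; apply/esym/cyc_unique.
- by rewrite map_rot rot_uniq.
- by rewrite rot_cycle cyc_fcycle.
- by move=> u; rewrite map_rot mem_rot; apply: cyc_out.
Qed.

(** [take 1 s] expresses a condition on the first point without a default value. *)
Definition split_head x s :=
  [&& all (fun u => mono x u == 1) (behead s),
      all (fun u => mono x u != 1) (take 1 s)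
    & uniq [seq porbit (wperm x) u.1 | u <- s]].

(** The sequence is a rotation of the one in [cut_main]; the piece at [p] keeps the monodromy of the
    old cycle and is the only non-trivial one. *)
Lemma split_headI z p b s x : all (leq 1) b -> sumn b < len z p.1 ->
  mono z p != 1 -> s = p :: ptsb z p b -> x = z * cyc s ->
  [/\ split_head x s, [seq len x u.1 | u <- s] = (len z p.1 - sumn b)%N :: b
    & forall F : nat -> cclass gT -> nat,
       \sum_i F (len x i) (cls x i)
         + (len z p.1 * F (len z p.1) (cls z p.1))%N
       = \sum_i F (len z i) (cls z i) + (\sum_(a <- b) a * F a c0)%N
         + ((len z p.1 - sumn b) * F (len z p.1 - sumn b)%N (cls z p.1))%N].
Proof.
move=> hb hL mz es ex.
have [s1 es1] : exists s1, s1 = rcons (ptsb z p b) p by eexists.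
have [H H'] := cut_main es1 (erefl (z * cyc s1)) hb hL.
have ec : cyc s1 = cyc s.
  have us : uniq (map fst s).
    case: H => + _ _ _ _; rewrite (map_comp (porbit _) fst) => /map_uniq.
    by rewrite es1 es -cats1 map_cat uniq_catC.
  by rewrite -(cyc_rot 1 us) es1 es rot1_cons.
move: H H'; rewrite ec -ex => -[H1 H2 H3 H4 H5] [H6 H7 H8].
have lp : len x p.1 = (len z p.1 - sumn b)%N by lia.
split.
- rewrite /split_head es /= H3 H5 mz /=.
  move: H1; rewrite es1 -cats1 map_cat uniq_catC /=; by rewrite take0 /= => ->.
- by rewrite es /= H2 lp.
- by move=> F; rewrite -lp H8.
Qed.

Lemma split_head_elim z p s s' x b : x = z * cyc s -> s = p :: s' ->
  uniq (map fst s) -> split_head x s -> b = [seq len x u.1 | u <- s'] ->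
  [/\ s' = ptsb z p b, sumn b < len z p.1 & mono z p != 1].
Proof.
move=> ex es uf; rewrite /split_head {1 2}es /= take0 /= andbT => /and3P[ms mp us] eb.
have e1 : rot 1 s = rcons s' p by rewrite es rot1_cons.
have ex1 : x = z * cyc (rcons s' p) by rewrite -e1 cyc_rot.
have uf1 : uniq (map fst (rcons s' p)) by rewrite -e1 map_rot rot_uniq.
have us1 : uniq [seq porbit (wperm x) u.1 | u <- rcons s' p].
  by rewrite -e1 map_rot rot_uniq.
have [H1 H2] := classify erefl ex1 uf1 us1 ms eb.
have hb : all (leq 1) b by rewrite eb len_all_gt0.
have er : rcons s' p = rcons (ptsb z p b) p by rewrite {1}H1.
by have [[_ _ _ _ H5] _] := cut_main er ex1 hb H2; rewrite -H5.
Qed.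

Definition split_pair x s :=
  all (fun u => mono x u == 1) s
  && (if [seq porbit (wperm x) u.1 | u <- s] is B :: C
      then uniq C && (B \in C) else false).

(** The first transposition in [cyc s] joins the cycles of [p] and [q] into a trivial one, to which
    [split_allI] applies. On it the fibre of [q] is reached from [p] after [len z q.1] steps, so the
    condition on [ssums b] says that [q] is not over a cut point. *)
Lemma split_pairI z p q b s x : all (leq 1) b -> q.1 \notin porbit (wperm z) p.1 ->
  mono z p * mono z q = 1 -> sumn b = len z p.1 + len z q.1 ->
  len z q.1 \notin ssums b ->
  s = q :: ptsb (z * ptperm q p) p b -> x = z * cyc s ->
  [/\ split_pair x s, uniq (map fst s), [seq len x u.1 | u <- behead s] = b,
      head p (behead s) = p
    & forall F : nat -> cclass gT -> nat,
       \sum_i F (len x i) (cls x i)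
         + ((len z p.1 * F (len z p.1) (cls z p.1))%N
            + (len z q.1 * F (len z q.1) (cls z q.1))%N)
       = \sum_i F (len z i) (cls z i) + (\sum_(a <- b) a * F a c0)%N].
Proof.
move=> hb npq mpq hs hq es ex.
have pq := notin_porbit_neq npq.
have [z' ez] : exists z', z' = z * ptperm p q by eexists.
have [s' es'] : exists s', s' = ptsb z' p b by eexists.
have lz' : len z' p.1 = len z p.1 + len z q.1 by rewrite ez join_len.
have mz' : mono z' p = 1 by rewrite ez join_mono.
have lq := len_gt0 z q.1.
have ess : s = q :: s' by rewrite es es' ez (ptpermC pq).
have s'0 : s' != [::].
  by rewrite es'; case: (b) hs => //=; lia.
have hp : head p s' = p.
  by rewrite es'; case: (b) hs => //= d b' hs; rewrite hs -lz' iter_mono mz' rt1.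
have ex' : x = z' * cyc s'.
  rewrite ex ess; case: (s') s'0 hp => //= u t _ ->.
  by rewrite ez (ptpermC pq) mulgA.
have hs' : sumn b = len z' p.1 by rewrite lz'.
have [[H1 H2 _] [H3 H4 H5]] := split_allI hb hs' mz' es' ex'.
have qz' : q.1 \in porbit (wperm z') p.1.
  by rewrite ez join_porbit // inE porbit_id orbT.
have eq : iter (len z q.1) (wact z') p = rt q (mono z q).
  by rewrite ez join_walk_len.
have /hasP[u us' hu] := H4 _ qz'.
move: (H1) => /andP[ms us].
split.
- rewrite /split_pair ess /= ms us /= -cls_c0 (cls_mem hu) cls_c0.
  rewrite (allP ms) //=; apply/mapP; exists u => //; exact: porbit_of_mem.
- rewrite ess /=; move: us; rewrite (map_comp (porbit _) fst) => /map_uniq ->.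
  rewrite andbT; apply/mapP => -[v]; rewrite es' ptsbE => /mapP[c cb ->].
  have -> : q.1 = (iter (len z q.1) (wact z') p).1 by rewrite eq.
  rewrite !iter_wact1 => e.
  have := ssums_le cb; rewrite hs' leq_eqVlt => /predU1P[e'|lt].
    move: e; rewrite e' iter_len -iter_wact1 eq /= => e.
    by rewrite e eqxx in pq.
  have lqz : len z q.1 < len z' p.1 by rewrite lz' -[ltnLHS]add0n ltn_add2r len_gt0.
  by move: hq; rewrite (len_iter_inj lqz lt e) cb.
- by rewrite ess /= H2.
- by rewrite ess.
- move=> F; have := H5 F; have := join_sum F ez npq.
  have -> : cls z' p.1 = c0 by apply/eqP; rewrite cls_c0 mz'.
  by clear; lia.
Qed.

Lemma split_pair_elim z p q s s' x b : x = z * cyc s -> s = q :: p :: s' ->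
  uniq (map fst s) -> split_pair x s -> b = [seq len x u.1 | u <- p :: s'] ->
  [/\ q.1 \notin porbit (wperm z) p.1, p :: s' = ptsb (z * ptperm q p) p b,
      sumn b = len z p.1 + len z q.1, len z q.1 \notin ssums b
    & mono z p * mono z q = 1].
Proof.
move=> ex es uf; rewrite /split_pair {1 2}es.
have [r er] : exists r, r = p :: s' by eexists.
rewrite -er /= => /andP[/andP[/eqP mq ms] /andP[us qs]] eb.
have rs : s = q :: r by rewrite es er.
move: uf; rewrite rs /= => /andP[qr ur].
have pq : p.1 != q.1 by apply: contraNneq qr => <-; rewrite er mem_head.
have [z' ez] : exists z', z' = z * ptperm p q by eexists.
have ex' : x = z' * cyc r.
  by rewrite ex es er ez (ptpermC pq) /= -/(cyc (p :: s')) mulgA.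
have ep : p = head p r by rewrite er.
have r0 : r != [::] by rewrite er.
have A1 : split_all x r by rewrite /split_all ms us.
have [H1 H2 H3] := split_all_elim ex' ep r0 A1 eb.
have hb : all (leq 1) b by rewrite eb len_all_gt0.
have [[_ _ _] [H4 H5 _]] := split_allI hb H2 H3 H1 ex'.
(* Otherwise the orbit of [q] would be the same in [x] and [z'], and could not contain a point of
   [r], all of which lie over the orbit of [p]. *)
have qz' : q.1 \in porbit (wperm z') p.1.
  apply/negPn/negP => nq; have [eo _ _] := H4 q nq.
  case/mapP: qs => u ur' eu.
  have uz : u.1 \in porbit (wperm z') p.1.
    by apply: (@mem_ptsb_porbit _ _ z' p b); rewrite -H1 mem_rcons inE ur' orbT.
  have uq : u.1 \in porbit (wperm z') q.1 by rewrite -eo eu porbit_id.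
  move: nq; rewrite -(porbit_of_mem uz) (porbit_of_mem uq) porbit_id //.
have ezz : z = z' * ptperm p q by rewrite ez mul_ptpermK.
have [C1 C2 C3 C4] := cut_spec ezz qz' pq.
split=> //; first by rewrite -(ptpermC pq) -ez -H1 er.
- by rewrite H2 C2.
- apply/negP => hq; case/negP: qr; apply/mapP.
  exists (iter (len z q.1) (wact z') p); last by rewrite C3.
  by rewrite H1 ptsbE; apply/mapP; exists (len z q.1).
- by rewrite -C4.
Qed.

End Classify.

(** * Types *)

Section Types.
Local Open Scope group_scope.
Context {gT : finGroupType} {n : nat}.
Local Notation point := ('I_n * gT)%type.
Implicit Types (x y z v w : wreath gT n) (p q u : point) (g h : gT) (i j : 'I_n).
Implicit Types (s : seq point) (b : seq nat) (c : cclass gT).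

Lemma iter_wact2 x k i g : (iter k (wact x) (i, g)).2
  = (\prod_(j <- rev (traject (wperm x) (wperm x i) k)) wbase x j) * g.
Proof.
elim: k => [|k IH]; first by rewrite big_nil mul1g.
rewrite trajectSr rev_rcons big_cons iterS [LHS]/= IH mulgA.
by rewrite iter_wact1 -iterSr.
Qed.

(** The cycle product starts at [i], the monodromy at [wperm x i]. Evaluating the product over the
    closed trajectory in two ways shows that the base component at [i] conjugates one into the
    other. *)
Lemma cls_cycle_product x i c : (cycle_product x i \in val c) = (cls x i == c).
Proof.
rewrite /cls -cls_ofE; congr (_ == _).
have em : mono x (i, 1)
   = \prod_(j <- rev (traject (wperm x) (wperm x i) (len x i))) wbase x j.
  by rewrite /mono iter_wact2 mulg1 invg1 mul1g.
have : \prod_(j <- rev (traject (wperm x) i (len x i).+1)) wbase x j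
   = wbase x i * cycle_product x i.
  by rewrite trajectSr rev_rcons big_cons iter_len.
rewrite trajectS rev_cons big_rcons /= -em => e.
by rewrite -(cls_ofJ (mono x (i, 1)) (wbase x i)) conjgE e mulgA mulVg mul1g.
Qed.

Definition has_cls x c (B : {set 'I_n}) := [exists i in B, cls x i == c].

Definition cyc_lens x c : seq nat :=
  [seq #|B| | B : {set 'I_n} <- enum (porbits (wperm x)) & has_cls x c B].

Lemma wtypeE x c : wtype x c = mkpartn (cyc_lens x c).
Proof.
rewrite /wtype /cyc_lens; congr (mkpartn (map _ _)); apply: eq_filter => B.
by apply: eq_existsb => i; rewrite cls_cycle_product.
Qed.

Lemma has_cls_porbit x c i : has_cls x c (porbit (wperm x) i) = (cls x i == c).
Proof.
apply/exists_inP/idP => [[j hj]|h]; first by rewrite (cls_mem hj).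
by exists i; rewrite ?porbit_id.
Qed.

Lemma sum_cyc_lens x c (Q : pred nat) :
  \sum_(a <- cyc_lens x c | Q a) a
  = \sum_i (Q (len x i) && (cls x i == c)).
Proof.
rewrite big_map big_filter_cond /= big_enum_cond /= -[RHS]big_mkcond /=.
rewrite (partition_big (porbit (wperm x)) (fun B => [&& B \in porbits (wperm x),
  has_cls x c B & Q #|B|])) /=; last first.
  by move=> i /andP[hQ hc]; rewrite imset_f // has_cls_porbit hc.
apply: eq_bigr => B /and3P[/imsetP[i _ ->]]; rewrite has_cls_porbit => hc hQ.
rewrite -sum1_card; apply: eq_bigl => j.
rewrite eq_porbit_mem; case: (boolP (j \in _)) => hj; rewrite ?andbF //.
by rewrite (len_mem hj) (cls_mem hj) hc andbT /len hQ.
Qed.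

Lemma mult_wtype x c k : 0 < k -> (k * mult k (wtype x c))%N
  = \sum_i ((len x i == k) && (cls x i == c)).
Proof.
move=> k0; rewrite wtypeE mult_mkpartn -lt0n k0 mul1n.
rewrite -(sum_cyc_lens x c (pred1 k)).
elim: (cyc_lens x c) => [|a s IH] /=; first by rewrite big_nil muln0.
by rewrite big_cons mulnDr IH; case: eqP => [->|_] /=; rewrite ?muln1 ?muln0.
Qed.

(** A part at [c0] is one less than the length of its cycle. Fixed points with trivial monodromy
    give the part 0 and cannot be seen at positive [k]. *)
Lemma mult_mtype_wtype x c k : 0 < k ->
  mult k (mtype x c) = mult (k + (c == c0)) (wtype x c).
Proof.
rewrite ffunE; case: eqP => [->|_] k0; last by rewrite addn0.
rewrite mult_mkpartn -lt0n k0 mul1n count_map addn1; apply: eq_count => -[|a] //=.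
by case: k k0.
Qed.

Lemma mult_mtype x c k : 0 < k -> ((k + (c == c0)) * mult k (mtype x c))%N
  = \sum_i ((len x i == k + (c == c0)) && (cls x i == c)).
Proof. by move=> k0; rewrite mult_mtype_wtype // mult_wtype ?addn_gt0 ?k0. Qed.

Lemma psize_mkpartn (s : seq nat) : psize (mkpartn s) = sumn s.
Proof.
rewrite /psize /= (perm_sumn (permEl (perm_sort _ _))).
by elim: s => //= -[|a] s IH /=; rewrite ?IH ?add0n.
Qed.

Lemma cyc_lens_pos x c : 0 \notin cyc_lens x c.
Proof.
apply/mapP => -[B]; rewrite mem_filter mem_enum => /andP[_ /imsetP[i _ ->]].
by move=> e; have := len_gt0 x i; rewrite /len -e.
Qed.

Lemma size_mkpartn (s : seq nat) : 0 \notin s -> size (mkpartn s) = size s.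
Proof.
move=> s0; rewrite /= size_sort size_filter; apply/eqP; rewrite -all_count.
by apply/allP => a; apply: contraTneq => ->.
Qed.

Definition triv_cycles x : {set {set 'I_n}} :=
  [set B in porbits (wperm x) | has_cls x c0 B].

Lemma size_wtype_c0 x : size (wtype x c0) = #|triv_cycles x|.
Proof.
rewrite wtypeE size_mkpartn ?cyc_lens_pos // size_map -sum1_size big_filter.
by rewrite big_enum_cond /= -sum1_card; apply: eq_bigl => B; rewrite inE.
Qed.

Lemma sum_psize_wtype x : \sum_c psize (wtype x c) = n.
Proof.
under eq_bigr => c _ do rewrite wtypeE psize_mkpartn sumnE
  (sum_cyc_lens x c predT).
rewrite exchange_big /= -[RHS]card_ord -sum1_card; apply: eq_bigr => i _.
by rewrite (bigD1 (cls x i)) //= eqxx big1 // => c /negPf; rewrite eq_sym => ->.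
Qed.

(** The modification at [c0] takes one point away from each trivial cycle. *)
Lemma norm_mtype x : norm (mtype x) + #|triv_cycles x| = n.
Proof.
rewrite -[RHS](sum_psize_wtype x) -size_wtype_c0 /norm.
rewrite (bigD1 c0) // [RHS](bigD1 c0) // addnAC; congr (_ + _); last first.
  by apply: eq_bigr => c /negPf hc; rewrite ffunE hc.
rewrite ffunE eqxx psize_mkpartn /psize.
have /andP[_] := partsP (wtype x c0).
elim: (parts _) => //= a s IH; rewrite inE negb_or => /andP[a0 /IH <-].
by rewrite eq_sym -lt0n in a0; lia.
Qed.

End Types.

(** * Cycles touched by a lifted cycle *)

(** A single coincidence occupies two positions; the factor 2 in [count_split_coinc] comes from
    here. *)
Lemma count_repeated (T : eqType) (l : seq T) : (size (undup l)).+1 = size l ->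
  count (fun a => 1 < count_mem a l) l = 2.
Proof.
elim: l => //= a l IH; case: ifP => al.
  move=> [sl]; have ul : uniq l.
    by apply: negbFE; rewrite -ltn_size_undup sl ltnn.
  rewrite eqxx (count_uniq_mem _ ul) al /= (_ : count _ l = count_mem a l).
    by rewrite (count_uniq_mem _ ul) al.
  apply: eq_in_count => d dl; rewrite (count_uniq_mem _ ul) dl /= eq_sym.
  by case: eqP.
move=> /= [/IH IH2]; rewrite eqxx (count_memPn _) ?al //= -[RHS]IH2.
apply: eq_in_count => d dl; suff /negPf -> : a != d by [].
by apply: contraFneq al => ->.
Qed.

(** Double counting of the pairs formed by a sequence in [Q] and a rotation of it satisfying [E]. It
    is used with [E] saying that the exceptional point comes first. *)
Lemma rot_count (A : finType) r d (Q E : pred (r.+1.-tuple A)) :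
  (forall k t, Q (rot_tuple k t) = Q t) ->
  (forall t, Q t -> \sum_(j < r.+1) E (rot_tuple j t) = d) ->
  d * #|Q| = r.+1 * #|[pred t | Q t && E t]|.
Proof.
move=> hQ hE; rewrite mulnC -sum_nat_const.
rewrite (eq_bigr (fun t => \sum_(j < r.+1) E (rot_tuple j t) : nat)); last first.
  by move=> t /hE ->.
rewrite exchange_big /= (eq_bigr (fun=> #|[pred t | Q t && E t]|)) ?sum_nat_const ?card_ord //.
move=> j _; rewrite -sum1_card big_mkcond [RHS]big_mkcond /=.
have inj : injective (fun t : r.+1.-tuple A => rot_tuple j t).
  by move=> t1 t2 /(congr1 val) /= /rot_inj /val_inj.
rewrite [RHS](reindex_inj inj) /=.
by apply: eq_bigr => t _; rewrite !inE hQ !unfold_in; case: (Q t); case: (E _).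
Qed.

Lemma sum_rot_head (A : finType) r (a : pred A) (x0 : A) (t : r.+1.-tuple A) :
  \sum_(j < r.+1) a (head x0 (rot j t)) = count a t.
Proof.
rewrite -sum1_count (big_nth x0) size_tuple big_mkord [RHS]big_mkcond /=.
apply: eq_bigr => j _; rewrite /rot -nth0 nth_cat size_drop size_tuple.
by rewrite subn_gt0 ltn_ord nth_drop addn0; case: (a _).
Qed.

Section Touched.
Local Open Scope group_scope.
Context {gT : finGroupType} {n : nat}.
Local Notation point := ('I_n * gT)%type.
Implicit Types (x y z v w : wreath gT n) (p q u : point) (g h : gT) (i j : 'I_n).
Implicit Types (s : seq point) (b : seq nat) (c : cclass gT).

Definition trivs x s :=
  size (undup [seq porbit (wperm x) u.1 | u <- s & mono x u == 1]).

Lemma untouched_sub (M : seq 'I_n) x z :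
  (forall u, u.1 \notin M -> wact x u = wact z u) ->
  [set B in triv_cycles x | ~~ has (mem B) M]
    \subset [set B in triv_cycles z | ~~ has (mem B) M].
Proof.
move=> h; apply/subsetP => B; rewrite !inE => /andP[/andP[/imsetP[i _ ->]]].
rewrite has_cls_porbit => hc hM; rewrite hM andbT.
have [|/= eo _ em] := @untouched _ _ z x (i, 1).
  move=> j g hj; rewrite h //=; apply: contra hM => jM.
  by apply/hasP; exists j.
rewrite -eo imset_f //= has_cls_porbit.
by rewrite /cls em.
Qed.

Lemma card_touched (x : wreath gT n) s :
  #|[set B in triv_cycles x | has (mem B) (map fst s)]| = trivs x s.
Proof.
rewrite /trivs -(card_uniqP (undup_uniq _)); apply: eq_card => B.
rewrite mem_undup !inE; apply/andP/mapP.
  case=> /andP[/imsetP[i _ ->]]; rewrite has_cls_porbit => hc.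
  case/hasP => _ /mapP[u us ->] /= hu; exists u; last by rewrite (porbit_of_mem hu).
  by rewrite mem_filter us andbT -cls_c0 (cls_mem hu).
case=> u; rewrite mem_filter -cls_c0 => /andP[hc us] ->.
rewrite imset_f //= has_cls_porbit hc; split=> //.
by apply/hasP; exists u.1; rewrite ?map_f //= porbit_id.
Qed.

(** Trivial cycles that miss [s] are common to [x] and [z], so the whole change of their number is
    visible on the cycles that meet [s]. *)
Lemma trivs_norm z s x r : x = z * cyc s ->
  norm (mtype z) = (norm (mtype x) + r)%N -> trivs x s = (trivs z s + r)%N.
Proof.
move=> ex hn.
have ag u : u.1 \notin map fst s -> wact x u = wact z u.
  by move=> hu; rewrite ex wactM cyc_out.
have e : [set B in triv_cycles x | ~~ has (mem B) (map fst s)]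
       = [set B in triv_cycles z | ~~ has (mem B) (map fst s)].
  apply/eqP; rewrite eqEsubset !untouched_sub // => u hu; by rewrite ag.
have S y : #|triv_cycles y| = (trivs y s
    + #|[set B in triv_cycles y | ~~ has (mem B) (map fst s)]|)%N.
  rewrite -card_touched -(cardsID [set B : {set 'I_n} | has (mem B) (map fst s)]).
  by congr (_ + _)%N; apply: eq_card => B; rewrite !inE andbC.
have := norm_mtype x; have := norm_mtype z; rewrite !S e; lia.
Qed.

Definition split_one x s :=
  (count (fun u => mono x u != 1) s == 1%N)
  && uniq [seq porbit (wperm x) u.1 | u <- s].

(** The last clause follows from the count of trivial cycles; recording it tells the enumeration
    that the two joined cycles are non-trivial. *)
Definition split_coinc z x s :=
  [&& all (fun u => mono x u == 1) s,
      (size (undup [seq porbit (wperm x) u.1 | u <- s])).+1 == size s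
    & all (fun u => mono z u != 1) s].

Lemma porbit_trivE x p q : porbit (wperm x) p.1 = porbit (wperm x) q.1 ->
  (mono x p == 1) = (mono x q == 1).
Proof.
move=> e; have h : p.1 \in porbit (wperm x) q.1 by rewrite -e porbit_id.
by rewrite -!cls_c0 (cls_mem h).
Qed.

Lemma trivs_eq0 z s : (trivs z s == 0) = all (fun u => mono z u != 1) s.
Proof.
have H (T : eqType) (l : seq T) : (size (undup l) == 0) = (size l == 0).
  by case: l => //= a l; case: ifP => //; rewrite -mem_undup; case: (undup l).
rewrite /trivs H size_map size_filter -leqn0 leqNgt -has_count -all_predC.
exact: eq_all.
Qed.

(** The number [trivs x s] is [r.+1] or [r]. The first value means [split_all]. With the second, [z]
    meets no trivial cycle along [s], and either one point is off the trivial cycles of [x] or two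
    points share one. *)
Lemma trivs_split z s x r : size s = r.+1 -> trivs x s = (trivs z s + r)%N ->
  (split_all x s + split_one x s + split_coinc z x s = 1)%N.
Proof.
move=> ss ht.
have c2 : split_all x s -> split_one x s = false.
  case/andP => ms _; rewrite /split_one (_ : count _ s = 0%N) //.
  by apply/eqP; rewrite -leqn0 leqNgt -has_count -all_predC; apply: sub_all ms => u /= ->.
have ltx : trivs x s <= size [seq u <- s | mono x u == 1].
  by rewrite /trivs (leq_trans (size_undup _)) // size_map.
have lJ : size [seq u <- s | mono x u == 1] <= r.+1.
  by rewrite -ss size_filter count_size.
have [aJ|nJ] := boolP (all (fun u => mono x u == 1) s).
  have eJ : [seq u <- s | mono x u == 1] = s by apply/all_filterP.
  have et : trivs x s = size (undup [seq porbit (wperm x) u.1 | u <- s]).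
    by rewrite /trivs eJ.
  have -> : split_one x s = false.
    rewrite /split_one (_ : count _ s = 0%N) //.
    by apply/eqP; rewrite -leqn0 leqNgt -has_count -all_predC; apply: sub_all aJ => u /= ->.
  rewrite /split_all aJ /split_coinc aJ addn0 /= -et -trivs_eq0 ss eqSS.
  rewrite -[uniq _]negbK -ltn_size_undup -et size_map ss.
  case: (ltngtP (trivs x s) r) => h; [lia| |]; last first.
    by rewrite h ltnSn /= (_ : trivs z s = 0%N) //; lia.
  by rewrite ltnNge h.
have lt : size [seq u <- s | mono x u == 1] < r.+1.
  by rewrite -ss size_filter ltn_neqAle count_size andbT -all_count.
have eJ : size [seq u <- s | mono x u == 1] = r by lia.
rewrite /split_all (negPf nJ) /split_coinc (negPf nJ) /= addn0 add0n.
have cn : count (fun u => mono x u != 1) s = 1%N.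
  have := count_predC (fun u => mono x u == 1) s.
  rewrite -size_filter eJ ss -addn1 => /addnI <-.
  exact: eq_count.
rewrite /split_one cn eqxx /=; apply/eqP; rewrite eqb1.
(* The points on trivial cycles are put first: they are [r] in number and meet at least [r] cycles,
   hence distinct ones, and the remaining point lies on none of these. *)
have up := perm_uniq (perm_map (fun u => porbit (wperm x) u.1)
  (permEl (perm_filterC (fun u => mono x u == 1) s))).
rewrite -up map_cat cat_uniq.
apply/and3P; split.
- by apply: negbFE; rewrite -ltn_size_undup size_map -/(trivs x s) eJ; lia.
- apply/hasPn => B /mapP[u]; rewrite mem_filter => /andP[hu _] ->.
  apply/mapP => -[v]; rewrite mem_filter => /andP[hv _] /porbit_trivE e.
  by have := hu; rewrite /= e hv.
- have : size [seq u <- s | predC (fun u => mono x u == 1) u] = 1%N.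
    by rewrite size_filter.
  by case: [seq u <- s | _] => // u [].
Qed.

Lemma split_one_head x p s :
  (split_one x (p :: s)) && (mono x p != 1) = split_head x (p :: s).
Proof.
rewrite /split_one /split_head /= take0 /= andbT.
case: (mono x p == 1); rewrite ?andbF //= andbT add1n eqSS.
by rewrite -leqn0 leqNgt -has_count -all_predC; congr andb; apply: eq_all => u /=; rewrite negbK.
Qed.

Lemma split_coinc_head z x p s (fs := [seq porbit (wperm x) u.1 | u <- p :: s]) :
  split_coinc z x (p :: s) && (1 < count_mem (porbit (wperm x) p.1) fs)
  = split_pair x (p :: s) && all (fun u => mono z u != 1) (p :: s).
Proof.
rewrite /fs /split_coinc /split_pair.
case: (all (fun u => mono x u == 1) _) => //.
case: (all (fun u => mono z u != 1) _); rewrite ?andbF //.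
rewrite [map _ _]/= [count_mem _ _]/= eqxx add1n ltnS -has_count has_pred1.
rewrite !andbT /= -(size_map (fun u => porbit (wperm x) u.1) s).
set C := [seq _ | u <- s]; case: (_ \in C) => /=; rewrite ?andbF // !andbT eqSS.
apply/eqP/idP => [e|/undup_id->//].
by apply: negbFE; rewrite -ltn_size_undup e ltnn.
Qed.

End Touched.

(** * Elements of type (r) *)

Section SingleType.
Local Open Scope group_scope.
Context {gT : finGroupType} {n : nat}.
Local Notation point := ('I_n * gT)%type.
Implicit Types (x y z v w : wreath gT n) (p q u : point) (g h : gT) (i j : 'I_n).
Implicit Types (s : seq point) (b : seq nat) (c : cclass gT).

Lemma fix_point y u : wact y u = u -> len y u.1 = 1%N /\ mono y u = 1.
Proof.
move=> e; have l1 : len y u.1 = 1%N.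
  by apply: len_first => //; [rewrite /= -[in RHS]e|case].
by split=> //; apply: (@rt_inj _ _ u); rewrite -iter_mono l1 /= e rt1.
Qed.

(** The last clause says that [y] and the first point determine the sequence, which is what makes
    the fibres of [cyc] countable. *)
Lemma fcycle_len y s u : uniq (map fst s) -> fcycle (wact y) s -> u \in s ->
  [/\ len y u.1 = size s, mono y u = 1
    & forall k s', rot k s = u :: s' -> u :: s' = traject (wact y) u (size s)].
Proof.
move=> us cs usn.
have key k s' : rot k s = u :: s' ->
    rcons s' u = traject (wact y) (wact y u) (size s).
  move=> e; move: cs; rewrite -(rot_cycle k) e /= => /fpathE ->.
  by rewrite size_rcons -(size_rot k s) e.
have [k s' e] := rot_to usn; have kk := key _ _ e.
have ei : iter (size s) (wact y) u = u.
  have : last u (rcons s' u) = u by rewrite last_rcons.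
  by rewrite kk last_traject.
have tr k' s'' : rot k' s = u :: s'' -> u :: s'' = traject (wact y) u (size s).
  move=> e'; have := key _ _ e'; rewrite -(size_rot k') e' => kk'.
  have es : size s = (size s'').+1 by rewrite -(size_rot k' s) e'.
  rewrite es /= in ei kk' *; congr (_ :: _).
  have : rcons s'' u = rcons (traject (wact y) (wact y u) (size s'')) u.
    by rewrite kk' -trajectS trajectSr -iterSr /= ei.
  by move/rcons_inj => -[].
have s0 : 0 < size s by rewrite -(size_rot k s) e.
have ls : len y u.1 = size s.
  apply: len_first => //; first by rewrite -iter_wact1 ei.
  move=> a ha; rewrite -iter_wact1 => ea.
  have ut : uniq (map fst (traject (wact y) u (size s))).
    by rewrite -(tr _ _ e) -e map_rot rot_uniq.
  have := nth_uniq u.1 _ _ ut; rewrite size_map size_traject.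
  move=> /(_ a 0 ltac:(lia) s0).
  rewrite !(nth_map u) ?size_traject ?nth_traject //=; try lia.
  rewrite ea eqxx; lia.
split=> //; apply: (@rt_inj _ _ u); rewrite -iter_mono ls ei rt1 //.
Qed.

Lemma cyc_rev s : uniq (map fst s) -> (cyc s)^-1 = cyc (rev s).
Proof.
move=> us; apply: cyc_unique.
- by rewrite map_rev rev_uniq.
- rewrite rev_cycle; have := cyc_fcycle us; congr is_true.
  apply: eq_cycle => a b /=.
  by apply/eqP/eqP => <-; rewrite ?wactK ?wactKV.
- by move=> u; rewrite map_rev mem_rev => /cyc_out {1}<-; rewrite wactK.
Qed.

Lemma mult_single k r c : 0 < k ->
  mult k (single r c0 c) = ((c == c0) && (k == r)).
Proof.
move=> k0; rewrite ffunE; case: (c == c0); rewrite mult_mkpartn -lt0n k0 mul1n /=.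
  by rewrite addn0 eq_sym.
by [].
Qed.

Lemma ptfun_eq (l m : ptfun gT) :
  (forall k c, 0 < k -> mult k (l c) = mult k (m c)) -> l = m.
Proof.
by move=> h; apply/ffunP => c; apply: partn_eq => -[|k]; rewrite ?mult0 ?h.
Qed.

Lemma mtype_cyc r s : 0 < r -> size s = r.+1 -> uniq (map fst s) ->
  mtype (cyc s) = single r c0.
Proof.
move=> r0 ss us; set y := cyc s.
have inn i : i \in map fst s -> len y i = r.+1 /\ cls y i = c0.
  case/mapP => u us' ->; have [-> e _] := fcycle_len us (cyc_fcycle us) us'.
  by split=> //; apply/eqP; rewrite cls_c0 e.
have out i : i \notin map fst s -> len y i = 1%N /\ cls y i = c0.
  move=> hi; have [|l1 m1] := @fix_point y (i, 1); first exact: cyc_out.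
  by split=> //; apply/eqP; rewrite -[i]/((i, 1 : gT).1) cls_c0 m1.
apply: ptfun_eq => k c k0; rewrite mult_single //.
apply/eqP; rewrite -(@eqn_pmul2l (k + (c == c0))) ?addn_gt0 ?k0 //.
rewrite mult_mtype //; apply/eqP.
have cA i : cls y i = c0 by case: (boolP (i \in map fst s)) => [/inn[]|/out[]].
have [->|nc] := eqVneq c c0; last first.
  by rewrite muln0 big1 // => i _; rewrite cA [c0 == c]eq_sym (negPf nc) andbF.
rewrite addn1 /= (eq_bigr (fun i => (k == r) && (i \in map fst s) : nat)).
  case: eqP => [->|_] /=; last by rewrite big1 // muln0.
  rewrite muln1 -big_mkcond /= sum1_card (card_uniqP us) size_map ss //.
move=> i _; rewrite cA eqxx andbT.
case: (boolP (i \in map fst s)) => [/inn[-> _]|/out[-> _]].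
  by rewrite eqSS eq_sym andbT.
by rewrite andbF eqSS; case: k k0.
Qed.

Lemma single_spec r y : 0 < r -> mtype y = single r c0 ->
  let A := [set i | len y i == r.+1] in
  [/\ #|A| = r.+1, forall u, u.1 \notin A -> wact y u = u
    & forall u, u.1 \in A -> mono y u = 1 /\ A = porbit (wperm y) u.1].
Proof.
move=> r0 my A.
have T c k : 0 < k -> \sum_i ((len y i == k + (c == c0)) && (cls y i == c))
    = ((c == c0) && (k == r) * r.+1)%N.
  move=> k0; rewrite -mult_mtype // my mult_single //.
  case: (c == c0); rewrite ?muln0 //= mulnC addn1.
  by case: eqP => [->|].
have cA i : (len y i == r.+1) || (len y i == 1%N) /\ cls y i = c0.
  (* [T] only sees positive parts, so the fixed points of trivial monodromy are separated first. *)
  have [e|ne] := eqVneq (len y i) (0 + (cls y i == c0))%N.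
    have := len_gt0 y i; rewrite e add0n; case: eqP => // -> _; rewrite orbT //.
  have l0 := len_gt0 y i.
  have k0 : 0 < len y i - (cls y i == c0) by case: (cls y i == c0) ne; lia.
  have := T (cls y i) _ k0; rewrite subnK; last by case: (cls y i == c0) ne; lia.
  rewrite (bigD1 i) //= !eqxx /= add1n.
  case: eqP => //= ->; case: eqP => //= e _; split=> //.
  by rewrite -e; apply/orP; left; apply/eqP; lia.
have cc i : cls y i = c0 by have [] := cA i.
have cardA : #|A| = r.+1.
  have := T c0 r r0; rewrite !eqxx /= mul1n addn1 => <-.
  rewrite -sum1_card big_mkcond; apply: eq_bigr => i _.
  by rewrite inE cc eqxx andbT; case: eqP.
split=> //.
  move=> u; rewrite inE => hu; have [] := cA u.1; rewrite (negPf hu) /= => /eqP l1 c1.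
  have := iter_mono y u; rewrite l1 /= => ->.
  by move/eqP: c1; rewrite cls_c0 => /eqP ->; rewrite rt1.
move=> u uA; split; first by apply/eqP; rewrite -cls_c0 cc.
apply/esym/eqP; rewrite eqEcard cardA; move: uA; rewrite inE => /eqP lu.
rewrite -/(len y u.1) lu leqnn andbT; apply/subsetP => j /len_mem e.
by rewrite inE e lu.
Qed.

Definition fibred r (t : r.-tuple point) := uniq (map fst t).

(** The sequences are the trajectories of [y] of length [r.+1], one from every point over the
    support. *)
Lemma card_cyc_fibre r y : 0 < r -> mtype y = single r c0 ->
  #|[pred t : r.+1.-tuple point | fibred t && (cyc t == y)]| = (r.+1 * #|gT|)%N.
Proof.
move=> r0 my; have [cA oA iA] := single_spec r0 my.
set A := [set i | _] in cA oA iA.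
have lA i : (i \in A) = (len y i == r.+1) by rewrite inE.
pose f p : r.+1.-tuple point := Tuple (introT eqP (size_traject (wact y) p r.+1)).
have -> : (r.+1 * #|gT|)%N = #|[set p : point | p.1 \in A]|.
  rewrite -cA -cardsT -cardsX; apply: eq_card => p; rewrite !inE andbT //.
have finj : {in [set p : point | p.1 \in A] &, injective f}.
  by move=> p q _ _ /(congr1 (fun t => head p (val t))).
rewrite -(card_in_imset finj); apply: eq_card => t; rewrite !inE.
apply/andP/imsetP => [[ut /eqP ey]|[p]].
  have ht : thead t \in val t by case/tupleP: t {ut ey} => p t; rewrite theadE mem_head.
  have [l1 m1 tr] := fcycle_len ut (cyc_fcycle ut) ht.
  exists (thead t); first by rewrite inE lA -ey l1 size_tuple.
  apply/val_inj; rewrite /= -ey; case/tupleP: t {ut ey ht l1 m1} tr => p t tr.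
  have := tr 0 t; rewrite rot0 theadE => /(_ erefl) /= ->.
  by rewrite size_tuple.
rewrite inE => pA ->.
have [mp Ap] := iA p pA; have lp : len y p.1 = r.+1 by apply/eqP; rewrite -lA.
have mf : map fst (traject (wact y) p r.+1) = traject (wperm y) p.1 r.+1.
  by elim: (r.+1) (p) => //= k IH q; rewrite IH.
have uf : fibred (f p).
  rewrite /fibred [map _ _]mf -lp; exact: uniq_traject_porbit.
split=> //; apply/eqP/esym/cyc_unique => //.
- have : fcycle (wact y) (traject (wact y) p r.+1).
    rewrite /= rcons_path fpath_traject last_traject /= -iterS -lp iter_mono mp rt1.
    by rewrite /= eqxx.
  done.
- move=> u; rewrite [map _ _]mf -lp -porbit_traject -Ap; exact: oA.
Qed.

Lemma mtype_inv_single r y : 0 < r ->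
  mtype y = single r c0 -> mtype y^-1 = single r c0.
Proof.
move=> r0 my; have : 0 < #|[pred t : r.+1.-tuple point | fibred t && (cyc t == y)]|.
  by rewrite card_cyc_fibre // muln_gt0 /=; apply/card_gt0P; exists 1.
case/card_gt0P => t; rewrite inE => /andP[ut /eqP <-].
rewrite cyc_rev //; apply: (mtype_cyc r0).
  by rewrite size_rev size_tuple.
by rewrite map_rev rev_uniq.
Qed.

(* Each element of type [(r)] is [cyc t] for exactly [r.+1 * #|gT|] sequences
   [t], one for each point of its support. *)
Lemma count_factor r (lam : ptfun gT) z : 0 < r ->
  (r.+1 * #|gT| * #|[set y | (mtype y == single r c0) && (mtype (z * y^-1)%g == lam)]|)%N
  = #|[pred t : r.+1.-tuple point | fibred t && (mtype (z * cyc t)%g == lam)]|.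
Proof.
move=> r0.
have -> : #|[set y | (mtype y == single r c0) && (mtype (z * y^-1) == lam)]|
   = #|[set y | (mtype y == single r c0) && (mtype (z * y) == lam)]|.
  rewrite -(card_imset _ invg_inj); apply: eq_card => y; rewrite !inE.
  apply/imsetP/idP => [[v]|/andP[/eqP my mz]].
    rewrite inE => /andP[/eqP mv mz] ->; by rewrite mz (mtype_inv_single r0 mv) eqxx.
  exists y^-1; rewrite ?invgK // inE invgK mz andbT; apply/eqP.
  exact: (mtype_inv_single r0).
rewrite mulnC -sum_nat_const -[RHS]sum1_card.
rewrite (partition_big (fun t : r.+1.-tuple point => cyc t)
  (fun y => y \in [set y | (mtype y == single r c0) && (mtype (z * y) == lam)])) /=; last first.
  move=> t; rewrite !inE => /andP[ut ->]; rewrite andbT; apply/eqP.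
  by apply: mtype_cyc; rewrite ?size_tuple.
apply: eq_bigr => y; rewrite inE => /andP[/eqP my mz].
rewrite -(card_cyc_fibre r0 my) -sum1_card; apply: eq_bigl => t.
rewrite !inE; case: eqP => [->|]; rewrite ?andbF // mz !andbT //.
Qed.

End SingleType.

(** * Compositions *)

Lemma big_nat_fact_rem (M x : nat) (s : seq nat) : x < M -> x \in s ->
  \prod_(0 <= i < M) (count_mem i s)`!
  = count_mem x s * \prod_(0 <= i < M) (count_mem i (rem x s))`!.
Proof.
move=> xM xs; rewrite (bigD1_seq x) ?mem_index_iota ?iota_uniq //=.
rewrite [in RHS](bigD1_seq x) ?mem_index_iota ?iota_uniq //= mulnA.
congr (_ * _).
  rewrite count_rem xs /= eqxx /=; have : 0 < count_mem x s by rewrite -has_count has_pred1.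
  by case: (count_mem x s) => // k _; rewrite subn1 factS.
apply: eq_bigr => i ix; rewrite count_rem /= eq_sym (negPf ix) andbF subn0 //.
Qed.

Lemma sum_count_undup (T : eqType) (s : seq T) :
  \sum_(x <- undup s) count_mem x s = size s.
Proof.
under eq_bigr => x _ do rewrite -sum1_count big_mkcond.
rewrite exchange_big /= -sum1_size big_seq [RHS]big_seq; apply: eq_bigr => y ys.
rewrite -big_mkcond /= (eq_bigl (pred1 y)); last by move=> x; rewrite eq_sym.
by rewrite sum1_count count_uniq_mem ?undup_uniq // mem_undup ys.
Qed.

(** The multinomial formula without division. Fixing the first entry removes it from [s], which
    divides the product of factorials by its multiplicity, and the multiplicities add up to the
    size. *)
Lemma size_permutations_fact (M : nat) (s : seq nat) : all (gtn M) s ->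
  size (permutations s) * \prod_(0 <= i < M) (count_mem i s)`! = (size s)`!.
Proof.
elim: (size s) {-2}s (erefl (size s)) => [|k IH] {}s es sM.
  by case: s es sM => // _ _; rewrite big1_seq.
have s0 : s != [::] by case: (s) es.
rewrite (perm_size (permutationsE _)); last by rewrite es.
rewrite size_allpairs_dep sumnE big_map big_distrl /=.
rewrite [in RHS]es factS -es -sum_count_undup big_distrl /= [LHS]big_seq [RHS]big_seq.
apply: eq_bigr => x; rewrite mem_undup => xs.
rewrite (big_nat_fact_rem (allP sM _ xs) xs) mulnCA; congr (_ * _).
have e : size (rem x s) = k by rewrite size_rem // es.
by rewrite IH ?e //; apply/allP => y /mem_rem; apply: (allP sM).
Qed.

Lemma parts_gt0 (m : Defs.partn) k : k \in parts m -> 0 < k.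
Proof. by case/andP: (partsP m) => _ h; rewrite lt0n; apply: contraTneq => ->. Qed.

Lemma parts_le_psize (m : Defs.partn) k : k \in parts m -> k <= psize m.
Proof. by move=> km; rewrite /psize (perm_sumn (perm_to_rem km)) leq_addr. Qed.

Lemma mult_gt_psize (m : Defs.partn) k : psize m < k -> mult k m = 0.
Proof.
by move=> h; apply/count_memPn/negP => /parts_le_psize; rewrite leqNgt h.
Qed.

Lemma count_ptilde m r k : count_mem k.+2 (ptilde m r) = mult k.+1 m.
Proof.
rewrite count_cat count_map count_nseq /= mul0n addn0.
exact: eq_count.
Qed.

Lemma count1_ptilde m r : count_mem 1 (ptilde m r) = r - size m.
Proof.
rewrite count_cat count_map count_nseq /= mul1n (_ : count _ m = 0) //.
by apply/eqP; rewrite -leqn0 leqNgt -has_count; apply/hasPn => k /parts_gt0; case: k.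
Qed.

Lemma ptilde_gt0 m r : all (leq 1) (ptilde m r).
Proof. by rewrite all_cat all_map all_nseq orbT andbT; apply/allP. Qed.

Lemma size_ptilde (m : Defs.partn) r : size m <= r -> size (ptilde m r) = r.
Proof. by move=> h; rewrite size_cat size_map size_nseq subnKC. Qed.

Lemma sumn_ptilde (m : Defs.partn) r : size m <= r -> sumn (ptilde m r) = psize m + r.
Proof.
move=> h; rewrite sumn_cat sumn_nseq mul1n /psize.
have -> : sumn [seq i.+1 | i <- m] = sumn m + size m.
  by elim: (parts m) => //= a s ->; lia.
by rewrite -addnA subnKC.
Qed.

Lemma size_permutations_ptilde (m : Defs.partn) r : size m <= r ->
  size (permutations (ptilde m r)) * ((r - size m)`! * mfact m) = r`!.
Proof.
move=> h; have hM : all (gtn (psize m).+2) (ptilde m r).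
  rewrite all_cat all_map all_nseq /= orbT andbT; apply/allP => k /parts_le_psize.
  by rewrite /= !ltnS.
have := size_permutations_fact hM; rewrite size_ptilde // => <-.
congr (_ * _); rewrite big_ltn // big_ltn // count1_ptilde.
rewrite (_ : count_mem 0 _ = 0); last first.
  by apply/count_memPn/negP => /(allP (ptilde_gt0 m r)).
rewrite mul1n; congr (_ * _); rewrite /mfact big_add1 [RHS]big_add1 /=.
by rewrite big_add1 /=; apply: eq_bigr => i _; rewrite count_ptilde.
Qed.

(** Inverse of [ptilde] up to order. Parts 1 become zeros and vanish, just as trivial fixed points
    do in the modified type. *)
Definition pred_partn (b : seq nat) : Defs.partn := mkpartn (map predn b).

Lemma mult_pred_partn b k : 0 < k -> mult k (pred_partn b) = count_mem k.+1 b.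
Proof.
move=> k0; rewrite mult_mkpartn -lt0n k0 mul1n count_map; apply: eq_count => -[|a] //=.
by case: k k0.
Qed.

Lemma perm_pred_partn b r : all (leq 1) b -> size b = r ->
  size (pred_partn b) <= r /\ perm_eq b (ptilde (pred_partn b) r).
Proof.
move=> hb <-; have ls : size (pred_partn b) = count (leq 2) b.
  rewrite /= size_sort size_filter count_map; apply: eq_in_count => a /(allP hb).
  by case: a => [|[]].
split; first by rewrite ls count_size.
apply/allP => k _; apply/eqP; case: k => [|[|k]].
- rewrite !(count_memPn _) //; apply/negP => /allP; last by move/(_ _ hb).
  by move/(_ _ (ptilde_gt0 _ _)).
- rewrite count1_ptilde ls -(count_predC (leq 2) b) addKn.
  by apply: eq_in_count => a /(allP hb); case: a => [|[]].
- by rewrite count_ptilde mult_pred_partn.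
Qed.

Lemma pred_partn_perm b m r : perm_eq b (ptilde m r) -> pred_partn b = m.
Proof.
move=> pb; apply: partn_eq => -[|k]; first by rewrite !mult0.
by rewrite mult_pred_partn // (seq.permP pb) count_ptilde.
Qed.

Lemma scanl_ge x (b : seq nat) s : s \in scanl addn x b -> x <= s.
Proof.
elim: b x => //= a b IH x; rewrite inE => /predU1P[->|/IH]; first exact: leq_addr.
by apply: leq_trans; apply: leq_addr.
Qed.

(** A suffix and the prefix before it add up to the total; the initial value [x] is general for the
    sake of the induction. *)
Lemma ssums_scanl x (b : seq nat) s : 0 < s -> s < sumn b ->
  (s \in ssums b) = (x + sumn b - s \in scanl addn x b).
Proof.
move=> s0; elim: b x => //= a b IH x sb; rewrite !inE.
rewrite (_ : (s == _) = false) /=; last by apply/eqP; lia.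
case: (ltngtP s (sumn b)) => h.
- rewrite (IH (x + a) h) addnA (_ : (_ == x + a) = false) //; apply/eqP; lia.
- rewrite (_ : (_ == x + a) = false) /=; last by apply/eqP; lia.
  by apply/idP/idP => [/ssums_le|/scanl_ge]; lia.
- rewrite (_ : (_ == x + a) = true); last by apply/eqP; lia.
  by rewrite h; case: (b) s0 h => /= [|c b' _ _]; [lia|rewrite mem_head].
Qed.

Lemma scanl_rev (b : seq nat) : scanl addn 0 (rev b) = rev (ssums b).
Proof.
have H (l : seq nat) a x : scanl addn x (rcons l a)
    = rcons (scanl addn x l) (x + sumn l + a).
  by elim: l x => /= [|c l IH] x; rewrite ?addn0 ?IH ?addnA.
elim: b => //= a b IH; rewrite !rev_cons H IH add0n; congr (rcons _ _).
by rewrite (perm_sumn (permEl (perm_rev b))) addnC.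
Qed.

Lemma count_permutations_rev (P : pred (seq nat)) s :
  count (fun b => P (rev b)) (permutations s) = count P (permutations s).
Proof.
rewrite -(count_map rev); apply/seq.permP/uniq_perm.
- by rewrite (map_inj_uniq (can_inj revK)) permutations_uniq.
- exact: permutations_uniq.
move=> b; rewrite mem_permutations -[b in LHS]revK (mem_map (can_inj revK)).
by rewrite mem_permutations (permPl (permEl (perm_rev b))).
Qed.

Lemma pcountE (m : Defs.partn) r s : size m <= r -> 0 < s < psize m + r ->
  pcount m r s = count (fun b => s \notin ssums b) (permutations (ptilde m r)).
Proof.
move=> hm hs; rewrite /pcount hs -count_permutations_rev.
by apply: eq_count => b; rewrite scanl_rev mem_rev.
Qed.

(** Reversing a composition replaces each inner partial sum by its complement. This allows the two
    joined cycles to be exchanged. *)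
Lemma pcount_sym (m : Defs.partn) r s t : size m <= r -> 0 < s -> 0 < t ->
  s + t = psize m + r -> pcount m r s = pcount m r t.
Proof.
move=> hm s0 t0 st; rewrite pcountE //; last lia.
rewrite /pcount ifT; last lia.
apply: eq_in_count => b; rewrite mem_permutations => pb.
have sb : sumn b = psize m + r by rewrite (perm_sumn pb) sumn_ptilde.
rewrite (@ssums_scanl 0) //; last by rewrite sb; lia.
by rewrite sb -st add0n addKn.
Qed.

Lemma sum_indicator (T : eqType) (s : seq T) (w : T -> nat) (a : T) :
  \sum_(e <- s) w e * (a == e) = w a * count_mem a s.
Proof.
elim: s => [|e s IH]; first by rewrite big_nil muln0.
rewrite big_cons IH /= mulnDr [e == a]eq_sym; case: eqP => [->|] //.
by rewrite !muln0.
Qed.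

(** * Comparison of the types of two elements *)

Section TypeRelation.
Context {gT : finGroupType} {n : nat}.
Implicit Types (x z : wreath gT n) (c : cclass gT) (lam nu A B : ptfun gT).

(** [Rm] lists the cycles lost and [Ad] the cycles gained on passing from [z] to [x]. Taking for [F]
    the indicator of one length and class isolates one multiplicity. *)
Lemma type_relation x z (Rm Ad : seq (nat * cclass gT)) :
  (forall F : nat -> cclass gT -> nat,
    \sum_i F (len x i) (cls x i) + \sum_(e <- Rm) e.1 * F e.1 e.2
    = \sum_i F (len z i) (cls z i) + \sum_(e <- Ad) e.1 * F e.1 e.2) ->
  forall k c, 0 < k ->
    mult k (mtype x c) + count_mem (k + (c == c0), c) Rm
    = mult k (mtype z c) + count_mem (k + (c == c0), c) Ad.
Proof.
move=> h k c k0; set K := k + (c == c0).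
have K0 : 0 < K by rewrite addn_gt0 k0.
apply/eqP; rewrite -(eqn_pmul2l K0) !mulnDr !mult_mtype //; apply/eqP.
have e (s : seq (nat * cclass gT)) : K * count_mem (K, c) s
    = \sum_(e <- s) e.1 * ((e.1 == K) && (e.2 == c)).
  rewrite -(sum_indicator s (fun e => e.1) (K, c)); apply: eq_bigr => -[a d] _.
  by rewrite eq_sym xpair_eqE.
rewrite !e; exact: (h (fun a d => (a == K) && (d == c))).
Qed.

Lemma mult_funion lam A k c : mult k (funion lam A c) = mult k (lam c) + mult k (A c).
Proof. by rewrite ffunE mult_punion. Qed.

Lemma mult_fdiff lam A k c : mult k (fdiff lam A c) = mult k (lam c) - mult k (A c).
Proof. by rewrite ffunE mult_pdiff. Qed.

(** Unions on both sides express the removal of parts without truncated differences. *)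
Lemma type_iff x z lam A B :
  (forall k c, 0 < k -> mult k (mtype x c) + mult k (A c)
    = mult k (mtype z c) + mult k (B c)) ->
  (mtype x == lam) = (funion lam A == funion (mtype z) B).
Proof.
move=> h; apply/eqP/eqP => [<-|e]; apply: ptfun_eq => k c k0.
  by rewrite !mult_funion h.
have := congr1 (fun f : ptfun gT => mult k (f c)) e; rewrite /= !mult_funion.
by have := h k c k0; lia.
Qed.

Lemma norm_funion lam A : norm (funion lam A) = norm lam + norm A.
Proof.
rewrite /norm -big_split; apply: eq_bigr => c _; rewrite ffunE psize_mkpartn.
by rewrite /psize sumn_cat.
Qed.

Lemma norm_at_class c m : norm (at_class c m) = psize m.
Proof.
rewrite /norm (bigD1 c) //= ffunE eqxx big1 ?addn0 // => d /negPf hd.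
by rewrite ffunE hd.
Qed.

Lemma norm_single k c : norm (single k c) = k.
Proof. by rewrite norm_at_class psize_mkpartn /= addn0. Qed.

Lemma mult_at_class k c (m : Defs.partn) d :
  mult k (at_class c m d) = (d == c) * mult k m.
Proof.
rewrite ffunE; case: eqP => _; rewrite ?mul1n // mult_mkpartn muln0 //.
Qed.

Lemma mult_single_at k l c d : 0 < k ->
  mult k (single l c d) = (d == c) && (k == l).
Proof.
move=> k0; rewrite mult_at_class mult_mkpartn -lt0n k0 mul1n /= addn0.
by rewrite [l == k]eq_sym; case: (d == c); case: (k == l).
Qed.

End TypeRelation.

(** * Dependent lists of indices and counting of tuples *)

Section Lists.
Variables (A B : eqType).

Lemma dep_pairs_uniq (s : seq A) (t : A -> seq B) :
  uniq s -> (forall a, uniq (t a)) -> uniq [seq (a, b) | a <- s, b <- t a].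
Proof.
move=> us ut; apply: allpairs_uniq_dep => //.
by move=> [a b] [c d] _ _ [-> ->].
Qed.

Lemma mem_dep_pairs (s : seq A) (t : A -> seq B) a b :
  ((a, b) \in [seq (a, b) | a <- s, b <- t a]) = (a \in s) && (b \in t a).
Proof.
apply/allpairsPdep/andP => [[a' [b' [? ? [-> ->]]]] //|[? ?]].
by exists a, b.
Qed.

Lemma size_dep_pairs (s : seq A) (t : A -> seq B) :
  size [seq (a, b) | a <- s, b <- t a] = \sum_(a <- s) size (t a).
Proof. by rewrite size_allpairs_dep sumnE big_map. Qed.

End Lists.

Lemma card_tuples (A : finType) r (P : pred (seq A)) (I : eqType) (l : seq I)
    (f : I -> seq A) : uniq l -> {in l &, injective f} ->
  (forall s, size s = r -> P s -> exists2 i, i \in l & s = f i) ->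
  (forall i, i \in l -> size (f i) = r /\ P (f i)) ->
  #|[pred t : r.-tuple A | P t]| = size l.
Proof.
move=> ul fi sur img; rewrite -(size_map f) cardE -(size_map val).
apply/perm_size/uniq_perm.
- by rewrite (map_inj_uniq val_inj) enum_uniq.
- by rewrite map_inj_in_uniq.
move=> s; apply/mapP/mapP => [[t]|[i il ->]].
  rewrite mem_enum inE => Pt ->; apply: sur => //; exact: size_tuple.
have [sf Pf] := img i il; exists (Tuple (introT eqP sf)) => //.
by rewrite mem_enum inE.
Qed.

(** * Enumerating the sequences *)

Section Enumerations.
Local Open Scope group_scope.
Context {gT : finGroupType} {n : nat}.
Local Notation point := ('I_n * gT)%type.
Implicit Types (x z v w : wreath gT n) (p q u : point) (g h : gT) (i j : 'I_n).
Implicit Types (s : seq point) (b : seq nat) (c : cclass gT).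

Variables (z : wreath gT n) (lam : ptfun gT) (r : nat).
Hypothesis r0 : 0 < r.
Let nu := mtype z.

Definition goodseq s := uniq (map fst s) && (mtype (z * cyc s) == lam).

Definition pts_of L c := [seq p <- enum {: point} | (len z p.1 == L) && (cls z p.1 == c)].

Lemma mem_pts_of L c p : (p \in pts_of L c) = (len z p.1 == L) && (cls z p.1 == c).
Proof. by rewrite mem_filter mem_enum andbT. Qed.

(** New trivial cycles of lengths [b] add exactly the parts of [m] to the modified type at [c0]. *)
Lemma count_ptilde_class k c b (m : Defs.partn) R : 0 < k -> perm_eq b (ptilde m R) ->
  count_mem (k + (c == c0), c) [seq (a, c0) | a <- b] = mult k (at_class c0 m c).
Proof.
move=> k0 pb; rewrite mult_at_class count_map.
have [->|nc] := eqVneq c c0.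
  rewrite mul1n -(pred_partn_perm pb) mult_pred_partn // addn1.
  by apply: eq_count => a; rewrite /= xpair_eqE eqxx andbT.
rewrite mul0n; apply/eqP; rewrite -leqn0 leqNgt -has_count; apply/hasPn => a _ /=.
by rewrite xpair_eqE [c0 == c]eq_sym (negPf nc) andbF.
Qed.

(** [A] has at [c0] no part small enough to be a part of [m], so the parts of [m] on the right can
    only be matched by [lam]. *)
Lemma subpartns_funion (A B : ptfun gT) (m : Defs.partn) :
  (forall k, 0 < k <= psize m -> mult k (A c0) = 0%N) ->
  (forall k, mult k m <= mult k (B c0)) ->
  funion lam A = funion nu B -> m \in subpartns (lam c0).
Proof.
move=> hA hB e; rewrite mem_subpartns; apply/psubP => k.
have [km|km] := boolP (k \in parts m); last by rewrite /mult (count_memPn km).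
have := congr1 (fun f : ptfun gT => mult k (f c0)) e; rewrite /= !mult_funion.
have hk : 0 < k <= psize m by rewrite (parts_gt0 km) parts_le_psize.
by rewrite (hA _ hk) addn0 => ->; rewrite (leq_trans (hB k)) ?leq_addl.
Qed.

Definition match_all (m : Defs.partn) := (size m <= r.+1)
  && (funion lam (single (psize m + r) c0) == funion nu (at_class c0 m)).

(** A sequence is encoded by its first point [p] and the composition [b] of the lengths of the
    pieces; [m] is determined by [b] and serves to sort the compositions by their effect on the
    type. *)
Lemma count_split_all :
  #|[pred t : r.+1.-tuple point | goodseq t && split_all (z * cyc t) t]|
  = \sum_(m <- subpartns (lam c0) | match_all m)
      (size (pts_of (psize m + r).+1 c0) * size (permutations (ptilde m r.+1)))%N.
Proof.
pose pb (m : Defs.partn) := [seq (p, b) | p <- pts_of (psize m + r).+1 c0,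
                                   b <- permutations (ptilde m r.+1)].
pose l := [seq (m, e) | m <- [seq m <- subpartns (lam c0) | match_all m], e <- pb m].
pose f (e : Defs.partn * (point * seq nat)) := ptsb z e.2.1 e.2.2.
have key (m : Defs.partn) p b s x : size m <= r.+1 -> perm_eq b (ptilde m r.+1) ->
    len z p.1 = (psize m + r).+1 -> mono z p = 1 -> s = ptsb z p b -> x = z * cyc s ->
    [/\ split_all x s, [seq len x u.1 | u <- s] = b, head p s = p & forall y : ptfun gT,
      (mtype x == y) = (funion y (single (psize m + r) c0) == funion nu (at_class c0 m))].
  move=> hm hb lp mp es ex.
  have ab : all (leq 1) b by rewrite (perm_all _ hb) ptilde_gt0.
  have sb : sumn b = len z p.1 by rewrite (perm_sumn hb) sumn_ptilde // lp addnS.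
  have [[H1 H2 H3] [_ _ H4]] := split_allI ab sb mp es ex.
  split=> // y; apply: type_iff => k c k0.
  have R : forall F : nat -> cclass gT -> nat,
    (\sum_i F (len x i) (cls x i)
      + \sum_(e <- [:: (len z p.1, c0)]) e.1 * F e.1 e.2
    = \sum_i F (len z i) (cls z i) + \sum_(e <- [seq (a, c0) | a <- b]) e.1 * F e.1 e.2)%N.
    by move=> F; rewrite big_seq1 big_map; exact: H4.
  have := type_relation R c k0; rewrite (count_ptilde_class _ k0 hb) => <-.
  congr (_ + _)%N; rewrite mult_single_at //= lp xpair_eqE addn0 [c0 == c]eq_sym.
  by case: (c == c0); rewrite ?andbF // addn1 eqSS eq_sym andbT.
have pl e : e \in l -> [/\ size e.1 <= r.+1, perm_eq e.2.2 (ptilde e.1 r.+1),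
    len z e.2.1.1 = (psize e.1 + r).+1, mono z e.2.1 = 1
    & funion lam (single (psize e.1 + r) c0) == funion nu (at_class c0 e.1)].
  case: e => m [p b]; rewrite mem_dep_pairs mem_filter => /andP[/andP[/andP[h1 h2] _]].
  rewrite mem_dep_pairs mem_pts_of mem_permutations cls_c0 => /andP[/andP[/eqP h3 /eqP h4] h5].
  by split.
have -> : \sum_(m <- subpartns (lam c0) | match_all m)
    (size (pts_of (psize m + r).+1 c0) * size (permutations (ptilde m r.+1)))%N = size l.
  rewrite size_dep_pairs big_filter; apply: eq_bigr => m _.
  by rewrite size_dep_pairs big_const_seq count_predT iter_addn_0 mulnC.
have := @card_tuples _ r.+1 (fun s => goodseq s && split_all (z * cyc s) s) _ l f.
apply.
- apply: dep_pairs_uniq; first by rewrite filter_uniq // undup_uniq.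
  move=> m; apply: dep_pairs_uniq => [|_]; last exact: permutations_uniq.
  by rewrite filter_uniq // enum_uniq.
(* The composition is recovered as the lengths of the cycles of [z * cyc s] along [s], and [p] as
   the head. *)
- move=> e1 e2 /pl[h1 h2 h3 h4 _] /pl[h1' h2' h3' h4' _] ef.
  have [_ b1 p1 _] := key _ _ _ _ _ h1 h2 h3 h4 erefl erefl.
  have [_ b2 p2 _] := key _ _ _ _ _ h1' h2' h3' h4' erefl erefl.
  move: b1; rewrite -/(f e1) ef b2 => eb.
  have em : e1.1 = e2.1 by rewrite -(pred_partn_perm h2) -(pred_partn_perm h2') eb.
  have ep : e1.2.1 = e2.2.1.
    have : size (f e2) = r.+1.
      by rewrite -(size_map (fun u => len (z * cyc (f e2)) u.1)) b2 (perm_size h2') size_ptilde.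
    have q1 : head e1.2.1 (f e1) = e1.2.1 by [].
    have q2 : head e2.2.1 (f e2) = e2.2.1 by [].
    by move=> sz; rewrite -q1 -[RHS]q2 ef; case: (f e2) sz.
  by case: (e1) (e2) em ep eb => [m [p b]] [m' [p' b']] /= -> -> ->.
- move=> [|p s'] // ss /andP[/andP[us ms] A1].
  set s := p :: s' in ss us ms A1 *.
  have [b eb] : exists b, b = [seq len (z * cyc s) u.1 | u <- s] by eexists.
  have [H1 H2 H3] := @split_all_elim _ _ z p s _ b erefl erefl isT A1 eb.
  have hb : all (leq 1) b by rewrite eb len_all_gt0.
  have sb : size b = r.+1 by rewrite eb size_map.
  have [hm hp] := perm_pred_partn hb sb; set m := pred_partn b in hm hp.
  have lp : len z p.1 = (psize m + r).+1.
    by rewrite -H2 (perm_sumn hp) sumn_ptilde // addnS.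
  have [_ _ _ t] := key _ _ _ _ _ hm hp lp H3 H1 erefl.
  move: ms; rewrite t => /eqP fe.
  exists (m, (p, b)); last by rewrite /f /= -H1.
  rewrite mem_dep_pairs mem_filter /match_all hm fe eqxx /= mem_dep_pairs mem_pts_of.
  rewrite mem_permutations hp lp eqxx cls_c0 H3 eqxx !andbT.
  apply: subpartns_funion fe => [k hk|k]; last by rewrite mult_at_class eqxx mul1n.
  rewrite mult_single_at ?eqxx /=; last lia.
  by case: eqP => //; lia.
- move=> e /pl[h1 h2 h3 h4 h5]; have [b1 p1 e1 t] := key _ _ _ _ _ h1 h2 h3 h4 erefl erefl.
  split.
    by rewrite -(size_map (fun u => len (z * cyc (f e)) u.1)) p1 (perm_size h2) size_ptilde.
  rewrite b1 andbT /goodseq t h5 andbT.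
  by case/andP: b1 => _; rewrite (map_comp (porbit _) fst) => /map_uniq.
Qed.

Definition match_head c (m : Defs.partn) k :=
  funion lam (single (psize m + r + k) c)
  == funion nu (funion (at_class c0 m) (single k c)).

(** Beyond the data of [count_split_all], [k] is the length of the piece that keeps the class [c] of
    the cycle being cut. *)
Lemma count_split_head :
  #|[pred t : r.+1.-tuple point | goodseq t && split_head (z * cyc t) t]|
  = \sum_(c : cclass gT | c != c0)
    \sum_(m <- subpartns (lam c0) | size m <= r)
    \sum_(k <- undup (lam c) | match_head c m k)
      (size (pts_of (psize m + r + k) c) * size (permutations (ptilde m r)))%N.
Proof.
pose pb c (m : Defs.partn) k := [seq (p, b) | p <- pts_of (psize m + r + k) c,
                                   b <- permutations (ptilde m r)].
pose kpb c (m : Defs.partn) :=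
  [seq (k, e) | k <- [seq k <- undup (lam c) | match_head c m k], e <- pb c m k].
pose mkpb c :=
  [seq (m, e) | m <- [seq m : Defs.partn <- subpartns (lam c0) | size m <= r], e <- kpb c m].
pose l := [seq (c, e) | c <- [seq c <- enum {: cclass gT} | c != c0], e <- mkpb c].
pose f (e : cclass gT * (Defs.partn * (nat * (point * seq nat)))) :=
  e.2.2.2.1 :: ptsb z e.2.2.2.1 e.2.2.2.2.
have key c (m : Defs.partn) k p b s x : c != c0 -> size m <= r -> 0 < k ->
    perm_eq b (ptilde m r) -> len z p.1 = (psize m + r + k)%N -> cls z p.1 = c ->
    s = p :: ptsb z p b -> x = z * cyc s ->
    [/\ split_head x s, [seq len x u.1 | u <- s] = k :: b & forall y : ptfun gT,
      (mtype x == y) = (funion y (single (psize m + r + k) c)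
                        == funion nu (funion (at_class c0 m) (single k c)))].
  move=> cc hm k0 hb lp cp es ex.
  have ab : all (leq 1) b by rewrite (perm_all _ hb) ptilde_gt0.
  have sb : sumn b = (psize m + r)%N by rewrite (perm_sumn hb) sumn_ptilde.
  have lb : sumn b < len z p.1 by rewrite lp sb -addn1 leq_add2l.
  have mp : mono z p != 1 by rewrite -cls_c0 cp.
  have [H1 H2 H3] := split_headI ab lb mp es ex.
  have ek : (len z p.1 - sumn b)%N = k by rewrite lp sb addKn.
  rewrite ek in H2 H3; split=> // y; apply: type_iff => a d a0.
  have R : forall F : nat -> cclass gT -> nat,
    (\sum_i F (len x i) (cls x i)
      + \sum_(e <- [:: (len z p.1, c)]) e.1 * F e.1 e.2
    = \sum_i F (len z i) (cls z i)
      + \sum_(e <- [seq (a, c0) | a <- b] ++ [:: (k, c)]) e.1 * F e.1 e.2)%N.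
    move=> F; rewrite big_cat !big_seq1 big_map /= addnA.
    by have := H3 F; rewrite cp.
  have := type_relation R d a0; rewrite count_cat (count_ptilde_class _ a0 hb).
  have one L : count_mem (a + (d == c0), d) [:: (L, c)] = ((d == c) && (a == L)).
    rewrite /= addn0 xpair_eqE [c == d]eq_sym; have [->|] := eqVneq d c.
      by rewrite (negPf cc) addn0 andbT eq_sym.
    by rewrite andbF.
  by rewrite !one mult_funion !mult_single_at // lp.
have pl e : e \in l -> [/\ e.1 != c0, size e.2.1 <= r, 0 < e.2.2.1,
    perm_eq e.2.2.2.2 (ptilde e.2.1 r)
    & [/\ len z e.2.2.2.1.1 = (psize e.2.1 + r + e.2.2.1)%N, cls z e.2.2.2.1.1 = e.1
    & match_head e.1 e.2.1 e.2.2.1]].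
  case: e => c [m [k [p b]]]; rewrite mem_dep_pairs mem_filter => /andP[/andP[h1 _]].
  rewrite mem_dep_pairs mem_filter => /andP[/andP[h2 _]].
  rewrite mem_dep_pairs mem_filter => /andP[/andP[h3]]; rewrite mem_undup => /parts_gt0 h4.
  rewrite mem_dep_pairs mem_pts_of mem_permutations => /andP[/andP[/eqP h5 /eqP h6] h7].
  by split.
have -> : \sum_(c : cclass gT | c != c0)
    \sum_(m <- subpartns (lam c0) | size m <= r)
    \sum_(k <- undup (lam c) | match_head c m k)
      (size (pts_of (psize m + r + k) c) * size (permutations (ptilde m r)))%N = size l.
  rewrite size_dep_pairs big_filter big_enum_cond /=; apply: eq_bigr => c _.
  rewrite size_dep_pairs big_filter; apply: eq_bigr => m _.
  rewrite size_dep_pairs big_filter; apply: eq_bigr => k _.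
  by rewrite size_dep_pairs big_const_seq count_predT iter_addn_0 mulnC.
have := @card_tuples _ r.+1 (fun s => goodseq s && split_head (z * cyc s) s) _ l f.
apply.
- apply: dep_pairs_uniq => [|c]; first by rewrite filter_uniq // enum_uniq.
  apply: dep_pairs_uniq => [|m]; first by rewrite filter_uniq // undup_uniq.
  apply: dep_pairs_uniq => [|k]; first by rewrite filter_uniq // undup_uniq.
  apply: dep_pairs_uniq => [|_]; last exact: permutations_uniq.
  by rewrite filter_uniq // enum_uniq.
- move=> e1 e2 /pl[h1 h2 h3 h4 [h5 h6 _]] /pl[h1' h2' h3' h4' [h5' h6' _]] ef.
  have [_ b1 _] := key _ _ _ _ _ _ _ h1 h2 h3 h4 h5 h6 erefl erefl.
  have [_ b2 _] := key _ _ _ _ _ _ _ h1' h2' h3' h4' h5' h6' erefl erefl.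
  move: b1; rewrite -/(f e1) ef b2 => -[ek eb].
  have em : e1.2.1 = e2.2.1 by rewrite -(pred_partn_perm h4) -(pred_partn_perm h4') eb.
  have ep : e1.2.2.2.1 = e2.2.2.2.1 by case: ef.
  have ec : e1.1 = e2.1 by rewrite -h6 -h6' ep.
  by case: (e1) (e2) em ep eb ek ec => [c [m [k [p b]]]] [c' [m' [k' [p' b']]]] /= -> -> -> -> ->.
- move=> [|p s'] // ss /andP[/andP[us ms] A2].
  set s := p :: s' in ss us ms A2 *.
  have [b eb] : exists b, b = [seq len (z * cyc s) u.1 | u <- s'] by eexists.
  have [H1 H2 H3] := @split_head_elim _ _ z p s s' _ b erefl erefl us A2 eb.
  have hb : all (leq 1) b by rewrite eb len_all_gt0.
  have sb : size b = r by rewrite eb size_map; case: ss.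
  have [hm hp] := perm_pred_partn hb sb; set m := pred_partn b in hm hp.
  have sub : sumn b = (psize m + r)%N by rewrite (perm_sumn hp) sumn_ptilde.
  pose k := (len z p.1 - sumn b)%N; have k0 : 0 < k by rewrite subn_gt0.
  have lp : len z p.1 = (psize m + r + k)%N by rewrite -sub subnKC // ltnW.
  have cc : cls z p.1 != c0 by rewrite cls_c0.
  have es : s = p :: ptsb z p b by rewrite -H1.
  have [_ _ t] := key _ _ _ _ _ _ _ cc hm k0 hp lp erefl es erefl.
  move: ms; rewrite t => /eqP fe.
  exists (cls z p.1, (m, (k, (p, b)))); last by rewrite /f /= -H1.
  rewrite mem_dep_pairs mem_filter cc mem_enum /= mem_dep_pairs mem_filter hm /=.
  rewrite mem_dep_pairs mem_filter /match_head fe eqxx mem_undup mem_dep_pairs mem_pts_of.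
  rewrite mem_permutations hp lp !eqxx !andbT /=; apply/andP; split.
    apply: subpartns_funion fe => [a ha|a].
      by rewrite mult_single_at ?[c0 == _]eq_sym ?(negPf cc) //; lia.
    by rewrite mult_funion mult_at_class eqxx mul1n leq_addr.
  (* As [r] is positive, [k] is not the length of the whole cycle, so the part [k] must come from
     [lam]. *)
  have := congr1 (fun f : ptfun gT => mult k (f (cls z p.1))) fe.
  rewrite /= !mult_funion !mult_single_at // !eqxx /= mult_at_class (negPf cc) mul0n.
  rewrite (_ : (k == _) = false); last by apply/eqP; lia.
  by rewrite -has_pred1 has_count /mult; lia.
- move=> e /pl[h1 h2 h3 h4 [h5 h6 h7]].
  have [b1 p1 t] := key _ _ _ _ _ _ _ h1 h2 h3 h4 h5 h6 erefl erefl.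
  split.
    rewrite -(size_map (fun u => len (z * cyc (f e)) u.1)) p1 /= (perm_size h4).
    by rewrite size_ptilde.
  rewrite b1 andbT /goodseq t; apply/andP; split; last exact: h7.
  by case/and3P: b1 => _ _; rewrite (map_comp (porbit _) fst) => /map_uniq.
Qed.

Definition match_pair (m : Defs.partn) q p :=
  [&& q.1 \notin porbit (wperm z) p.1, mono z p * mono z q == 1,
      len z p.1 + len z q.1 == psize m + r
    & funion lam (funion (single (len z q.1) (cls z q.1))
                         (single (len z p.1) (cls z p.1)))
      == funion nu (at_class c0 m)].

(** The first two points [q] and [p] fix the joining transposition, and [b] describes the cuts of
    the joined cycle from [p]. Requiring the cycle of [q] to be non-trivial is enough, since that of
    [p] has the inverse monodromy. *)
Lemma count_split_pair :
  #|[pred t : r.+1.-tuple point | goodseq t && (split_pair (z * cyc t) t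
      && all (fun u => mono z u != 1) t)]|
  = \sum_(m <- subpartns (lam c0) | size m <= r)
    \sum_(q : point | cls z q.1 != c0) \sum_(p : point | match_pair m q p)
      count (fun b => len z q.1 \notin ssums b) (permutations (ptilde m r)).
Proof.
pose bs (m : Defs.partn) q :=
  [seq b <- permutations (ptilde m r) | len z q.1 \notin ssums b].
pose pb (m : Defs.partn) q :=
  [seq (p, b) | p <- [seq p <- enum {: point} | match_pair m q p], b <- bs m q].
pose qpb (m : Defs.partn) :=
  [seq (q, e) | q <- [seq q <- enum {: point} | cls z q.1 != c0], e <- pb m q].
pose l :=
  [seq (m, e) | m <- [seq m : Defs.partn <- subpartns (lam c0) | size m <= r], e <- qpb m].
pose f (e : Defs.partn * (point * (point * seq nat))) :=
  e.2.1 :: ptsb (z * ptperm e.2.1 e.2.2.1) e.2.2.1 e.2.2.2.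
have key (m : Defs.partn) q p b s x : size m <= r -> perm_eq b (ptilde m r) ->
    cls z q.1 != c0 -> q.1 \notin porbit (wperm z) p.1 -> mono z p * mono z q = 1 ->
    (len z p.1 + len z q.1 = psize m + r)%N -> len z q.1 \notin ssums b ->
    s = q :: ptsb (z * ptperm q p) p b -> x = z * cyc s ->
    [/\ split_pair x s, uniq (map fst s), [seq len x u.1 | u <- behead s] = b,
        head p (behead s) = p & forall y : ptfun gT,
      (mtype x == y) = (funion y (funion (single (len z q.1) (cls z q.1))
                         (single (len z p.1) (cls z p.1)))
                        == funion nu (at_class c0 m))].
  move=> hm hb cq npq mpq lpq hs es ex.
  have ab : all (leq 1) b by rewrite (perm_all _ hb) ptilde_gt0.
  have sb : sumn b = (len z p.1 + len z q.1)%N by rewrite (perm_sumn hb) sumn_ptilde.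
  have cp : cls z p.1 != c0.
    by move: cq; rewrite !cls_c0; apply: contraNneq => e; rewrite -mpq e mul1g.
  have [H1 H2 H3 H4 H5] := split_pairI ab npq mpq sb hs es ex.
  split=> // y; apply: type_iff => a d a0.
  have R : forall F : nat -> cclass gT -> nat,
    (\sum_i F (len x i) (cls x i)
      + \sum_(e <- [:: (len z q.1, cls z q.1); (len z p.1, cls z p.1)]) e.1 * F e.1 e.2
    = \sum_i F (len z i) (cls z i)
      + \sum_(e <- [seq (a, c0) | a <- b]) e.1 * F e.1 e.2)%N.
    move=> F; rewrite big_cons big_seq1 big_map /= [(len z q.1 * _ + _)%N]addnC.
    exact: H5.
  have := type_relation R d a0; rewrite (count_ptilde_class _ a0 hb) => <-.
  have one L c : c != c0 -> ((L, c) == ((a + (d == c0))%N, d)) = ((d == c) && (a == L)).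
    move=> cc; rewrite xpair_eqE [c == d]eq_sym; have [->|] := eqVneq d c.
      by rewrite (negPf cc) addn0 andbT eq_sym.
    by rewrite andbF.
  by rewrite /= !one // addn0 mult_funion !mult_single_at.
(* All points lie over the joined cycle, that is, over one of the two non-trivial cycles of [z]. *)
have nt m q p b : cls z q.1 != c0 -> match_pair m q p ->
    all (fun u => mono z u != 1) (f (m, (q, (p, b)))).
  move=> cq /and4P[npq /eqP mpq _ _].
  have cp : cls z p.1 != c0.
    by move: cq; rewrite !cls_c0; apply: contraNneq => e; rewrite -mpq e mul1g.
  rewrite /= -cls_c0 cq /=; apply/allP => u hu; rewrite -cls_c0.
  have : u.1 \in porbit (wperm (z * ptperm p q)) p.1.
    rewrite (ptpermC (notin_porbit_neq npq)); apply: (@mem_ptsb_porbit _ _ _ p b).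
    by rewrite mem_rcons inE hu orbT.
  by rewrite join_porbit // inE => /orP[] /cls_mem ->.
have pl e : e \in l -> [/\ size e.1 <= r, perm_eq e.2.2.2 (ptilde e.1 r),
    cls z e.2.1.1 != c0, match_pair e.1 e.2.1 e.2.2.1 & len z e.2.1.1 \notin ssums e.2.2.2].
  case: e => m [q [p b]]; rewrite mem_dep_pairs mem_filter => /andP[/andP[h1 _]].
  rewrite mem_dep_pairs mem_filter => /andP[/andP[h2 _]].
  rewrite mem_dep_pairs !mem_filter => /andP[/andP[h3 _]].
  by rewrite mem_permutations => /andP[h4 h5]; split.
have -> : \sum_(m <- subpartns (lam c0) | size m <= r)
    \sum_(q : point | cls z q.1 != c0) \sum_(p : point | match_pair m q p)
      count (fun b => len z q.1 \notin ssums b) (permutations (ptilde m r)) = size l.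
  rewrite size_dep_pairs big_filter; apply: eq_bigr => m _.
  rewrite size_dep_pairs big_filter big_enum_cond /=; apply: eq_bigr => q _.
  rewrite size_dep_pairs big_filter big_enum_cond /=; apply: eq_bigr => p _.
  by rewrite size_filter.
have := @card_tuples _ r.+1 (fun s => goodseq s && (split_pair (z * cyc s) s
      && all (fun u => mono z u != 1) s)) _ l f.
apply.
- apply: dep_pairs_uniq => [|m]; first by rewrite filter_uniq // undup_uniq.
  apply: dep_pairs_uniq => [|q]; first by rewrite filter_uniq // enum_uniq.
  apply: dep_pairs_uniq => [|_]; last by rewrite filter_uniq // permutations_uniq.
  by rewrite filter_uniq // enum_uniq.
- move=> e1 e2 /pl[h1 h2 h3 h4 h5] /pl[h1' h2' h3' h4' h5'] ef.
  have /and4P[i1 /eqP i2 /eqP i3 i4] := h4.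
  have /and4P[j1 /eqP j2 /eqP j3 j4] := h4'.
  have [_ _ b1 p1 _] := key _ _ _ _ _ _ h1 h2 h3 i1 i2 i3 h5 erefl erefl.
  have [_ _ b2 p2 _] := key _ _ _ _ _ _ h1' h2' h3' j1 j2 j3 h5' erefl erefl.
  have eb : e1.2.2.2 = e2.2.2.2 by rewrite -b1 -b2 -/(f e1) -/(f e2) ef.
  have em : e1.1 = e2.1 by rewrite -(pred_partn_perm h2) -(pred_partn_perm h2') eb.
  have eq : e1.2.1 = e2.2.1 by case: ef.
  have ep : e1.2.2.1 = e2.2.2.1.
    have : size (behead (f e2)) = r.
      rewrite -(size_map (fun u => len (z * cyc (f e2)) u.1)) b2 (perm_size h2').
      by rewrite size_ptilde.
    have q1 : head e1.2.2.1 (behead (f e1)) = e1.2.2.1 by [].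
    have q2 : head e2.2.2.1 (behead (f e2)) = e2.2.2.1 by [].
    by move=> sz; rewrite -q1 -[RHS]q2 ef; have r1 := r0; move: sz r1; case: (behead (f e2)) => //= <-.
  by case: (e1) (e2) em ep eb eq => [m [q [p b]]] [m' [q' [p' b']]] /= -> -> -> ->.
(* Positivity of [r] supplies the second point. *)
- move=> [|q [|p s']] // ss; first by case: ss => e; have := r0; rewrite -e.
  move=> /andP[/andP[us ms] /andP[A3 az]].
  set s := q :: p :: s' in ss us ms A3 az *.
  have [b eb] : exists b, b = [seq len (z * cyc s) u.1 | u <- p :: s'] by eexists.
  have [H1 H2 H3 H4 H5] := @split_pair_elim _ _ z p q s s' _ b erefl erefl us A3 eb.
  have hb : all (leq 1) b by rewrite eb len_all_gt0.
  have sb : size b = r by rewrite eb size_map; case: ss.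
  have [hm hp] := perm_pred_partn hb sb; set m := pred_partn b in hm hp.
  have lpq : (len z p.1 + len z q.1 = psize m + r)%N.
    by rewrite -H3 (perm_sumn hp) sumn_ptilde.
  have cq : cls z q.1 != c0 by case/andP: az; rewrite cls_c0.
  have cp : cls z p.1 != c0 by case/and3P: az; rewrite cls_c0.
  have es : s = q :: ptsb (z * ptperm q p) p b by rewrite -H2.
  have [_ _ _ _ t] := key _ _ _ _ _ _ hm hp cq H1 H5 lpq H4 es erefl.
  move: ms; rewrite t => /eqP fe.
  exists (m, (q, (p, b))); last by rewrite /f /= -H2.
  rewrite mem_dep_pairs mem_filter hm mem_dep_pairs mem_filter cq mem_enum mem_dep_pairs.
  rewrite !mem_filter mem_permutations hp H4 /= andbT; apply/andP; split.
    apply: subpartns_funion fe => [a ha|a]; last by rewrite mult_at_class eqxx mul1n.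
    by rewrite mult_funion !mult_single_at ?[c0 == _]eq_sym ?(negPf cq) ?(negPf cp) //; lia.
  by rewrite /match_pair H1 H5 lpq fe !eqxx -enumT mem_enum.
- move=> e /pl[h1 h2 h3 h4 h5].
  have /and4P[i1 /eqP i2 /eqP i3 i4] := h4.
  have [b1 u1 p1 _ t] := key _ _ _ _ _ _ h1 h2 h3 i1 i2 i3 h5 erefl erefl.
  split.
    have : size (behead (f e)) = r.
      rewrite -(size_map (fun u => len (z * cyc (f e)) u.1)) p1 (perm_size h2).
      by rewrite size_ptilde.
    by move=> <-.
  rewrite b1 /goodseq u1 t i4 /=.
  by have := nt e.1 e.2.1 e.2.2.1 e.2.2.2 h3 h4.
Qed.

End Enumerations.

(** * Counting points *)

Section Totals.
Local Open Scope group_scope.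
Context {gT : finGroupType} {n : nat}.
Local Notation point := ('I_n * gT)%type.
Implicit Types (x z v w : wreath gT n) (p q u : point) (g h : gT) (i j : 'I_n).
Implicit Types (s : seq point) (b : seq nat) (c : cclass gT).

Lemma sum_points (F : 'I_n -> nat) : \sum_(p : point) F p.1 = (#|gT| * \sum_i F i)%N.
Proof.
transitivity (\sum_(i : 'I_n) \sum_(g : gT) F i).
  by rewrite pair_bigA.
by rewrite big_distrr; apply: eq_bigr => i _; rewrite sum_nat_const.
Qed.

Lemma sum_cls_len z L c : 0 < L ->
  \sum_i ((len z i == L) && (cls z i == c))
  = (L * mult L (wtype z c))%N.
Proof. by move=> L0; rewrite mult_wtype. Qed.

Lemma size_pts_of z L c : 0 < L ->
  size (pts_of z L c) = (#|gT| * (L * mult L (wtype z c)))%N.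
Proof.
move=> L0; rewrite -sum_cls_len // -(sum_points (fun i => (len z i == L) && (cls z i == c))).
by rewrite size_filter -sum1_count big_mkcond big_enum /=; apply: eq_bigr => p _; case: ifP.
Qed.

Lemma wtype_nontriv z L c : c != c0 -> 0 < L ->
  mult L (wtype z c) = mult L (mtype z c).
Proof. by move=> /negPf cc L0; rewrite mult_mtype_wtype // cc addn0. Qed.

Lemma zeta_cls_of g : zeta (cls_of g) = #|'C[g]|.
Proof.
rewrite /zeta /=; have : repr (g ^: [set: gT]) \in g ^: [set: gT].
  exact: (mem_repr g (class_refl _ _)).
by case/imsetP => h _ ->; rewrite cent1J cardJg.
Qed.

Lemma cls_of_inv g : cls_of g^-1 = cbar (cls_of g).
Proof. by apply/val_inj; rewrite /= classVg. Qed.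

Lemma cls_of_repr c : cls_of (repr (val c)) = c.
Proof.
apply/eqP; rewrite cls_ofE; case: c => c /= /imsetP[g _ ->].
exact: (mem_repr g (class_refl _ _)).
Qed.

Lemma zeta_cbar c : zeta (cbar c) = zeta c.
Proof.
rewrite -[c in LHS]cls_of_repr -cls_of_inv zeta_cls_of /zeta; apply: eq_card => g.
by rewrite cent1C groupV cent1C.
Qed.

(** The solutions, if there are any, form a coset of a centralizer. *)
Lemma card_conj_eq a g : #|[set h | a ^ h == g]| =
  if cls_of a == cls_of g then zeta (cls_of g) else 0%N.
Proof.
case: eqP => [/(congr1 val) /= e|ne]; last first.
  apply: eq_card0 => h; rewrite inE; apply/eqP => e; apply: ne.
  by rewrite -e cls_ofJ.
have /imsetP[h _ eh] : g \in a ^: [set: gT] by rewrite e class_refl.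
rewrite zeta_cls_of eh cent1J cardJg -(card_rcoset 'C[a] h); apply: eq_card => k.
rewrite inE mem_rcoset cent1E; apply/eqP/eqP => [ek|ek].
  by rewrite [RHS]conjgC conjgM ek -conjgM mulgV conjg1.
have ea : a ^ (k * h^-1) = a by rewrite conjgE -ek mulKg.
by rewrite -{1}(mulgKV h k) conjgM ea.
Qed.

End Totals.

(** * Pairs of cycles with inverse monodromies *)

Section PairTotals.
Local Open Scope group_scope.
Context {gT : finGroupType} {n : nat}.
Local Notation point := ('I_n * gT)%type.
Implicit Types (p q u : point) (g h : gT) (i j : 'I_n) (c : cclass gT) (m : Defs.partn).
Variables (z : wreath gT n) (lam : ptfun gT) (r : nat).
Let nu := mtype z.

Definition match_types m c s1 s2 : bool :=
  funion lam (funion (single s1 c) (single s2 (cbar c)))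
  == funion nu (at_class c0 m).

(** Each fibre over a suitable cycle has [zeta] points with the required monodromy. The subtracted
    term removes the cycle of [q] itself, which has the right class when this class is its own
    inverse. *)
Lemma card_inverse_points q s2 : cls z q.1 != c0 -> 0 < s2 ->
  #|[pred p : point | [&& q.1 \notin porbit (wperm z) p.1, mono z p * mono z q == 1
      & len z p.1 == s2]]|
  = (zeta (cls z q.1) * (s2 * (mult s2 (nu (cbar (cls z q.1)))
      - ((len z q.1 == s2) && (cls z q.1 == cbar (cls z q.1))))))%N.
Proof.
set c := cls z q.1 => cq s20.
have cb : cbar c != c0.
  apply: contraNneq cq => /(congr1 cbar); rewrite cbarK => ->; apply/eqP/val_inj.
  by rewrite /= invg1.
pose A i : nat := (len z i == s2) && (cls z i == cbar c).
have H i : #|[set g : gT | [&& q.1 \notin porbit (wperm z) i,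
    mono z (i, g) * mono z q == 1 & len z i == s2]]|
    = (zeta c * ((i \notin porbit (wperm z) q.1) * A i))%N.
  rewrite porbit_sym /A; case: (i \notin _) => /=; last first.
    by rewrite mul0n muln0; apply: eq_card0 => g; rewrite inE.
  case: (len z i == s2) => /=; last first.
    by rewrite muln0 muln0; apply: eq_card0 => g; rewrite inE /= andbF.
  rewrite mul1n -zeta_cbar /c clsE -cls_of_inv.
  rewrite (_ : [set g | _] = [set g | mono z (i, 1) ^ g == (mono z q)^-1]).
    by rewrite card_conj_eq /cls; case: eqP => _; rewrite ?muln1 ?muln0.
  apply/setP => g; rewrite !inE andbT -mono_rt /rt /= mul1g.
  by apply/eqP/eqP => [e|->]; rewrite ?mulVg //; apply: (mulIg (mono z q)); rewrite e mulVg.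
rewrite -sum1_card (eq_bigl (fun p : point => xpredT p.1 && [&& q.1 \notin porbit (wperm z) p.1,
   mono z (p.1, p.2) * mono z q == 1 & len z p.1 == s2])) => [|[i g]] //.
rewrite -(pair_big_dep xpredT (fun i g => [&& q.1 \notin porbit (wperm z) i,
   mono z (i, g) * mono z q == 1 & len z i == s2]) (fun _ _ => 1%N)) /=.
rewrite (eq_bigr (fun i => (zeta c * ((i \notin porbit (wperm z) q.1) * A i))%N)); last first.
  by move=> i _; rewrite -H -sum1_card; apply: eq_bigl => g; rewrite inE.
rewrite -big_distrr /=; congr (_ * _)%N.
have SA : \sum_i A i = (s2 * mult s2 (nu (cbar c)))%N.
  by rewrite sum_cls_len // wtype_nontriv.
have SB : \sum_(i in porbit (wperm z) q.1) A i
   = (s2 * ((len z q.1 == s2) && (c == cbar c)))%N.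
  rewrite (sum_porbit z q.1 (fun a d => (a == s2) && (d == cbar c))) -/c.
  by case: (len z q.1 =P s2) => [->//|_]; rewrite /= !muln0.
rewrite mulnBr -SA -SB [X in (X - _)%N](bigID (mem (porbit (wperm z) q.1))) /= addKn.
rewrite [RHS]big_mkcond /=; apply: eq_bigr => i _.
by case: (i \in _); rewrite ?mul1n.
Qed.

(** The contribution, up to the factor [#|gT|], of the ordered pairs with [q] on a cycle of length
    [s1] and class [c] and [p] on one of length [s2] and class [cbar c]. *)
Definition pair_term m c s1 s2 : nat := (match_types m c s1 s2 *
  (s1 * s2 * zeta c * pcount m r s1
    * (mult s1 (nu c) * (mult s2 (nu (cbar c)) - ((s1 == s2) && (c == cbar c))))))%N.

Lemma sum_len_cls (B : nat) (H : nat -> cclass gT -> nat) :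
  (forall s c, B <= s -> H s c = 0%N) ->
  \sum_i H (len z i) (cls z i)
  = \sum_c \sum_(s < B) (s * mult s (wtype z c) * H s c)%N.
Proof.
move=> hB; transitivity (\sum_i \sum_c \sum_(s < B)
    (((len z i == s) && (cls z i == c)) * H s c)%N).
  apply: eq_bigr => i _; rewrite (bigD1 (cls z i)) //= [X in (_ + X)%N]big1 ?addn0.
    case: (ltnP (len z i) B) => h; last first.
      rewrite hB // big1 // => s _; rewrite (_ : (_ == _) = false) //.
      by apply/eqP => e; move: h; rewrite e leqNgt ltn_ord.
    rewrite (bigD1 (Ordinal h)) //= !eqxx mul1n big1 ?addn0 // => s hs.
    by rewrite (_ : (_ == _) = false) //; apply: contraNF hs => /eqP e; apply/eqP/val_inj.
  move=> c cc; apply: big1 => s _; by rewrite [cls z i == c]eq_sym (negPf cc) andbF.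
rewrite exchange_big; apply: eq_bigr => c _; rewrite exchange_big; apply: eq_bigr => s _.
rewrite -big_distrl /=; congr (_ * _)%N.
case: (posnP s) => [->|s0]; last by rewrite sum_cls_len.
by rewrite big1 // => i _; rewrite eqn0Ngt len_gt0.
Qed.

Lemma sum_match_points m : size m <= r ->
  \sum_(q : point | cls z q.1 != c0) \sum_(p : point | match_pair z lam r m q p)
      count (fun b => len z q.1 \notin ssums b) (permutations (ptilde m r))
  = (#|gT| * \sum_(c : cclass gT | c != c0) \sum_(s1 < (psize m + r).+1)
      \sum_(s2 < (psize m + r).+1 | [&& 0 < s1, 0 < s2 & s1 + s2 == psize m + r])
        pair_term m c s1 s2)%N.
Proof.
move=> hm; set N := psize m + r.
pose H s1 c := if c == c0 then 0%N else
  \sum_(s2 < N.+1 | [&& 0 < s1, 0 < s2 & s1 + s2 == N])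
    (match_types m c s1 s2 * (zeta c * (s2 * (mult s2 (nu (cbar c))
      - ((s1 == s2) && (c == cbar c)))) * pcount m r s1))%N.
transitivity (\sum_(q : point) H (len z q.1) (cls z q.1)).
  rewrite big_mkcond; apply: eq_bigr => q _; rewrite /H.
  case: eqP => //= /eqP cq; rewrite sum_nat_const.
  (* The points [p] are sorted by the length of their cycle; it is at most [N], so [inord] does not
     fall back on its default. *)
  rewrite -sum1_card (partition_big (fun p : point => inord (len z p.1) : 'I_N.+1)
    (fun s2 => [&& 0 < len z q.1, 0 < s2 & len z q.1 + s2 == N])) /=; last first.
    move=> p /and4P[_ _ /eqP e _]; rewrite inordK; last by rewrite ltnS /N -e leq_addr.
    by rewrite !len_gt0 addnC e eqxx.
  rewrite big_distrl /=; apply: eq_bigr => s2 /and3P[q0 s20 /eqP es].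
  rewrite -card_inverse_points // mulnA; congr (_ * _)%N; last first.
    by rewrite pcountE // -/N; lia.
  rewrite sum1_card; case: (boolP (match_types _ _ _ _)) => hM; rewrite ?mul1n ?mul0n.
    apply: eq_card => p; rewrite !inE /match_pair; apply/andP/and3P.
      move=> [/and4P[h1 h2 /eqP h3 _] /eqP e]; split=> //.
      by rewrite -e inordK // ltnS /N -h3 leq_addr.
    case=> h1 h2 /eqP h3; rewrite unfold_in h1 h2 h3 /N addnC es eqxx /=; split; last first.
      by apply/eqP/val_inj; rewrite /= inordK // h3.
    move: hM; rewrite /match_types -/nu.
    suff -> : cls z p.1 = cbar (cls z q.1) by [].
    by rewrite !clsE -cls_of_inv (_ : mono z p = (mono z q)^-1) //; apply: (mulIg (mono z q)); rewrite (eqP h2) mulVg.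
  apply: eq_card0 => p; rewrite !inE; apply: contraNF hM.
  case/andP => /and4P[h1 h2 /eqP h3 h4] /eqP e; rewrite /match_types.
  have e2 : cls z p.1 = cbar (cls z q.1).
    by rewrite !clsE -cls_of_inv (_ : mono z p = (mono z q)^-1) //; apply: (mulIg (mono z q)); rewrite (eqP h2) mulVg.
  by rewrite -e2 -e inordK // ltnS /N -h3 leq_addr.
rewrite (sum_points (fun i => H (len z i) (cls z i))); congr (_ * _)%N.
rewrite (@sum_len_cls N.+1); last first.
  move=> s c hs; rewrite /H; case: eqP => // _; apply: big1 => s2 /and3P[_ _ /eqP]; lia.
rewrite [RHS]big_mkcond /=; apply: eq_bigr => c _; rewrite /H; case: eqP => /= cc.
  by rewrite big1 // => s1 _; rewrite muln0.
apply: eq_bigr => s1 _; rewrite big_distrr /=; apply: eq_bigr => s2 /and3P[s10 _ _].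
rewrite wtype_nontriv //; last exact/eqP.
rewrite /pair_term -/nu mulnCA; congr (_ * _)%N; ring.
Qed.

Lemma cbar_c0 : cbar (c0 : cclass gT) = c0.
Proof. by apply/val_inj; rewrite /= invg1. Qed.

Lemma cbar_neq0 c : (cbar c != c0) = (c != c0).
Proof. by rewrite -[in LHS]cbar_c0 (inj_eq (inv_inj cbarK)). Qed.

Lemma match_types_mult m c s1 s2 k d : match_types m c s1 s2 -> d != c0 -> 0 < k ->
  mult k (nu d) = (mult k (lam d) + ((d == c) && (k == s1)) + ((d == cbar c) && (k == s2)))%N.
Proof.
move=> /eqP e dc k0; have := congr1 (fun f : ptfun gT => mult k (f d)) e.
rewrite /= !mult_funion !mult_single_at // mult_at_class (negPf dc) mul0n addn0 => <-.
by rewrite addnA.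
Qed.

Lemma pair_term_sym m c s1 s2 : size m <= r -> 0 < s1 -> 0 < s2 ->
  (s1 + s2 = psize m + r)%N -> pair_term m (cbar c) s2 s1 = pair_term m c s1 s2.
Proof.
move=> hm h1 h2 hs; rewrite /pair_term /match_types cbarK zeta_cbar.
rewrite (pcount_sym hm h1 h2 hs) [s2 == s1]eq_sym [cbar c == c]eq_sym.
have -> : funion (single s2 (cbar c)) (single s1 c)
        = funion (single s1 c) (single s2 (cbar c)).
  by apply: ptfun_eq => k d _; rewrite !mult_funion addnC.
congr (_ * _)%N; case: eqP => [->|_]; rewrite /= ?subn0; last by ring.
case: eqP => [<-//|_] /=; rewrite !subn0; ring.
Qed.

(** The two cycles differ in length or class, so each of the two multiplicities in [nu] exceeds the
    one in [lam] by one. *)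
Lemma pair_term_lt m c s1 s2 : c != c0 -> 0 < s1 -> 0 < s2 ->
  (s1 == s2) && (c == cbar c) = false ->
  pair_term m c s1 s2 = (match_types m c s1 s2 * (s1 * s2 * zeta c * pcount m r s1
    * (mult s1 (lam c)).+1 * (mult s2 (lam (cbar c))).+1))%N.
Proof.
move=> cc h1 h2 hne; rewrite /pair_term hne subn0.
case: (boolP (match_types _ _ _ _)) => hM //; rewrite !mul1n.
rewrite (match_types_mult hM cc h1) (match_types_mult hM _ h2) ?cbar_neq0 // !eqxx /=.
rewrite [s2 == s1]eq_sym [cbar c == c]eq_sym andbC in hne *; rewrite !hne.
by rewrite !addn0 !addn1 !mulnA.
Qed.

Lemma bin2_mul a : ('C(a.+2, 2) * 2 = a.+2 * a.+1)%N.
Proof. by rewrite (bin_ffact a.+2 2) !ffactnS ffactn0 muln1. Qed.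

(** Both cycles are taken from the same a+2 cycles of [z], with a the multiplicity in [lam]; the
    (a+2)(a+1) ordered choices are twice the binomial coefficient. *)
Lemma pair_term_diag m c s : c != c0 -> 0 < s -> c = cbar c ->
  pair_term m c s s = (2 * (match_types m c s s * (s ^ 2 * zeta c * pcount m r s
    * 'C((mult s (lam c)).+2, 2))))%N.
Proof.
move=> cc h1 ec; rewrite /pair_term -ec !eqxx.
case: (boolP (match_types _ _ _ _)) => hM //; rewrite !mul1n.
have := match_types_mult hM cc h1; rewrite -ec !eqxx /= => ->.
have -> : (mult s (lam c) + 1 + 1 = (mult s (lam c)).+2)%N by rewrite !addn1.
rewrite /= subn1 /= -bin2_mul; ring.
Qed.

(** Ordered pairs count everything twice. Terms with s1 > s2 become those with s1 < s2 on replacing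
    [c] by [cbar c]; for equal lengths, a pair of distinct inverse classes is met once from each
    class, and a self-inverse class gives twice a binomial coefficient. *)
Lemma sum_pair_term m : 0 < r -> size m <= r ->
  \sum_(c : cclass gT | c != c0) \sum_(s1 < (psize m + r).+1)
      \sum_(s2 < (psize m + r).+1 | [&& 0 < s1, 0 < s2 & s1 + s2 == psize m + r])
        pair_term m c s1 s2
  = (2 * (\sum_(c : cclass gT | c != c0) \sum_(s1 < (psize m + r).+1)
      \sum_(s2 < (psize m + r).+1 | [&& 0 < s1, s1 < s2 & s1 + s2 == psize m + r])
        match_types m c s1 s2 * (s1 * s2 * zeta c * pcount m r s1
           * (mult s1 (lam c)).+1 * (mult s2 (lam (cbar c))).+1)
   + \sum_(c : cclass gT | pair_rep c)
     \sum_(s < (psize m + r).+1 | 2 * s == psize m + r)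
       match_types m c s s * (s ^ 2 * zeta c * pcount m r s
           * (mult s (lam c)).+1 * (mult s (lam (cbar c))).+1)
   + \sum_(c : cclass gT | (c == cbar c) && (c != c0))
     \sum_(s < (psize m + r).+1 | 2 * s == psize m + r)
       match_types m c s s * (s ^ 2 * zeta c * pcount m r s * 'C((mult s (lam c)).+2, 2))))%N.
Proof.
move=> r0 hm; set N := psize m + r.
pose Lt c := \sum_(s1 < N.+1) \sum_(s2 < N.+1 | [&& 0 < s1, s1 < s2 & s1 + s2 == N])
   pair_term m c s1 s2.
pose Gt c := \sum_(s1 < N.+1) \sum_(s2 < N.+1 | [&& 0 < s2, s2 < s1 & s1 + s2 == N])
   pair_term m c s1 s2.
pose Eq c := \sum_(s < N.+1 | (2 * s == N)%N) pair_term m c s s.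
have split3 c : \sum_(s1 < N.+1) \sum_(s2 < N.+1 | [&& 0 < s1, 0 < s2 & s1 + s2 == N])
        pair_term m c s1 s2 = (Lt c + Gt c + Eq c)%N.
  rewrite /Lt /Gt /Eq [X in (_ + X)%N]big_mkcond /= -!big_split; apply: eq_bigr => s1 _ /=.
  have -> : (if 2 * s1 == N then pair_term m c s1 s1 else 0)%N
    = \sum_(s2 < N.+1 | [&& 0 < s1, s1 == s2 & s1 + s2 == N]) pair_term m c s1 s2.
    case: eqP => e; last first.
      by rewrite big_pred0 // => s2; apply/and3P => -[_ /eqP <- /eqP]; lia.
    rewrite (big_pred1 s1) // => s2 /=.
    apply/and3P/eqP => [[_ /eqP <-]//|->]; split=> //.
      case: (posnP s1) e => // ->; rewrite muln0 => e.
      by move: r0; rewrite -(leq_add2l (psize m)) addn1 -/N -e.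
    by apply/eqP; lia.
  rewrite big_mkcond [X in (X + _ + _)%N]big_mkcond [X in (_ + X + _)%N]big_mkcond.
  rewrite [X in (_ + _ + X)%N]big_mkcond -!big_split; apply: eq_bigr => s2 _ /=.
  rewrite -[s1 == s2](inj_eq val_inj) /=.
  case: (s1 + s2 == N); rewrite ?andbF // !andbT.
  case: (ltngtP s1 s2) => h; rewrite ?andbT ?andbF ?addn0 ?add0n.
  - by case: (posnP s1) => // s10; rewrite (leq_trans s10 (ltnW h)).
  - by case: (posnP s2) => [->|s20]; rewrite ?andbF // (leq_trans s20 (ltnW h)).
  - by rewrite -h; case: (posnP s1).
have GL : \sum_(c : cclass gT | c != c0) Gt c = \sum_(c : cclass gT | c != c0) Lt c.
  rewrite (reindex_inj (inv_inj cbarK)); apply: eq_big => [c|c _].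
    by rewrite cbar_neq0.
  rewrite /Gt (exchange_big_dep xpredT) //=; apply: eq_bigr => s1 _.
  apply: eq_big => [s2|s2 /and3P[h1 h2 /eqP h3]]; first by rewrite addnC.
  by apply: pair_term_sym => //; [apply: leq_trans h1 (ltnW h2)|rewrite addnC h3].
have Esym c : Eq (cbar c) = Eq c.
  rewrite /Eq; apply: eq_bigr => s /eqP hs.
  have s0 : 0 < s.
    case: (posnP s) hs => // ->; rewrite muln0 => e.
    by move: r0; rewrite -(leq_add2l (psize m)) addn1 -/N -e.
  by apply: pair_term_sym => //; rewrite addnn -mul2n.
have EP : \sum_(c : cclass gT | c != c0) Eq c
    = (\sum_(c : cclass gT | (c == cbar c) && (c != c0)) Eq c
       + 2 * \sum_(c : cclass gT | pair_rep c) Eq c)%N.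
  rewrite (bigID (fun c => c == cbar c)) /=; congr (_ + _)%N.
    by apply: eq_bigl => c; rewrite andbC.
  rewrite (eq_bigl (fun c => c != cbar c)); last first.
    move=> c; case: (boolP (c == cbar c)); rewrite ?andbF ?andbT //.
    by move=> h; apply: contraNneq h => ->; rewrite cbar_c0.
  rewrite (bigID (@pair_rep gT)) /= mul2n -addnn; congr (_ + _)%N.
    by apply: eq_bigl => c; rewrite /pair_rep andbA andbb.
  rewrite (reindex_inj (inv_inj cbarK)); apply: eq_big => [c|c _]; last exact: Esym.
  rewrite cbarK eq_sym; case: (boolP (c == cbar c)) => [/eqP e|h] /=.
    by rewrite /pair_rep -e eqxx.
  by rewrite (pair_rep_cbar h) negbK.
rewrite (eq_bigr _ (fun c _ => split3 c)) !big_split /= GL EP.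
have fin (X Y Z A B C : nat) : X = A -> Z = B -> Y = (2 * C)%N ->
  (X + X + (Y + 2 * Z) = 2 * (A + B + C))%N by lia.
apply: fin.
- apply: eq_bigr => c cc; apply: eq_bigr => s1 _.
  apply: eq_bigr => s2 /and3P[h1 h2 _]; apply: pair_term_lt => //.
    exact: leq_trans h1 (ltnW h2).
  by rewrite (ltn_eqF h2).
- apply: eq_bigr => c cc; apply: eq_bigr => s /eqP hs.
  have s0 : 0 < s.
    case: (posnP s) hs => // ->; rewrite muln0 => e.
    by move: r0; rewrite -(leq_add2l (psize m)) addn1 -/N -e.
  have ncb : c != cbar c by case/andP: cc.
  have c0' : c != c0 by apply: contraNneq ncb => ->; rewrite cbar_c0.
  by rewrite pair_term_lt ?(negPf ncb) ?andbF // mulnn.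
rewrite big_distrr; apply: eq_bigr => c /andP[/eqP ec cc] /=.
rewrite big_distrr; apply: eq_bigr => s /eqP hs /=.
have s0 : 0 < s.
  case: (posnP s) hs => // ->; rewrite muln0 => e.
  by move: r0; rewrite -(leq_add2l (psize m)) addn1 -/N -e.
exact: pair_term_diag.
Qed.

End PairTotals.

(** * Structure constants *)

Section Main.
Local Open Scope group_scope.
Context {gT : finGroupType} {n : nat}.
Local Notation point := ('I_n * gT)%type.
Implicit Types (p q u : point) (g h : gT) (i j : 'I_n) (c : cclass gT) (m : Defs.partn).
Variables (z : wreath gT n) (lam : ptfun gT) (r : nat).
Hypothesis r0 : 0 < r.
Let nu := mtype z.
Hypothesis norm_nu : norm nu = (norm lam + r)%N.

Lemma goodseq_rot k (s : seq point) : goodseq z lam (rot k s) = goodseq z lam s.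
Proof.
rewrite /goodseq map_rot rot_uniq; case: (boolP (uniq _)) => //= us.
by rewrite cyc_rot.
Qed.

(** Exactly one rotation brings the point on the non-trivial cycle to the front. *)
Lemma count_split_one :
  #|[pred t : r.+1.-tuple point | goodseq z lam t && split_one (z * cyc t) t]|
  = (r.+1 * #|[pred t : r.+1.-tuple point | goodseq z lam t
                && split_head (z * cyc t)%g t]|)%N.
Proof.
pose Q (t : r.+1.-tuple point) := goodseq z lam t && split_one (z * cyc t) t.
pose E (t : r.+1.-tuple point) := mono (z * cyc t) (thead t) != 1.
have hQ k t : Q (rot_tuple k t) = Q t.
  rewrite /Q /= goodseq_rot; case: (boolP (goodseq z lam t)) => //= /andP[ut _].
  rewrite cyc_rot // /split_one map_rot rot_uniq; congr (_ && _).
  by rewrite (seq.permP (permEl (perm_rot k t))).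
have hE t : Q t -> \sum_(j < r.+1) E (rot_tuple j t) = 1%N.
  move=> /andP[/andP[ut _] /andP[/eqP c1 _]].
  rewrite -[RHS]c1 -(sum_rot_head _ (thead t)); apply: eq_bigr => j _; congr nat_of_bool.
  rewrite /E /= cyc_rot //; congr (mono _ _ != 1).
  by rewrite [LHS](tnth_nth (thead t)) nth0.
have := rot_count hQ hE; rewrite mul1n => eQ.
transitivity #|Q|; first by apply: eq_card.
rewrite eQ; congr (_ * _)%N; apply: eq_card => t; rewrite !inE /Q /E -andbA.
case: (goodseq _ _ _) => //=; case/tupleP: t => p t; rewrite theadE.
exact: split_one_head.
Qed.

(** Two rotations are admissible, one for each of the two points that share a cycle. *)
Lemma count_split_coinc :
  (2 * #|[pred t : r.+1.-tuple point | goodseq z lam t && split_coinc z (z * cyc t)%g t]|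
  = r.+1 * #|[pred t : r.+1.-tuple point | goodseq z lam t
      && (split_pair (z * cyc t)%g t && all (fun u => mono z u != 1%g) t)]|)%N.
Proof.
pose Q (t : r.+1.-tuple point) := goodseq z lam t && split_coinc z (z * cyc t) t.
pose E (t : r.+1.-tuple point) :=
  1 < count_mem (porbit (wperm (z * cyc t)) (thead t).1)
        [seq porbit (wperm (z * cyc t)) u.1 | u <- t].
have hQ k t : Q (rot_tuple k t) = Q t.
  rewrite /Q /= goodseq_rot; case: (boolP (goodseq z lam t)) => //= /andP[ut _].
  have pr := perm_rot k t.
  rewrite cyc_rot // /split_coinc !(perm_all _ (permEl pr)) size_rot; congr [&& _, _ & _].
  by rewrite (perm_size (perm_undup (perm_mem (perm_map _ (permEl pr))))).
have hE t : Q t -> \sum_(j < r.+1) E (rot_tuple j t) = 2%N.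
  move=> /andP[/andP[ut _] /and3P[_ /eqP sz _]].
  set x := z * cyc t in sz.
  have := @count_repeated _ [seq porbit (wperm x) u.1 | u <- t].
  rewrite size_map => /(_ sz) c2.
  rewrite -[RHS]c2 count_map -(sum_rot_head _ (thead t)); apply: eq_bigr => j _.
  congr nat_of_bool; rewrite /E /= cyc_rot // -/x map_rot.
  rewrite (seq.permP (permEl (perm_rot j _))).
  congr (1 < count_mem (porbit _ _.1) _).
  by rewrite [LHS](tnth_nth (thead t)) nth0.
have eQ := rot_count hQ hE.
transitivity (2 * #|Q|)%N; first by congr (_ * _)%N; apply: eq_card.
rewrite eQ; congr (_ * _)%N; apply: eq_card => t; rewrite !inE /Q /E -andbA.
case: (goodseq _ _ _) => //=; case/tupleP: t => p t; rewrite theadE.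
exact: split_coinc_head.
Qed.

Lemma count_goodseq :
  #|[pred t : r.+1.-tuple point | fibred t && (mtype (z * cyc t) == lam)]|
  = (#|[pred t : r.+1.-tuple point | goodseq z lam t && split_all (z * cyc t)%g t]|
   + #|[pred t : r.+1.-tuple point | goodseq z lam t && split_one (z * cyc t)%g t]|
   + #|[pred t : r.+1.-tuple point | goodseq z lam t && split_coinc z (z * cyc t)%g t]|)%N.
Proof.
rewrite -!sum1_card [LHS]big_mkcond [X in (X + _ + _)%N]big_mkcond.
rewrite [X in (_ + X + _)%N]big_mkcond [X in (_ + _ + X)%N]big_mkcond -!big_split.
apply: eq_bigr => t _ /=.
rewrite !inE -/(goodseq z lam t); case: (boolP (goodseq z lam t)) => //= /andP[ut /eqP mt].
have := @trivs_split _ _ z t (z * cyc t) r (size_tuple t).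
have hn : norm (mtype z) = (norm (mtype (z * cyc t)%g) + r)%N by rewrite mt.
move/(_ (trivs_norm erefl hn)).
by case: (split_all _ _); case: (split_one _ _); case: (split_coinc _ _ _).
Qed.

Lemma match_fdiff (A B : ptfun gT) :
  (forall k c, mult k (B c) <= mult k (funion lam A c)) ->
  (funion lam A == funion nu B) = (fdiff (funion lam A) B == nu).
Proof.
move=> h; apply/eqP/eqP => [->|<-]; apply: ptfun_eq => k c _.
  by rewrite mult_fdiff mult_funion addnK.
by rewrite [RHS]mult_funion mult_fdiff subnK.
Qed.

Lemma mult_at_sub (A : ptfun gT) m k c : m \in subpartns (lam c0) ->
  mult k (at_class c0 m c) <= mult k (funion lam A c).
Proof.
rewrite mem_subpartns mult_at_class mult_funion => /psubP /(_ k) h.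
by case: eqP => [->|_]; rewrite ?mul0n // mul1n (leq_trans h) ?leq_addr.
Qed.

Lemma mult_at_single_sub (A : ptfun gT) m k c a d : c != c0 ->
  m \in subpartns (lam c0) -> k \in parts (lam c) ->
  mult a (funion (at_class c0 m) (single k c) d) <= mult a (funion lam A d).
Proof.
move=> cc ml kl; rewrite [mult a (funion (at_class c0 m) _ d)]mult_funion.
have [->|dc] := eqVneq d c0.
  by rewrite [mult a (single k c c0)]mult_at_class [c0 == c]eq_sym (negPf cc) mul0n addn0
     mult_at_sub.
rewrite mult_at_class (negPf dc) mul0n add0n; case: (posnP a) => [->|a0]; first by rewrite mult0.
rewrite mult_funion mult_single_at //; case: eqP => //= ->.
case: eqP => //= ->; rewrite (leq_trans _ (leq_addr _ _)) //.
by rewrite /mult -has_count has_pred1.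
Qed.

Definition cut_coef m : nat := ((mult (psize m + r) (lam c0)).+1 * (psize m + r).+1 * r`!)
           %/ ((r.+1 - size m)`! * mfact m).

Lemma mfact_gt0 m : 0 < mfact m.
Proof. by apply: prodn_gt0 => i; apply: fact_gt0. Qed.

(** The rearrangements number (r+1)! over the denominator of [cut_coef], whose numerator has only
    r!; the quotient [r.+1] is the choice of a first point, which no rotation argument has removed
    in this case. *)
Lemma cut_coefE m : size m <= r.+1 ->
  (r.+1 * cut_coef m = (mult (psize m + r) (lam c0)).+1 * (psize m + r).+1
    * size (permutations (ptilde m r.+1)))%N.
Proof.
move=> hm; have D0 : 0 < (r.+1 - size m)`! * mfact m by rewrite muln_gt0 fact_gt0 mfact_gt0.
apply/eqP; rewrite -(eqn_pmul2r D0); apply/eqP.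
rewrite -[RHS]mulnA size_permutations_ptilde // -mulnA /cut_coef divnK; last first.
  by rewrite -mulnA dvdn_mull // coefS_dvdn.
by rewrite factS; ring.
Qed.

Lemma coef2E m (a b : nat) : size m <= r ->
  ((a * b * r`!) %/ ((r - size m)`! * mfact m)
   = a * b * size (permutations (ptilde m r)))%N.
Proof.
move=> hm; have D0 : 0 < (r - size m)`! * mfact m by rewrite muln_gt0 fact_gt0 mfact_gt0.
by rewrite -(size_permutations_ptilde hm) mulnA mulnK.
Qed.

Lemma sum_match_all : \sum_(m <- subpartns (lam c0) | match_all z lam r m)
      (size (pts_of z (psize m + r).+1 c0) * size (permutations (ptilde m r.+1)))%N
  = (r.+1 * #|gT| * \sum_(m <- subpartns (lam c0) | size m <= r.+1)
      (fdiff (funion lam (single (psize m + r) c0)) (at_class c0 m) == nu) * cut_coef m)%N.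
Proof.
rewrite big_distrr big_mkcond [RHS]big_mkcond big_seq [RHS]big_seq /=.
apply: eq_bigr => m ml; rewrite /match_all; case: (boolP (size m <= r.+1)) => //= hm.
rewrite match_fdiff; last by move=> k c; apply: mult_at_sub.
case: (boolP (_ == nu)) => [e|_]; last by rewrite mul0n muln0.
rewrite mul1n size_pts_of // -[(psize m + r).+1 in X in (_ * (_ * X))%N]addn1.
have N0 : 0 < psize m + r by rewrite addn_gt0 r0 orbT.
have := @mult_mtype_wtype _ _ z c0 _ N0; rewrite eqxx addn1 => <-.
rewrite -/nu -(eqP e) mult_fdiff mult_funion mult_single_at // !eqxx /=.
(* Since [r] is positive, [psize m + r] exceeds every part of [m], and removing [m] does not change
   its multiplicity. *)
rewrite mult_at_class eqxx mul1n (@mult_gt_psize m) ?subn0 ?addn1; last by lia.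
by rewrite [RHS]mulnAC cut_coefE //; ring.
Qed.

Lemma sum_match_head :
    \sum_(c : cclass gT | c != c0)
    \sum_(m <- subpartns (lam c0) | size m <= r)
    \sum_(k <- undup (lam c) | match_head z lam r c m k)
      (size (pts_of z (psize m + r + k) c) * size (permutations (ptilde m r)))%N
  = (#|gT| * \sum_(c : cclass gT | c != c0)
     \sum_(m <- subpartns (lam c0) | size m <= r)
     \sum_(k <- undup (lam c))
       (fdiff (funion lam (single (psize m + r + k) c))
                (funion (at_class c0 m) (single k c)) == nu)
       * ((((mult (psize m + r + k) (lam c)).+1 * (psize m + r + k) * r`!)
           %/ ((r - size m)`! * mfact m))))%N.
Proof.
rewrite big_distrr; apply: eq_bigr => c cc.
rewrite big_distrr big_seq_cond [RHS]big_seq_cond; apply: eq_bigr => m /andP[ml hm] /=.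
rewrite big_distrr big_mkcond big_seq [RHS]big_seq; apply: eq_bigr => k /=.
rewrite mem_undup => kl; have k0 := parts_gt0 kl.
rewrite /match_head match_fdiff; last by move=> a d; apply: mult_at_single_sub.
case: (boolP (_ == nu)) => [e|_]; last by rewrite mul0n muln0.
have N0 : 0 < psize m + r + k by rewrite addn_gt0 k0 orbT.
rewrite mul1n coef2E // size_pts_of // wtype_nontriv //.
rewrite -/nu -(eqP e) mult_fdiff !mult_funion !mult_single_at // !eqxx /=.
rewrite mult_at_class (negPf cc) mul0n (_ : (_ == k) = false) ?subn0 ?addn1; first by ring.
by apply/eqP; lia.
Qed.

Lemma sum_match_pair :
  \sum_(m <- subpartns (lam c0) | size m <= r)
    \sum_(q : point | cls z q.1 != c0) \sum_(p : point | match_pair z lam r m q p)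
      count (fun b => len z q.1 \notin ssums b) (permutations (ptilde m r))
  = (2 * #|gT| * (
     \sum_(c : cclass gT | c != c0)
     \sum_(m <- subpartns (lam c0) | size m <= r)
     \sum_(s1 < (psize m + r).+1)
     \sum_(s2 < (psize m + r).+1 | [&& 0 < s1, s1 < s2 & s1 + s2 == psize m + r])
       (fdiff (funion (funion lam (single s1 c)) (single s2 (cbar c)))
                (at_class c0 m) == nu)
       * (s1 * s2 * zeta c * pcount m r s1
           * (mult s1 (lam c)).+1 * (mult s2 (lam (cbar c))).+1)
   + \sum_(c : cclass gT | pair_rep c)
     \sum_(m <- subpartns (lam c0) | size m <= r)
     \sum_(s < (psize m + r).+1 | 2 * s == psize m + r)
       (fdiff (funion (funion lam (single s c)) (single s (cbar c)))
                (at_class c0 m) == nu)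
       * (s ^ 2 * zeta c * pcount m r s
           * (mult s (lam c)).+1 * (mult s (lam (cbar c))).+1)
   + \sum_(c : cclass gT | (c == cbar c) && (c != c0))
     \sum_(m <- subpartns (lam c0) | size m <= r)
     \sum_(s < (psize m + r).+1 | 2 * s == psize m + r)
       (fdiff (funion (funion lam (single s c)) (single s c))
                (at_class c0 m) == nu)
       * (s ^ 2 * zeta c * pcount m r s * 'C((mult s (lam c)).+2, 2))))%N.
Proof.
have M m c s1 s2 : m \in subpartns (lam c0) -> match_types z lam m c s1 s2
   = (fdiff (funion (funion lam (single s1 c)) (single s2 (cbar c))) (at_class c0 m) == nu).
  move=> ml; rewrite /match_types match_fdiff; last by move=> k d; apply: mult_at_sub.
  congr (_ == _); congr fdiff; apply: ptfun_eq => k d _.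
  by rewrite !mult_funion addnA.
rewrite [X in (_ * (X + _ + _))%N]exchange_big.
rewrite [X in (_ * (_ + X + _))%N]exchange_big.
rewrite [X in (_ * (_ + _ + X))%N]exchange_big -!big_split /= big_distrr /=.
rewrite big_seq_cond [RHS]big_seq_cond; apply: eq_bigr => m /andP[ml hm].
rewrite sum_match_points // sum_pair_term // -mulnCA -mulnA; congr (_ * (_ * _))%N.
congr (_ + _ + _)%N.
- apply: eq_bigr => c _; apply: eq_bigr => s1 _; apply: eq_bigr => s2 _.
  congr (nat_of_bool _ * _)%N; exact: M.
- apply: eq_bigr => c _; apply: eq_bigr => s _.
  congr (nat_of_bool _ * _)%N; exact: M.
- apply: eq_bigr => c /andP[/eqP ec _]; apply: eq_bigr => s _.
  have := M m c s s ml; rewrite -ec => e.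
  congr (nat_of_bool _ * _)%N; exact: e.
Qed.

(** All three counts carry the weight [r.+1 * #|gT|] of a single factorization, once the 2 from the
    choice between the coinciding points is cancelled against the 2 from the ordered pairs. *)
Lemma count_factor_total :
  #|[set y | (mtype y == single r c0) && (mtype (z * y^-1) == lam)]|
  = (\sum_(m <- subpartns (lam c0) | size m <= r.+1)
      (fdiff (funion lam (single (psize m + r) c0)) (at_class c0 m) == nu) * cut_coef m
   + \sum_(c : cclass gT | c != c0)
     \sum_(m <- subpartns (lam c0) | size m <= r)
     \sum_(k <- undup (lam c))
       (fdiff (funion lam (single (psize m + r + k) c))
                (funion (at_class c0 m) (single k c)) == nu)
       * ((((mult (psize m + r + k) (lam c)).+1 * (psize m + r + k) * r`!)
           %/ ((r - size m)`! * mfact m)))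
   + (
     \sum_(c : cclass gT | c != c0)
     \sum_(m <- subpartns (lam c0) | size m <= r)
     \sum_(s1 < (psize m + r).+1)
     \sum_(s2 < (psize m + r).+1 | [&& 0 < s1, s1 < s2 & s1 + s2 == psize m + r])
       (fdiff (funion (funion lam (single s1 c)) (single s2 (cbar c)))
                (at_class c0 m) == nu)
       * (s1 * s2 * zeta c * pcount m r s1
           * (mult s1 (lam c)).+1 * (mult s2 (lam (cbar c))).+1)
   + \sum_(c : cclass gT | pair_rep c)
     \sum_(m <- subpartns (lam c0) | size m <= r)
     \sum_(s < (psize m + r).+1 | 2 * s == psize m + r)
       (fdiff (funion (funion lam (single s c)) (single s (cbar c)))
                (at_class c0 m) == nu)
       * (s ^ 2 * zeta c * pcount m r s
           * (mult s (lam c)).+1 * (mult s (lam (cbar c))).+1)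
   + \sum_(c : cclass gT | (c == cbar c) && (c != c0))
     \sum_(m <- subpartns (lam c0) | size m <= r)
     \sum_(s < (psize m + r).+1 | 2 * s == psize m + r)
       (fdiff (funion (funion lam (single s c)) (single s c))
                (at_class c0 m) == nu)
       * (s ^ 2 * zeta c * pcount m r s * 'C((mult s (lam c)).+2, 2))))%N.
Proof.
have G0 : 0 < #|gT| by apply/card_gt0P; exists 1.
have fin (R G a n1 n2 n3 S1 S2 S3 : nat) : 0 < R -> 0 < G ->
    n1 = (R * G * S1)%N -> n2 = (R * (G * S2))%N -> (2 * n3 = R * (2 * G * S3))%N ->
    (R * G * a = n1 + n2 + n3)%N -> a = (S1 + S2 + S3)%N.
  move=> R0 g0 -> -> e3; have -> : n3 = (R * G * S3)%N.
    by apply/eqP; rewrite -(@eqn_pmul2l 2) // e3; apply/eqP; ring.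
  move=> e; apply/eqP; rewrite -(@eqn_pmul2l (R * G)) ?muln_gt0 ?R0 // e.
  by apply/eqP; ring.
have H1 := etrans (count_split_all z lam r0) sum_match_all.
have H2 := etrans count_split_one (congr1 (muln r.+1) (etrans (count_split_head z lam r0) sum_match_head)).
have H3 := etrans count_split_coinc (congr1 (muln r.+1) (etrans (count_split_pair z lam r0) sum_match_pair)).
have H4 := etrans (count_factor lam z r0) count_goodseq.
exact: (fin _ _ _ _ _ _ _ _ _ (ltn0Sn r) G0 H1 H2 H3 H4).
Qed.

End Main.

(** * Existence of elements of given type *)

Section Existence.
Local Open Scope group_scope.
Context {gT : finGroupType} {n : nat}.
Local Notation point := ('I_n * gT)%type.
Implicit Types (z : wreath gT n) (p q u : point) (i : 'I_n) (c : cclass gT).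
Implicit Types (l : seq (nat * cclass gT)).

(* [l] lists the lengths and classes of all cycles of some element; a cycle of
   length [k] contributes [k] points to each sum. *)
Definition realizable l := exists z, forall F : nat -> cclass gT -> nat,
  \sum_i F (len z i) (cls z i) = (\sum_(e <- l) e.1 * F e.1 e.2)%N.

Lemma realizable_perm l1 l2 : perm_eq l1 l2 -> realizable l1 -> realizable l2.
Proof. by move=> pl [z hz]; exists z => F; rewrite hz (perm_big _ pl). Qed.

(** Multiplication by a base element supported at a trivial fixed point gives that point any
    prescribed monodromy. *)
Lemma realizable_cls c l : realizable ((1%N, c0) :: l) -> realizable ((1%N, c) :: l).
Proof.
case=> z hz.
have : 0 < \sum_i ((len z i == 1%N) && (cls z i == c0)).
  by rewrite (hz (fun a d => (a == 1%N) && (d == c0))) big_cons /= !eqxx.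
rewrite lt0n sum_nat_eq0 negb_forall => /existsP[i /=].
rewrite eqb0 negbK => /andP[/eqP li /eqP ci].
pose g := repr (val c).
pose d : wreath gT n := Wreath [ffun j => if j == i then g else 1] 1.
have dE j h : wact d (j, h) = (j, if j == i then g * h else h).
  by rewrite /wact /= perm1 ffunE; case: eqP; rewrite ?mul1g.
have fz h : wact z (i, h) = (i, h).
  have := iter_mono z (i, h); rewrite li /= => ->.
  by rewrite (eqP (_ : mono z (i, h) == 1)) ?rt1 // -cls_c0 ci.
have fv h : wact (z * d) (i, h) = (i, g * h) by rewrite wactM dE eqxx fz.
have lv : len (z * d) i = 1%N.
  by apply: len_first => //; [exact: (congr1 fst (fv 1))|case].
have cv : cls (z * d) i = c.
  rewrite -[c]cls_of_repr /cls; congr cls_of; apply: (@rt_inj _ _ (i, 1)).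
  by rewrite -iter_mono lv /= fv /rt /= mul1g mulg1.
have ov j : j != i -> len (z * d) j = len z j /\ cls (z * d) j = cls z j.
  move=> ji; have := @untouched _ _ (z * d) z (j, 1).
  case=> [k h hk|_ l1 m1]; last by rewrite /cls m1.
  rewrite wactM dE (_ : (k == i) = false) //.
  apply: contraNF ji => /eqP ki; move: hk; rewrite /= ki porbit_sym.
  move: (card_le1_eqP (eq_leq li)) => h1 hj.
  by rewrite (h1 i j) ?porbit_id.
exists (z * d) => F; have := hz F; rewrite !big_cons /= !mul1n.
rewrite (bigD1 i) //= [in X in _ -> X](bigD1 i) //= li ci lv cv => /addnI <-.
by congr (_ + _)%N; apply: eq_bigr => j /ov[-> ->].
Qed.

(** A lifted transposition absorbs a trivial fixed point into a cycle without changing the class of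
    the cycle. *)
Lemma realizable_join a c l : 0 < a ->
  realizable [:: (a, c), (1%N, c0) & l] -> realizable ((a.+1, c) :: l).
Proof.
move=> a0 [z hz].
have : 0 < \sum_i ((len z i == a) && (cls z i == c)).
  rewrite (hz (fun b d => (b == a) && (d == c))) big_cons /= !eqxx muln1.
  by rewrite addn_gt0 a0.
rewrite lt0n sum_nat_eq0 negb_forall => /existsP[i /=].
rewrite eqb0 negbK => /andP[/eqP li /eqP ci].
have : 0 < \sum_(j | j \notin porbit (wperm z) i) ((len z j == 1%N) && (cls z j == c0)).
  have := hz (fun b d => (b == 1%N) && (d == c0)).
  rewrite (bigID (mem (porbit (wperm z) i))) /=.
  rewrite (sum_porbit z i (fun b d => (b == 1%N) && (d == c0))) li ci big_cons /= => /addnI ->.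
  by rewrite big_cons /= !eqxx.
rewrite lt0n sum_nat_eq0 negb_forall => /existsP[j /=].
rewrite negb_imply eqb0 negbK => /andP[nj /andP[/eqP lj /eqP cj]].
pose p : point := (i, 1); pose q : point := (j, 1).
have nq : q.1 \notin porbit (wperm z) p.1 by [].
exists (z * ptperm p q) => F.
have mq : mono z q = 1 by apply/eqP; rewrite -cls_c0 cj.
have lv : len (z * ptperm p q) p.1 = a.+1 by rewrite join_len // li lj addn1.
have cv : cls (z * ptperm p q) p.1 = c by rewrite clsE join_mono // mq mulg1 -clsE.
have := join_sum F erefl nq; rewrite lv cv li ci lj cj hz !big_cons /=; lia.
Qed.

Lemma realizable_nseq k c l : 0 < k ->
  realizable (nseq k (1%N, c0) ++ l) -> realizable ((k, c) :: l).
Proof.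
case: k => // k _; elim: k l => [|k IH] l; first exact: realizable_cls.
move=> h; apply: realizable_join => //; apply: IH.
apply: realizable_perm h; rewrite -cat1s catA.
by apply: perm_cat => //; rewrite -[nseq k.+2 _]/(nseq (1 + k.+1) _) nseqD perm_catC.
Qed.

Lemma realizable_all l t : all (fun e => 0 < e.1) l ->
  realizable (nseq (\sum_(e <- l) e.1) (1%N, c0) ++ t) -> realizable (l ++ t).
Proof.
elim: l t => [|[k c] l IH] t /=; first by rewrite big_nil.
case/andP => k0 hl; rewrite big_cons /= nseqD => h.
apply: realizable_nseq => //.
have pc (u v w : seq (nat * cclass gT)) : perm_eq (u ++ v ++ w) (v ++ u ++ w).
  by rewrite perm_catCA.
apply: realizable_perm (pc _ _ _) (IH _ hl _).
by apply: realizable_perm h; rewrite -catA perm_catCA.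
Qed.

Lemma realizable1 : realizable (nseq n (1%N, c0)).
Proof.
pose w : wreath gT n := 1; exists w => F; rewrite big_nseq.
have one i : len w i = 1%N /\ cls w i = c0.
  have [l1 m1] := fix_point (wact1 ((i, 1) : point)).
  by split=> //; apply/eqP; rewrite -[i]/((i, 1 : gT).1) cls_c0 m1.
rewrite (eq_bigr (fun=> F 1%N c0)); last by move=> i _; have [-> ->] := one i.
by rewrite big_const_ord mul1n.
Qed.

(** Enlarging every part at [c0] by one gives cycle lengths with sum exactly [n], so no fixed points
    have to be added. This rules out the default value 0 in [structure_const]. *)
Lemma mtype_exists (nu : ptfun gT) : n = norm nu + size (nu c0) ->
  exists z, mtype z = nu.
Proof.
move=> en.
pose l := [seq (k + (c == c0), c) | c <- enum {: cclass gT}, k <- nu c].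
have sl (F : nat -> cclass gT -> nat) : \sum_(e <- l) F e.1 e.2
    = \sum_c \sum_(k <- nu c) F (k + (c == c0)) c.
  by rewrite big_allpairs_dep big_enum.
have l0 : all (fun e => 0 < e.1) l.
  apply/allP => e /allpairsPdep[c [k [_ kc ->]]] /=.
  by rewrite addn_gt0 (parts_gt0 kc).
have nl : \sum_(e <- l) e.1 = n.
  rewrite (sl (fun k _ => k)) en /norm.
  have e (s : seq nat) a : \sum_(k <- s) (k + a) = (sumn s + size s * a)%N.
    by rewrite big_split /= -sumnE big_const_seq count_predT iter_addn_0 mulnC.
  under eq_bigr => c _ do rewrite e.
  rewrite big_split /=; congr (_ + _)%N.
  by rewrite (bigD1 c0) //= eqxx muln1 big1 ?addn0 // => c /negPf ->; rewrite muln0.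
have [z hz] : realizable l.
  rewrite -[l]cats0; apply: realizable_all => //.
  by rewrite nl cats0; apply: realizable1.
exists z; apply: ptfun_eq => k c k0; apply/eqP.
rewrite -(@eqn_pmul2l (k + (c == c0))) ?addn_gt0 ?k0 // mult_mtype //.
rewrite (hz (fun a d => (a == k + (c == c0)) && (d == c))).
rewrite (sl (fun a d => a * ((a == k + (c == c0)) && (d == c))))%N.
rewrite (bigD1 c) //= [X in _ + X]big1 ?addn0; last first.
  by move=> d /negPf dc; rewrite big1 // => a _; rewrite dc andbF muln0.
have e (s : seq nat) a :
    \sum_(k' <- s) ((k' + a) * ((k' + a == k + a) && (c == c)))%N = ((k + a) * count_mem k s)%N.
  rewrite -(sum_indicator s (fun b => b + a)%N k); apply: eq_bigr => b _.
  by rewrite eqxx andbT eqn_add2r eq_sym.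
by rewrite e.
Qed.

End Existence.

(** * From counts of factorizations to coefficients in the ring *)

Section StructureConstants.
Import GRing.Theory.
Context {gT : finGroupType}.
Implicit Types (lam mu nu : ptfun gT).

(** For each second factor [y] the first one is forced to be [z * y^-1]. *)
Lemma convolution_class_sum n lam mu (z : wreath gT n) :
  convolution (class_sum n lam) (class_sum n mu) z
  = (#|[set y : wreath gT n | (mtype y == mu) && (mtype (z * y^-1)%g == lam)]|)%:Z%R.
Proof.
rewrite /convolution ffunE (exchange_big_dep xpredT) //=.
rewrite (eq_bigr (fun y => ((mtype y == mu) && (mtype (z * y^-1)%g == lam))%:R%R)).
  rewrite -natz -sum1_card natr_sum big_mkcond [RHS]big_mkcond /=; apply: eq_bigr => y _.
  by rewrite inE; case: (_ && _).
move=> y _; rewrite (big_pred1 (z * y^-1)%g) => [|x].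
  by rewrite !ffunE andbC; do 2!case: (_ == _); rewrite ?mulr1 ?mulr0 ?mul0r.
by rewrite /= -(can2_eq (mulgK y) (mulgKV y)).
Qed.

Lemma stable_constE lam mu nu : exists n, exists2 z : wreath gT n, mtype z = nu
  & stable_const lam mu nu
    = (#|[set y : wreath gT n | (mtype y == mu) && (mtype (z * y^-1)%g == lam)]|)%:Z%R.
Proof.
rewrite /stable_const /structure_const; set n := norm nu + _.
case: pickP => [z /eqP mz|no].
  by exists n, z => //; rewrite convolution_class_sum.
have [z mz] := @mtype_exists gT n nu erefl.
by have := no z; rewrite mz eqxx.
Qed.

(** The family is empty, and any cycle other than a fixed point of trivial monodromy would
    contribute a positive part. *)
Lemma mtype_single0 n (y : wreath gT n) : (mtype y == single 0 c0) = (y == 1%g).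
Proof.
apply/eqP/eqP => [my|->].
  have T c k : 0 < k -> \sum_i ((len y i == k + (c == c0)) && (cls y i == c)) = 0.
    by move=> k0; rewrite -mult_mtype // my mult_single // (gtn_eqF k0) andbF muln0.
  have ly i : len y i = (cls y i == c0).
    apply/eqP/negPn/negP => ne; have l0 := len_gt0 y i.
    have k0 : 0 < len y i - (cls y i == c0) by case: (cls y i == c0) ne; lia.
    have := T (cls y i) _ k0; rewrite subnK; last by case: (cls y i == c0) ne; lia.
    by rewrite (bigD1 i) //= !eqxx.
  apply: wact_ext => u; rewrite wact1.
  have cu : cls y u.1 = c0 by have := len_gt0 y u.1; rewrite ly; case: eqP.
  have lu : len y u.1 = 1 by rewrite ly cu eqxx.
  have := iter_mono y u; rewrite lu /= => ->.
  by move/eqP: cu; rewrite cls_c0 => /eqP ->; rewrite rt1.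
have one i : len (1%g : wreath gT n) i = 1 /\ cls (1%g : wreath gT n) i = c0.
  have [l1 m1] := fix_point (wact1 ((i, 1%g) : 'I_n * gT)).
  by split=> //; apply/eqP; rewrite -[i]/((i, 1%g : gT).1) cls_c0 m1.
apply: ptfun_eq => k c k0; rewrite mult_single // (gtn_eqF k0) andbF.
apply/eqP; rewrite -(@eqn_pmul2l (k + (c == c0))) ?addn_gt0 ?k0 // mult_mtype //.
rewrite muln0 big1 // => i _; have [-> ->] := one i.
by rewrite [c0 == c]eq_sym; case: (c == c0); rewrite ?andbF // addn1 andbT eqSS (ltn_eqF k0).
Qed.

Local Open Scope ring_scope.

Lemma mcoeff_mulK lam mu nu : (mulK lam mu)@_nu
  = if norm nu == (norm lam + norm mu)%N then stable_const lam mu nu else 0.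
Proof.
rewrite /mulK raddf_sum /=.
rewrite (eq_bigr (fun k => if k == nu then stable_const lam mu nu else 0)); last first.
  move=> k _; rewrite raddfMz /= mcoeffU; case: eqP => [->|_]; last by rewrite mul0rz.
  by rewrite intz.
rewrite -mem_funs_of_norm; case: ifP => h; last first.
  by rewrite big1_seq // => k /andP[_ kl]; case: eqP => // e; rewrite -e kl in h.
rewrite (bigD1_seq nu) ?undup_uniq //= eqxx big1 ?addr0 // => k /negPf -> //.
Qed.

End StructureConstants.

Section Coefficients.
Context {gT : finGroupType}.
Implicit Types (lam nu A B : ptfun gT).

Lemma norm_fdiff A B : (forall k c, mult k (B c) <= mult k (A c)) ->
  norm A = norm (fdiff A B) + norm B.
Proof.
move=> h; rewrite -norm_funion; congr norm; apply: ptfun_eq => k c _.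
by rewrite mult_funion mult_fdiff subnK.
Qed.

Local Open Scope ring_scope.
Import GRing.Theory.

Lemma mcoeff_K lam nu a : (K lam *+ a)@_nu = ((lam == nu) * a)%N%:R :> int.
Proof. by rewrite mcoeffMn mcoeffU mulnC mulrnA; case: eqP; rewrite ?mul0rn. Qed.

End Coefficients.

Import GRing.Theory.
Local Open Scope ring_scope.

(* For r = 0 the five sums do not give the product: with lam = (1)_{c0} they
   contain the term 4 K_lam for m = (1), although K_{(0)} is the identity. *)
Theorem theorem3p4 (gT : finGroupType) (lam : ptfun gT) (r : nat) :
  (r = 0%N -> FHmul (K lam) (K (single r c0)) = K lam) /\
  ((0 < r)%N ->
   FHmul (K lam) (K (single r c0)) =
     \sum_(m <- subpartns (lam c0) | (size m <= r.+1)%N)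
       K (fdiff (funion lam (single (psize m + r) c0)) (at_class c0 m))
       *+ (((mult (psize m + r) (lam c0)).+1 * (psize m + r).+1 * r`!)
           %/ ((r.+1 - size m)`! * mfact m))%N
   + \sum_(c : cclass gT | c != c0)
     \sum_(m <- subpartns (lam c0) | (size m <= r)%N)
     \sum_(k <- undup (lam c))
       K (fdiff (funion lam (single (psize m + r + k) c))
                (funion (at_class c0 m) (single k c)))
       *+ (((mult (psize m + r + k) (lam c)).+1 * (psize m + r + k) * r`!)
           %/ ((r - size m)`! * mfact m))%N
   + \sum_(c : cclass gT | c != c0)
     \sum_(m <- subpartns (lam c0) | (size m <= r)%N)
     \sum_(s1 < (psize m + r).+1)
     \sum_(s2 < (psize m + r).+1 | [&& 0 < s1, s1 < s2 & s1 + s2 == psize m + r]%N)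
       K (fdiff (funion (funion lam (single s1 c)) (single s2 (cbar c)))
                (at_class c0 m))
       *+ (s1 * s2 * zeta c * pcount m r s1
           * (mult s1 (lam c)).+1 * (mult s2 (lam (cbar c))).+1)%N
   + \sum_(c : cclass gT | pair_rep c)
     \sum_(m <- subpartns (lam c0) | (size m <= r)%N)
     \sum_(s < (psize m + r).+1 | (2 * s == psize m + r)%N)
       K (fdiff (funion (funion lam (single s c)) (single s (cbar c)))
                (at_class c0 m))
       *+ (s ^ 2 * zeta c * pcount m r s
           * (mult s (lam c)).+1 * (mult s (lam (cbar c))).+1)%N
   + \sum_(c : cclass gT | (c == cbar c) && (c != c0))
     \sum_(m <- subpartns (lam c0) | (size m <= r)%N)
     \sum_(s < (psize m + r).+1 | (2 * s == psize m + r)%N)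
       K (fdiff (funion (funion lam (single s c)) (single s c))
                (at_class c0 m))
       *+ (s ^ 2 * zeta c * pcount m r s * 'C((mult s (lam c)).+2, 2))%N).
Proof.
split=> [->|r0]; rewrite FHmulK; apply/malgP => nu.
  rewrite mcoeff_mulK norm_single addn0 mcoeffU.
  case: (eqVneq (norm nu) (norm lam)) => hn; last first.
    by case: eqP => // e; rewrite -e eqxx in hn.
  have [n [z mz ->]] := stable_constE lam (single 0 c0) nu.
  rewrite -natz; congr (_%:R).
  rewrite (_ : [set y | _] = if lam == nu then [set 1%g] else set0).
    by case: eqP; rewrite ?cards1 ?cards0.
  apply/setP => y; rewrite inE mtype_single0.
  have [->|ny] /= := eqVneq y 1%g.
    by rewrite invg1 mulg1 mz [nu == lam]eq_sym; case: (lam == nu); rewrite !inE ?eqxx.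
  by case: (lam == nu); rewrite !inE ?(negPf ny).
(* [X] is the coefficient of [K nu] on the right-hand side, written in the shape of
   [count_factor_total]. *)
pose X : nat := (\sum_(m <- subpartns (lam c0) | size m <= r.+1)
      (fdiff (funion lam (single (psize m + r) c0)) (at_class c0 m) == nu) * cut_coef lam r m
   + \sum_(c : cclass gT | c != c0)
     \sum_(m <- subpartns (lam c0) | size m <= r)
     \sum_(k <- undup (lam c))
       (fdiff (funion lam (single (psize m + r + k) c))
                (funion (at_class c0 m) (single k c)) == nu)
       * ((((mult (psize m + r + k) (lam c)).+1 * (psize m + r + k) * r`!)
           %/ ((r - size m)`! * mfact m)))
   + (
     \sum_(c : cclass gT | c != c0)
     \sum_(m <- subpartns (lam c0) | size m <= r)
     \sum_(s1 < (psize m + r).+1)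
     \sum_(s2 < (psize m + r).+1 | [&& 0 < s1, s1 < s2 & s1 + s2 == psize m + r])
       (fdiff (funion (funion lam (single s1 c)) (single s2 (cbar c)))
                (at_class c0 m) == nu)
       * (s1 * s2 * zeta c * pcount m r s1
           * (mult s1 (lam c)).+1 * (mult s2 (lam (cbar c))).+1)
   + \sum_(c : cclass gT | pair_rep c)
     \sum_(m <- subpartns (lam c0) | size m <= r)
     \sum_(s < (psize m + r).+1 | 2 * s == psize m + r)
       (fdiff (funion (funion lam (single s c)) (single s (cbar c)))
                (at_class c0 m) == nu)
       * (s ^ 2 * zeta c * pcount m r s
           * (mult s (lam c)).+1 * (mult s (lam (cbar c))).+1)
   + \sum_(c : cclass gT | (c == cbar c) && (c != c0))
     \sum_(m <- subpartns (lam c0) | size m <= r)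
     \sum_(s < (psize m + r).+1 | 2 * s == psize m + r)
       (fdiff (funion (funion lam (single s c)) (single s c))
                (at_class c0 m) == nu)
       * (s ^ 2 * zeta c * pcount m r s * 'C((mult s (lam c)).+2, 2))))%N.
transitivity (X%:R : int); last first.
  rewrite !mcoeffD /X !natrD !addrA !natr_sum !raddf_sum /=.
  congr (_ + _ + _ + _ + _).
  - by apply: eq_bigr => m _; rewrite mcoeff_K.
  - apply: eq_bigr => c _; rewrite natr_sum raddf_sum; apply: eq_bigr => m _.
    rewrite natr_sum raddf_sum; apply: eq_bigr => k _; exact/esym/mcoeff_K.
  - apply: eq_bigr => c _; rewrite natr_sum raddf_sum; apply: eq_bigr => m _.
    rewrite natr_sum raddf_sum; apply: eq_bigr => s1 _.
    rewrite natr_sum raddf_sum; apply: eq_bigr => s2 _; exact/esym/mcoeff_K.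
  - apply: eq_bigr => c _; rewrite natr_sum raddf_sum; apply: eq_bigr => m _.
    rewrite natr_sum raddf_sum; apply: eq_bigr => s _; exact/esym/mcoeff_K.
  - apply: eq_bigr => c _; rewrite natr_sum raddf_sum; apply: eq_bigr => m _.
    rewrite natr_sum raddf_sum; apply: eq_bigr => s _; exact/esym/mcoeff_K.
rewrite mcoeff_mulK norm_single; case: eqP => [hn|/eqP hn].
  have [n [z mz ->]] := stable_constE lam (single r c0) nu.
  rewrite -natz; congr (_%:R); rewrite /X -mz.
  by rewrite -mz in hn; exact: count_factor_total.
(* Here [nu] has the wrong norm, whereas every family indexing a term on the right has norm
   [norm lam + r]: what is added exceeds what is removed by exactly [r]. Hence every indicator
   vanishes. *)
suff -> : X = 0%N by [].
have N1 A m (e : fdiff (funion lam A) (at_class c0 m) == nu) :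
    m \in subpartns (lam c0) -> norm A <> (psize m + r)%N.
  move=> ml hA; case/eqP: hn.
  have := @norm_fdiff _ (funion lam A) (at_class c0 m) (fun k c => mult_at_sub A k c ml).
  rewrite norm_funion norm_at_class hA (eqP e); lia.
have N2 (A B : ptfun gT) m : m \in subpartns (lam c0) -> (norm A + norm B = psize m + r)%N ->
    (fdiff (funion (funion lam A) B) (at_class c0 m) == nu) = false.
  move=> ml hA; apply/negP => e; apply: (N1 (funion A B) m _ ml); last by rewrite norm_funion.
  rewrite -(eqP e); apply/eqP; congr (fdiff _ _); apply: ptfun_eq => k c _.
  by rewrite !mult_funion addnA.
have Z1 : (\sum_(m <- subpartns (lam c0) | size m <= r.+1)
    (fdiff (funion lam (single (psize m + r) c0)) (at_class c0 m) == nu)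
    * cut_coef lam r m = 0)%N.
  apply: big1_seq => m /andP[_ ml]; case: (boolP (_ == nu)) => // e.
  by case: (N1 _ _ e ml); rewrite norm_single.
have Z2 (c : cclass gT) (m : Defs.partn) (k : nat) (a : nat) : c != c0 ->
    m \in subpartns (lam c0) -> k \in undup (lam c) ->
    ((fdiff (funion lam (single (psize m + r + k) c))
       (funion (at_class c0 m) (single k c)) == nu) * a = 0)%N.
  move=> cc ml; rewrite mem_undup => kl; case: (boolP (_ == nu)) => // e.
  case/eqP: hn; have := @norm_fdiff _ (funion lam (single (psize m + r + k) c))
    (funion (at_class c0 m) (single k c))
    (fun a d => mult_at_single_sub _ a d cc ml kl).
  rewrite !norm_funion !norm_at_class !psize_mkpartn (eqP e) /=; lia.
have Z3 A B (m : Defs.partn) (a : nat) : m \in subpartns (lam c0) ->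
    (norm A + norm B = psize m + r)%N ->
    ((fdiff (funion (funion lam A) B) (at_class c0 m) == nu) * a = 0)%N.
  by move=> ml hA; rewrite N2.
rewrite /X Z1 add0n; apply/eqP; rewrite !addn_eq0 -!andbA; apply/and4P; split.
- apply/eqP/big1 => c cc; apply: big1_seq => m /andP[_ ml].
  by apply: big1_seq => k /andP[_ kl]; apply: Z2.
- apply/eqP/big1 => c cc; apply: big1_seq => m /andP[_ ml].
  apply: big1 => s1 _; apply: big1 => s2 /and3P[_ _ /eqP hs].
  by apply: Z3; rewrite ?norm_single.
- apply/eqP/big1 => c cc; apply: big1_seq => m /andP[_ ml].
  apply: big1 => s /eqP hs; apply: Z3; rewrite ?norm_single //.
  by rewrite addnn -mul2n.
- apply/eqP/big1 => c cc; apply: big1_seq => m /andP[_ ml].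
  apply: big1 => s /eqP hs; apply: Z3; rewrite ?norm_single //.
  by rewrite addnn -mul2n.
Qed.
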